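(* Let $X$ be a real-valued Lévy process with $\lim_{t\to\infty}X_t=-\infty$ a.s., let $Q$ be the associated workload process started from its stationary distribution, let $\underline Q_t=\inf_{s\in[0,t]}Q_s$, and let $e_q$ be an independent exponential random variable with rate $q$. Then for any $\theta,q\ge 0$, $$\mathbb E\, e^{-\theta\underline Q_{e_q}}=\frac{\overline\kappa(0,0)}{\overline\kappa(0,\theta)}\,\frac{\overline\kappa(q,\theta)}{\overline\kappa(q,0)}.$$
   Context: $X=(X_t)_{t\ge0}$ is a real-valued càdlàg Lévy process with $X_0=0$ (jumps of both signs are allowed), and it is assumed that $\lim_{t\to\infty}X_t=-\infty$ a.s. Write $\underline X_t=\inf_{s\in[0,t]}X_s$, $\overline X_t=\sup_{s\in[0,t]}X_s$, $\overline X=\overline X_\infty=\sup_{s\ge 0}X_s$. The workload process is $Q_t=Q_0\vee(-\underline X_t)+X_t$, $t\ge0$, where $Q_0\ge 0$ is independent of $X$ and has the stationary workload distribution, i.e. $Q_0$ has the same distribution as $\overline X$. For $q>0$, $e_q$ is an exponential random variable with rate $q$ (mean $1/q$), independent of $(X,Q_0)$; for $q=0$ one reads $e_0=\infty$ and $\underline Q_\infty=\inf_{s\ge0}Q_s$. For $\alpha,\beta\in\mathbb C$ with $\Re(\alpha),\Re(\beta)\ge0$, $$\overline\kappa(\alpha,\beta)=\exp\left(\int_0^\infty\int_{(0,\infty)}\left(e^{-t}-e^{-\alpha t-\beta x}\right)\frac1t\,\mathbb P(X_t\in dx)\,dt\right)$$ (the Laplace exponent of the strictly ascending bivariate ladder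 process). *)

(* Defs.v *)
From HB Require Import structures.
From mathcomp Require Import all_boot all_order all_algebra.
From mathcomp Require Import all_classical all_reals all_analysis.
From mathcomp Require Import measurable_realfun complex.

Set Implicit Arguments.
Unset Strict Implicit.
Unset Printing Implicit Defensive.

Import Order.TTheory GRing.Theory Num.Theory.
Import numFieldNormedType.Exports.

Local Open Scope classical_set_scope.
Local Open Scope ring_scope.
Local Open Scope complex_scope.

Definition cexp (R : realType) (z : R[i]) : R[i] :=
  (expR (complex.Re z))%:C *
  (cos (complex.Im z) +i* sin (complex.Im z)).

Definition cintegral (R : realType) (d : measure_display)
    (T : measurableType d) (mu : {measure set T -> \bar R}) (D : set T)
    (f : T -> R[i]) : R[i] :=
  (\int[mu]_(x in D) complex.Re (f x)) +i*
  (\int[mu]_(x in D) complex.Im (f x)).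

Definition same_law (R : realType) (d d' : measure_display)
    (T : measurableType d) (T' : measurableType d') (P : probability T R)
    (f g : T -> T') : Prop :=
  forall A : set T', measurable A -> P (f @^-1` A) = P (g @^-1` A).

Definition independent_fun (R : realType) (d d' : measure_display)
    (T : measurableType d) (T' : measurableType d') (P : probability T R)
    (n : nat) (Y : nat -> T -> T') : Prop :=
  forall A : nat -> set T', (forall i, measurable (A i)) ->
    P (\bigcap_(i < n) (Y i @^-1` A i)) =
    (\prod_(i < n) P (Y i @^-1` A i))%E.

Definition independent_sets (R : realType) (d : measure_display)
    (T : measurableType d) (P : probability T R) (F G : set (set T)) : Prop :=
  forall A B : set T, F A -> G B -> P (A `&` B) = (P A * P B)%E.

Definition sigma_fun (d d' : measure_display) (T : measurableType d)
    (T' : measurableType d') (f : T -> T') : set (set T) :=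
  preimage_set_system setT f measurable.

(** A process is indexed by all of [R], but only the times [0 <= t] are ever
    used; its values at negative times are irrelevant. *)
Definition sigma_process (R : realType) (d : measure_display)
    (T : measurableType d) (X : R -> T -> R) : set (set T) :=
  <<s \bigcup_(t in `[0, +oo[) sigma_fun (X t) >>.

Definition sigma_process_fun (R : realType) (d : measure_display)
    (T : measurableType d) (X : R -> T -> R) (Y : T -> R) : set (set T) :=
  <<s (\bigcup_(t in `[0, +oo[) sigma_fun (X t)) `|` sigma_fun Y >>.

(** [exponential_prob 0] is the zero measure, so the rate [0] is separate. *)
Definition exponential_time (R : realType) (d : measure_display)
    (T : measurableType d) (P : probability T R) (q : R) (e : T -> \bar R)
    : Prop :=
  if q == 0 then forall w, e w = +oo%E
  else forall A : set (\bar R), measurable A ->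
    P (e @^-1` A) = exponential_prob q (EFin @^-1` A).

Definition cadlag (R : realType) (f : R -> R) : Prop :=
  (forall t, 0 <= t -> f x @[x --> t^'+] --> f t) /\
  (forall t, 0 < t -> cvg (f x @[x --> t^'-])).

Record levy_process (R : realType) (d : measure_display)
    (T : measurableType d) (P : probability T R) (X : R -> {RV P >-> R})
    : Prop := LevyProcess {
  levy_start : forall w, X 0 w = 0 ;
  levy_cadlag : forall w, cadlag (fun t => X t w) ;
  levy_stationary : forall s t, 0 <= s -> 0 <= t ->
    same_law P (fun w => X (s + t) w - X s w) (X t) ;
  levy_independent : forall (n : nat) (t : nat -> R),
    0 <= t 0%N -> (forall i, t i <= t i.+1) ->
    independent_fun P n (fun i w => X (t i.+1) w - X (t i) w) }.

(** [running_inf f s] is the infimum of [f] over the times [u] with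
    [0 <= u <= s]; for [s = +oo] it is the infimum over all times. The set is
    nonempty and bounded below wherever this is used with [0 <= s]: càdlàg
    functions are bounded on compact intervals, and the workload is
    nonnegative. *)
Definition running_inf (R : realType) (f : R -> R) (s : \bar R) : R :=
  inf [set f u | u in [set u : R | 0 <= u /\ (u%:E <= s)%E]].

Definition overall_sup (R : realType) (f : R -> R) : \bar R :=
  ereal_sup [set (f t)%:E | t in `[0, +oo[].

Definition workload (R : realType) (q0 : R) (f : R -> R) (t : R) : R :=
  Num.max q0 (- running_inf f t%:E) + f t.

(** Intended for [a], [b] with nonnegative real part only: elsewhere the
    integrals need not converge, and then take a default value. *)
Definition kappa_bar (R : realType) (d : measure_display)
    (T : measurableType d) (P : probability T R) (X : R -> {RV P >-> R})
    (a b : R[i]) : R[i] :=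
  cexp (cintegral lebesgue_measure `]0, +oo[ (fun t : R =>
    cintegral (distribution P (X t)) `]0, +oo[ (fun x : R =>
      (cexp (- t%:C) - cexp (- a * t%:C - b * x%:C)) * (t^-1)%:C))).

(* Main.v *)
Require Import Defs.
From HB Require Import structures.
From mathcomp Require Import all_boot all_order all_algebra.
From mathcomp Require Import all_classical all_reals all_analysis.
From mathcomp Require Import measurable_realfun complex ring lra zify.

Set Implicit Arguments.
Unset Strict Implicit.
Unset Printing Implicit Defensive.

Import Order.TTheory GRing.Theory Num.Theory.
Import numFieldNormedType.Exports.

Local Open Scope classical_set_scope.
Local Open Scope ring_scope.

(** Write [X^+] for the positive part of [X], [I_t] and [M_t] for the running
    infimum and supremum of [X], and [M] for the overall supremum. The infimum of
    the workload up to time [t] is [(Q_0 + I_t)^+] ([running_inf_workload]), so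
    the left-hand side is the Laplace transform of [(Q_0 + I_e)^+], with [Q_0],
    [X] and [e] independent. The theorem is the formula
<<
      E exp(-theta (Q_0 + I_e)^+)
        = exp(- int_0^oo (1 - exp(-q t)) E (1 - exp(-theta X_t^+)) / t dt)
>>
    ([killed_workload_exponent]), combined with the cancellation of the other
    terms in the four exponents on the right.

    The formula comes from random walks. Cutting a walk at the first time at
    which it reaches its maximum makes the two parts independent
    ([first_argmax]). This gives Spitzer's identity for the transform of the
    maximum ([wmax_wpos], [pseries_expR_gap]), and a second identity
    ([wmax_wmaxmin]): up to the horizon, the transform of [M] is the product of
    the transform of [M_e], where [e] is an independent geometric time, and of
    the transform of [(M' + I_e)^+], where [M'] is an independent copy of [M].
    Both are identities between finite sums when the steps take finitely many
    values; rounding the steps extends them to all step laws.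

    They are applied to the skeletons of [X] on dyadic grids, whose mesh tends to
    0 while the horizon tends to infinity. An exponential time rounded to a grid
    is geometric, and [Q_0] has the law of [M]; hence the second identity
    becomes, in the limit,
    [E exp(-theta Q_0) = E exp(-theta M_e) * E exp(-theta (Q_0 + I_e)^+)]
    ([killed_maxmin_cvg], [killed_workload_cvg]). By Spitzer's identity, minus
    the logarithm of the transform of [M_e] is on each grid a Riemann sum for the
    integral of [exp(-q t) E (1 - exp(-theta X_t^+)) / t]. Riemann sums are easy
    to control only for the difference of two rates [p < q], where the
    singularity at 0 cancels. The missing constant is found by letting [p] go to
    0, where [M_e] tends to [M], whose law is that of [Q_0]
    ([double_limit_unique]).

    At real arguments, the exponent of [kappa_bar] at [(a, b)] is the integral
    of [(exp(-t) - exp(-a t)) P(X_t > 0) / t +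
    exp(-a t) E (1 - exp(-b X_t^+)) / t] ([kappa_bar_real]). In the ratio the
    terms with [P(X_t > 0)] cancel, provided that they are integrable, and the
    other ones give the integral above ([kappa_exponents_telescope]).
    Integrability at [a = 0] follows from the formula itself, for [theta] going
    to infinity: the left-hand side stays above the probability that the workload
    is emptied before [e], which is positive as [X] drifts to minus infinity
    ([killed_workload_bounded_below], [integrable_pos_prob_killed]). For [q = 0]
    the workload is emptied almost surely and both sides are 1. *)

(** * Convolutions of sequences *)

Definition conv (R : realType) (x y : nat -> R) (n : nat) : R :=
  \sum_(i < n.+1) x i * y (n - i)%N.

(** Truncating both sequences to polynomials transfers associativity and
    commutativity from polynomial multiplication. *)
Lemma convE (R : realType) (x y : nat -> R) N n : (n < N)%N ->
  conv x y n = (\poly_(i < N) x i * \poly_(i < N) y i)`_n.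
Proof.
move=> nN; rewrite coefM; apply: eq_bigr => i _; rewrite !coef_poly.
by rewrite (leq_ltn_trans _ nN) ?leq_ord// (leq_ltn_trans _ nN) ?leq_subr.
Qed.

Lemma eq_conv (R : realType) (x x' y y' : nat -> R) :
  x =1 x' -> y =1 y' -> conv x y =1 conv x' y'.
Proof. by move=> ex ey n; apply: eq_bigr => i _; rewrite ex ey. Qed.

Lemma coef_trunc_eq (R : realType) (p p' q q' : {poly R}) N n : (n < N)%N ->
  (forall i, (i < N)%N -> p`_i = p'`_i) -> (forall i, (i < N)%N -> q`_i = q'`_i) ->
  (p * q)`_n = (p' * q')`_n.
Proof.
move=> nN ep eq; rewrite !coefM; apply: eq_bigr => i _.
by rewrite ep ?eq// (leq_ltn_trans _ nN) ?leq_subr// leq_ord.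
Qed.

Lemma coef_conv (R : realType) (x y : nat -> R) N i : (i < N)%N ->
  (\poly_(i < N) conv x y i)`_i = (\poly_(i < N) x i * \poly_(i < N) y i)`_i.
Proof. by move=> iN; rewrite coef_poly iN; exact: convE. Qed.

Lemma convA (R : realType) (x y z : nat -> R) :
  conv x (conv y z) =1 conv (conv x y) z.
Proof.
move=> n; rewrite !(@convE _ _ _ n.+1)//.
set X := \poly_(_ < _) x _; set Z := \poly_(_ < _) z _.
rewrite (@coef_trunc_eq _ X X _ _ n.+1 n _ _ (coef_conv y z (N := n.+1)))//.
by rewrite mulrA; apply: (@coef_trunc_eq _ _ _ _ _ n.+1) => // i iN; rewrite coef_conv.
Qed.

Lemma convC (R : realType) (x y : nat -> R) : conv x y =1 conv y x.
Proof. by move=> n; rewrite !(@convE _ _ _ n.+1)// mulrC. Qed.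

Lemma convACA (R : realType) (x y z t : nat -> R) :
  conv (conv x y) (conv z t) =1 conv (conv x t) (conv z y).
Proof.
move=> n; rewrite -!convA.
apply: eq_conv => // {}n; rewrite [LHS]convC [RHS]convA.
by apply: eq_conv => // {}n; rewrite convC.
Qed.

(** The workhorse behind every rearrangement of iterated convolutions. *)
Lemma sum_triangle (V : nmodType) (G : nat -> nat -> V) N :
  \sum_(m < N.+1) \sum_(k < m.+1) G m k =
  \sum_(k < N.+1) \sum_(j < (N - k).+1) G (k + j)%N k.
Proof.
elim: N => [|N IH]; first by rewrite !big_ord1.
rewrite big_ord_recr/= IH [RHS]big_ord_recr/= subnn [X in _ = _ + X]big_ord1 addn0.
rewrite [X in _ + X]big_ord_recr/= addrA -big_split/=; congr (_ + _).
apply: eq_bigr => k _; rewrite subSn ?leq_ord// [RHS]big_ord_recr/=.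
by rewrite addnS subnKC// leq_ord.
Qed.

(** * Words of independent steps with a finite law *)

Section words.
Context {R : realType} (vs : seq R) (p : R -> R).

(** The expectation of [F] over words of [n] independent letters of law [p] on
    the finite alphabet [vs]. With a finite law, Fubini, time reversal and
    cutting a word into independent pieces are identities between finite sums. *)
Fixpoint Ex (n : nat) (F : seq R -> R) : R :=
  if n is n'.+1 then \sum_(v <- vs) p v * Ex n' (fun s => F (v :: s))
  else F [::].

Lemma eq_Ex n F G : (forall s, size s = n -> F s = G s) -> Ex n F = Ex n G.
Proof.
elim: n F G => [|n IH] F G FG /=; first exact: FG.
apply: eq_bigr => v _; congr (_ * _); apply: IH => s sn.
by apply: FG; rewrite /= sn.
Qed.

Lemma ExZ n c F : Ex n (fun s => c * F s) = c * Ex n F.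
Proof.
elim: n F => [//|n IH] F /=; rewrite mulr_sumr; apply: eq_bigr => v _.
by rewrite IH mulrCA.
Qed.

Lemma ExZr n c F : Ex n (fun s => F s * c) = Ex n F * c.
Proof. by rewrite mulrC -ExZ; apply: eq_Ex => s _; rewrite mulrC. Qed.

Lemma Ex_sum I (r : seq I) n (F : I -> seq R -> R) :
  Ex n (fun s => \sum_(i <- r) F i s) = \sum_(i <- r) Ex n (F i).
Proof.
elim: n F => [//|n IH] F /=; rewrite exchange_big/=; apply: eq_bigr => v _.
by rewrite IH mulr_sumr.
Qed.

Lemma Ex_cat m n F :
  Ex (m + n) F = Ex m (fun s => Ex n (fun t => F (s ++ t))).
Proof.
elim: m F => [//|m IH] F /=; apply: eq_bigr => v _; congr (_ * _).
by rewrite IH.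
Qed.

Lemma Ex_swap m n (F : seq R -> seq R -> R) :
  Ex m (fun s => Ex n (F s)) = Ex n (fun t => Ex m (fun s => F s t)).
Proof.
elim: m F => [//|m IH] F /=; rewrite Ex_sum; apply: eq_bigr => v _.
by rewrite IH ExZ.
Qed.

Lemma Ex_prod m n F G :
  Ex m (fun s => Ex n (fun t => F s * G t)) = Ex m F * Ex n G.
Proof. by rewrite -ExZr; apply: eq_Ex => s _; rewrite ExZ. Qed.

Lemma Ex_rev n F : Ex n (F \o rev) = Ex n F.
Proof.
elim: n F => [//|n IH] F; rewrite -[in RHS]addn1.
rewrite Ex_cat (Ex_swap n 1)/=; apply: eq_bigr => v _; congr (_ * _).
by rewrite -(IH (fun s => F (s ++ [:: v])))/=; apply: eq_Ex => s _ /=;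
  rewrite rev_cons -cats1.
Qed.

Hypothesis p1 : \sum_(v <- vs) p v = 1.

Lemma Ex_cst n c : Ex n (fun=> c) = c.
Proof. by elim: n => [//|n IH] /=; rewrite IH -mulr_suml p1 mul1r. Qed.

(** The two pieces of a word cut at a fixed place are independent: a sum over
    all cuts thus becomes a convolution. *)
Lemma Ex_split n (H : seq R -> seq R -> R) :
  Ex n (fun s => \sum_(k < n.+1) H (take k s) (drop k s)) =
  \sum_(k < n.+1) Ex k (fun s => Ex (n - k) (fun t => H s t)).
Proof.
rewrite Ex_sum; apply: eq_bigr => k _.
rewrite -{1}(subnKC (leq_ord k)) Ex_cat; apply: eq_Ex => s ss.
by apply: eq_Ex => t _; rewrite take_size_cat// drop_size_cat.
Qed.

End words.

(** * Extrema of a walk *)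

Definition lsum (R : realType) (s : seq R) : R := \sum_(x <- s) x.

(** The maximum over all partial sums, the empty one included, written as a
    recursion on the first step. *)
Definition lmax (R : realType) (s : seq R) : R :=
  foldr (fun x m => Num.max 0 (x + m)) 0 s.

Definition lmin (R : realType) (s : seq R) : R :=
  foldr (fun x m => Num.min 0 (x + m)) 0 s.

(** Every nonempty suffix has a positive sum: the walk ends strictly above all
    its earlier positions. *)
Fixpoint record (R : realType) (s : seq R) : bool :=
  if s is _ :: s' then record s' && (0 < lsum s) else true.

Section extrema.
Context {R : realType}.
Implicit Types s t : seq R.

Lemma lsum_nil : lsum [::] = 0 :> R.
Proof. by rewrite /lsum big_nil. Qed.

Lemma lsum_cons x s : lsum (x :: s) = x + lsum s.
Proof. by rewrite /lsum big_cons. Qed.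

Lemma lsum_cat s t : lsum (s ++ t) = lsum s + lsum t.
Proof. by rewrite /lsum big_cat. Qed.

Lemma lmax_ge0 s : 0 <= lmax s.
Proof. by case: s => [//|x s] /=; rewrite le_max lexx. Qed.

Lemma lmin_le0 s : lmin s <= 0.
Proof. by case: s => [//|x s] /=; rewrite ge_min lexx. Qed.

Lemma lmax_cat s t : lmax (s ++ t) = Num.max (lmax s) (lsum s + lmax t).
Proof.
elim: s => [|x s IH] /=.
  by rewrite /lsum big_nil add0r; apply/esym/max_idPr/lmax_ge0.
by rewrite IH lsum_cons -maxA addr_maxr addrA.
Qed.

Lemma lmin_cat s t : lmin (s ++ t) = Num.min (lmin s) (lsum s + lmin t).
Proof.
elim: s => [|x s IH] /=.
  by rewrite /lsum big_nil add0r; apply/esym/min_idPr/lmin_le0.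
by rewrite IH lsum_cons -minA addr_minr addrA.
Qed.

(** Reversing the steps turns the partial sum at time [k] into the final
    position minus the partial sum at time [n - k]. *)
Lemma lmin_rev s : lmin (rev s) = lsum s - lmax s.
Proof.
elim: s => [|x s IH]; first by rewrite /lsum /= big_nil subr0.
rewrite rev_cons -cats1 lmin_cat IH lsum_cons /= addr0.
have -> : lsum (rev s) = lsum s by rewrite /lsum big_rev.
move: (lsum s) (lmax s) (lmax_ge0 s) => L M M0.
case: (leP 0 x) => h1; case: (leP 0 (x + M)) => h2;
  case: (leP (L - M)) => h3; lra.
Qed.

(** The maximum of the walk is reached for the first time at exactly one time
    [k]: then the walk has a strict record at [k] and stays below its value
    at [k] afterwards. *)
Lemma first_argmax s (G : R -> R) :
  \sum_(k < (size s).+1)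
    (record (take k s) && (lmax (drop k s) <= 0))%:R * G (lsum (take k s)) =
  G (lmax s).
Proof.
elim: s G => [|x s IH] G.
  by rewrite big_ord1 /= lexx mul1r /lsum big_nil.
rewrite big_ord_recl/= lsum_nil.
rewrite [X in _ + X](_ : _ = \sum_(k < (size s).+1)
    (record (take k s) && (lmax (drop k s) <= 0))%:R *
    ((0 < x + lsum (take k s))%R%:R * G (x + lsum (take k s)))); last first.
  apply: eq_bigr => k _; rewrite add0n lsum_cons.
  by rewrite mulrA -natrM mulnb andbAC.
rewrite (IH (fun y => (0 < x + y)%R%:R * G (x + y))).
rewrite ge_max lexx /=.
by case: (leP (x + lmax s) 0) => _; rewrite ?mul1r ?mul0r ?add0r ?addr0.
Qed.

End extrema.

(** * The Wiener-Hopf identities of a walk with finitely many step values *)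

Section identities.
Context {R : realType} (vs : seq R) (p : R -> R) (th : R).
Hypothesis p1 : \sum_(v <- vs) p v = 1.

Local Notation EE := (Ex vs p).
(** The Laplace functional of the positive part. *)
Definition eminus (z : R) : R := expR (- th * Num.max z 0).
Let up (s : seq R) : R := (record s)%:R.
Let down (s : seq R) : R := (lmax s <= 0)%R%:R.

Definition wmax n := EE n (fun s => expR (- th * lmax s)).
Definition wpos n := EE n (fun s => eminus (lsum s)).
Definition wmaxmin m n := EE m (fun s => EE n (fun t => eminus (lmax s + lmin t))).

(* Weights of the pieces of a walk cut at its first maximum: the part before
   it, with ([u]) and without ([u0]) the exponential weight, and the part [d]
   after it; [c] glues a part before and a part after that belong to different
   cuts. *)
Let u n := EE n (fun s => up s * expR (- th * lsum s)).
Let u0 n := EE n up.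
Let d n := EE n down.
Let c k l := EE k (fun s => EE l (fun t => up s * down t * eminus (lsum s + lsum t))).

Lemma first_argmax_mul (s : seq R) n (G : R -> R) : size s = n ->
  \sum_(k < n.+1) up (take k s) * down (drop k s) * G (lsum (take k s)) =
  G (lmax s).
Proof.
move=> <-; rewrite -(first_argmax s G); apply: eq_bigr => k _.
by rewrite -natrM mulnb.
Qed.

Lemma wmax_conv : wmax =1 conv u d.
Proof.
move=> n; rewrite /wmax /conv.
under [RHS]eq_bigr do rewrite /u /d -Ex_prod.
rewrite -(Ex_split _ _ _ (fun s t => up s * expR (- th * lsum s) * down t)).
apply: eq_Ex => s sn; rewrite -(first_argmax_mul (fun y => expR (- th * y)) sn).
by apply: eq_bigr => k _; rewrite mulrAC.
Qed.

Lemma conv_u0_d n : conv u0 d n = 1.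
Proof.
rewrite /conv -[RHS](Ex_cst p1 n 1).
under [LHS]eq_bigr do rewrite /u0 /d -Ex_prod.
rewrite -(Ex_split _ _ _ (fun s t => up s * down t)).
apply: eq_Ex => s sn; rewrite -(first_argmax_mul (fun y => 1) sn).
by apply: eq_bigr => k _; rewrite mulr1.
Qed.

Lemma wpos_sum n : wpos n = \sum_(k < n.+1) c k (n - k).
Proof.
rewrite /wpos /c -(Ex_split _ _ _ (fun s t => up s * down t * eminus (lsum s + lsum t))).
apply: eq_Ex => s sn; rewrite -(first_argmax_mul (fun y => eminus (lsum s)) sn).
by apply: eq_bigr => k _; rewrite -lsum_cat cat_take_drop.
Qed.

Let w m l := \sum_(k < m.+1) d (m - k) * c k l.

(** Cutting two independent words at their first maxima gives four independent
    pieces. The kernel only couples the first piece of one word with the second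
    piece of the other one, so the expectation is a convolution. *)
Lemma Ex_double_split m n (A : seq R -> R) :
  EE n (fun t => EE m (fun s => \sum_(i < n.+1) \sum_(k < m.+1)
    A (take i t) * down (drop k s) *
    (up (take k s) * down (drop i t) * eminus (lsum (take k s) + lsum (drop i t))))) =
  conv (fun i => EE i A) (w m) n.
Proof.
pose K (s t : seq R) := up s * down t * eminus (lsum s + lsum t).
transitivity (EE n (fun t => \sum_(i < n.+1) A (take i t) *
    \sum_(k < m.+1) d (m - k) * EE k (fun s => K s (drop i t)))).
  apply: eq_Ex => t _; rewrite Ex_sum; apply: eq_bigr => i _.
  under eq_Ex do under eq_bigr do rewrite -mulrA.
  under eq_Ex do rewrite -mulr_sumr.
  rewrite ExZ; congr (_ * _).
  rewrite (Ex_split _ _ _ (fun s s' => down s' * K s (drop i t))).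
  apply: eq_bigr => k _; under eq_Ex do rewrite ExZr.
  by rewrite ExZ.
rewrite (Ex_split _ _ _ (fun t t' => A t *
  \sum_(k < m.+1) d (m - k) * EE k (fun s => K s t'))).
rewrite /conv; apply: eq_bigr => i _; rewrite Ex_prod; congr (_ * _).
rewrite Ex_sum /w; apply: eq_bigr => k _; rewrite ExZ; congr (_ * _).
exact: Ex_swap.
Qed.

(** The minimum of a walk has the law of its final position minus its
    maximum, by time reversal; then both maxima are located. *)
Lemma wmaxmin_conv m : wmaxmin m =1 conv u0 (w m).
Proof.
move=> n; rewrite /wmaxmin Ex_swap -[RHS](Ex_double_split m n up) -[LHS]Ex_rev.
apply: eq_Ex => t tn; apply: eq_Ex => s sm /=; rewrite lmin_rev.
rewrite -(first_argmax_mul (fun y => eminus (lmax s + (lsum t - y))) tn).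
apply: eq_bigr => i _.
rewrite -(first_argmax_mul (fun y => eminus (y + (lsum t - lsum (take i t)))) sm).
rewrite mulr_sumr; apply: eq_bigr => k _.
rewrite -[X in lsum X - _](cat_take_drop i t) lsum_cat addrAC subrr add0r.
by ring.
Qed.

(** The maximum of a walk of length [n + m] splits at time [n]; locating the
    first maximum of each part cuts the walk into four independent pieces. *)
Lemma wmax_shift_conv m n : wmax (m + n) = conv u (w m) n.
Proof.
rewrite /wmax addnC Ex_cat -(Ex_double_split m n (fun s => up s * expR (- th * lsum s))).
apply: eq_Ex => s sn; apply: eq_Ex => t tm; rewrite lmax_cat.
rewrite -(first_argmax_mul (fun y => expR (- th * Num.max y (lsum s + lmax t))) sn).
apply: eq_bigr => i _.
rewrite -(first_argmax_mul
  (fun y => expR (- th * Num.max (lsum (take i s)) (lsum s + y))) tm).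
rewrite mulr_sumr; apply: eq_bigr => k _.
rewrite -[X in lsum X + _](cat_take_drop i s) lsum_cat.
rewrite (_ : Num.max _ _ = lsum (take i s) +
  Num.max (lsum (take k t) + lsum (drop i s)) 0); last first.
  by rewrite addr_maxr addr0 maxC -addrA [lsum (drop i s) + _]addrC.
by rewrite mulrDr expRD /eminus; ring.
Qed.

(** The four pieces of [wmax_shift_conv] and of [wmaxmin_conv] differ only in
    the weight of the first one, [u] against [u0]; convolving with [d] turns
    [u] into [wmax] and [u0] into the constant 1. As [m] goes to infinity, this
    says in continuous time that [E exp(-th M)] is the product of [E exp(-th M_e)] and
    [E exp(-th (M + I_e)^+)], where [M] is the overall maximum, [M_e] the
    maximum up to an independent exponential time, and [I_e] the minimum up to
    that time of an independent copy. *)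
Lemma wmax_wmaxmin m n :
  conv (fun j => wmax (m + j)) (fun=> 1) n = conv wmax (wmaxmin m) n.
Proof.
rewrite (eq_conv (wmax_shift_conv m) (fun i => esym (conv_u0_d i))).
by rewrite convACA; apply: eq_conv => // i; rewrite ?wmax_conv// wmaxmin_conv convC.
Qed.

(** Spitzer's identity, in recursive form. Summing [wmax_shift_conv] over all
    ways to write [n] as a sum of two times gives [n + 1] copies of [wmax n];
    on the other side the pieces reassemble into [wmax] (the outer ones) and
    [wpos] (the inner ones). *)
Lemma wmax_wpos n : n.+1%:R * wmax n = conv wmax wpos n.
Proof.
rewrite (eq_conv wmax_conv (fun=> erefl)) -convA.
transitivity (\sum_(m < n.+1) conv u (w m) (n - m)).
  rewrite (eq_bigr (fun=> wmax n)) => [|m _]; last first.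
    by rewrite -wmax_shift_conv subnKC// leq_ord.
  by rewrite sumr_const card_ord mulr_natl.
rewrite /conv.
transitivity (\sum_(m < n.+1) \sum_(i < (n - m).+1) u i * w m (n - i - m)).
  by apply: eq_bigr => m _; apply: eq_bigr => i _; rewrite subnAC.
transitivity (\sum_(i < n.+1) \sum_(m < (n - i).+1) u i * w m (n - i - m)).
  pose G k i := u i * w (k - i) (n - i - (k - i)).
  have E1 : \sum_(m < n.+1) \sum_(i < (n - m).+1) u i * w m (n - i - m) =
     \sum_(k < n.+1) \sum_(i < k.+1) G k i.
    pose G' k m := u (k - m)%N * w m (n - (k - m) - m)%N.
    transitivity (\sum_(k < n.+1) \sum_(m < k.+1) G' k m).
      rewrite sum_triangle; apply: eq_bigr => m _; apply: eq_bigr => i _.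
      by rewrite /G' addKn.
    apply: eq_bigr => k _; rewrite (reindex_inj rev_ord_inj)/=.
    by apply: eq_bigr => i _; rewrite /G' /G subSS subKn// leq_ord.
  rewrite E1 sum_triangle; apply: eq_bigr => i _; apply: eq_bigr => m _.
  by rewrite /G addKn.
apply: eq_bigr => i _; rewrite -mulr_sumr; congr (_ * _).
rewrite /w.
transitivity (\sum_(m < (n - i).+1) \sum_(k < m.+1) d (m - k) * c k (n - i - m)).
  by [].
rewrite (sum_triangle (fun m k => d (m - k) * c k (n - i - m))).
under eq_bigr do under eq_bigr do rewrite addKn.
rewrite /conv.
transitivity (\sum_(j < (n - i).+1) \sum_(k < (n - i - j).+1) d j * c k (n - i - j - k)).
  pose G1 t j := d j * c (t - j) (n - i - t).
  pose G2 t k := d (t - k) * c k (n - i - t).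
  transitivity (\sum_(t < (n - i).+1) \sum_(k < t.+1) G2 t k).
    rewrite sum_triangle; apply: eq_bigr => k _; apply: eq_bigr => j _.
    by rewrite /G2 addKn.
  transitivity (\sum_(t < (n - i).+1) \sum_(j < t.+1) G1 t j).
    apply: eq_bigr => t _; rewrite (reindex_inj rev_ord_inj)/=.
    by apply: eq_bigr => j _; rewrite /G1 /G2 subSS subKn// leq_ord.
  rewrite sum_triangle; apply: eq_bigr => j _; apply: eq_bigr => k _.
  by rewrite /G1 addKn subnDA.
by apply: eq_bigr => j _; rewrite wpos_sum mulr_sumr.
Qed.

End identities.

(** * Power series *)

Section cauchy_product.
Context {R : realType}.
Implicit Types x y : R^nat.

(** The triangle of indices lies between two squares. *)
Lemma series_conv_le x y N : (forall n, 0 <= x n) -> (forall n, 0 <= y n) ->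
  series (conv x y) N <= series x N * series y N <= series (conv x y) N.*2.
Proof.
move=> x0 y0; case: N => [|N].
  by rewrite /series /= !big_geq// mul0r lexx.
have E M : series (conv x y) M.+1 =
    \sum_(i < M.+1) \sum_(j < (M - i).+1) x i * y j.
  rewrite /series /= big_mkord /conv.
  rewrite (sum_triangle (fun m k => x k * y (m - k)%N)).
  by apply: eq_bigr => i _; apply: eq_bigr => j _; rewrite addKn.
have le_sum M M' (f : nat -> R) : (forall n, 0 <= f n) -> (M <= M')%N ->
    \sum_(i < M) f i <= \sum_(i < M') f i.
  by move=> f0 MM'; rewrite -!(big_mkord xpredT) [leRHS](@big_cat_nat _ _ _ M)//= lerDl sumr_ge0.
have P : series x N.+1 * series y N.+1 = \sum_(i < N.+1) \sum_(j < N.+1) x i * y j.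
  rewrite /series /= !big_mkord mulr_suml; apply: eq_bigr => i _.
  by rewrite mulr_sumr.
rewrite P; apply/andP; split.
  rewrite E; apply: ler_sum => i _.
  by apply: (le_sum _ _ (fun j => x i * y j)) => [j|]; [rewrite mulr_ge0|rewrite ltnS leq_subr].
rewrite doubleS E.
apply: (@le_trans _ _ (\sum_(i < N.+1) \sum_(j < (N.*2.+1 - i).+1) x i * y j)).
  apply: ler_sum => i _.
  apply: (le_sum _ _ (fun j => x i * y j)) => [j|]; first by rewrite mulr_ge0.
  by rewrite ltnS leq_subRL -addnn; have := ltn_ord i; lia.
apply: (le_sum _ _ (fun i => \sum_(j < (N.*2.+1 - i).+1) x i * y j)) => [j|].
  by apply: sumr_ge0 => ? _; rewrite mulr_ge0.
by rewrite -addnn; lia.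
Qed.

Lemma cvg_series_conv x y (a b : R) : (forall n, 0 <= x n) -> (forall n, 0 <= y n) ->
  series x @ \oo --> a -> series y @ \oo --> b ->
  series (conv x y) @ \oo --> a * b.
Proof.
move=> x0 y0 xa yb.
have xy : (fun N => series x N * series y N) @ \oo --> a * b by exact: cvgM.
have nd (z : R^nat) : (forall n, 0 <= z n) -> nondecreasing_seq (series z).
  by move=> z0; apply: (@nondecreasing_series _ z xpredT 0%N) => n _ _; exact: z0.
have c0 n : 0 <= conv x y n by apply: sumr_ge0 => i _; rewrite mulr_ge0.
have nP : nondecreasing_seq (fun N => series x N * series y N).
  move=> i j ij; apply: ler_pM; rewrite ?nd//; exact: sumr_ge0.
have ub n : series (conv x y) n <= a * b.
  have /andP[h _] := series_conv_le n x0 y0; apply: (le_trans h).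
  have /(_ n) := nondecreasing_cvgn_le nP (cvgP _ xy).
  by rewrite (cvg_lim _ xy).
have cc : cvgn (series (conv x y)).
  by apply: nondecreasing_is_cvgn; [exact: nd | exists (a * b) => _ [n _ <-]].
suff -> : a * b = limn (series (conv x y)) by [].
apply/eqP; rewrite eq_le; apply/andP; split; last exact: limr_le cc (nearW _ ub).
rewrite -(cvg_lim _ xy)//; apply: limr_le; first exact: cvgP xy.
apply: nearW => n; have /andP[_ h] := series_conv_le n x0 y0; apply: (le_trans h).
by apply: nondecreasing_cvgn_le => //; exact: nd.
Qed.

End cauchy_product.

Section unit_disc.
Context {R : realType}.
Implicit Types c : R^nat.

(** Absolute convergence, which is stable under Cauchy products and under
    term-by-term differentiation. *)
Definition disc_cvg c := forall r : R, 0 < r < 1 -> cvgn (pseries (fun n => `|c n|) r).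

Lemma disc_cvg_bounded c C : (forall n, `|c n| <= C) -> disc_cvg c.
Proof.
move=> cC r /andP[r0 r1]; have C0 : 0 <= C by exact: le_trans (cC 0%N).
apply: (@series_le_cvg _ _ (geometric C r)) => [n|n|n|].
- by rewrite mulr_ge0// exprn_ge0// ltW.
- by rewrite mulr_ge0// exprn_ge0// ltW.
- by rewrite ler_wpM2r// exprn_ge0// ltW.
- by apply: is_cvg_geometric_series; rewrite ger0_norm// ltW.
Qed.

Lemma disc_cvg_unit c : (forall n, 0 <= c n <= 1) -> disc_cvg c.
Proof.
move=> hc; apply: (@disc_cvg_bounded _ 1) => n.
by have /andP[h1 h2] := hc n; rewrite ger0_norm.
Qed.

Lemma disc_cvg_unit_div c : (forall n, 0 <= c n <= 1) -> disc_cvg (fun n => c n / n%:R).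
Proof.
move=> hc; apply: disc_cvg_unit => -[|n]; first by rewrite invr0 mulr0 lexx ler01.
have /andP[c0 c1] := hc n.+1.
by rewrite divr_ge0//= ler_pdivrMr// mul1r (le_trans c1)// ler1n.
Qed.

Lemma pseries_one (r : R) : 0 <= r < 1 -> limn (pseries (fun=> 1) r) = (1 - r)^-1.
Proof.
move=> /andP[r0 r1].
apply: cvg_lim => //; have := @cvg_geometric_series R 1 r; rewrite mul1r; apply.
by rewrite ger0_norm.
Qed.

Lemma bernoulli_le (d : R) n : 0 <= d -> 1 + n%:R * d <= (1 + d) ^+ n.
Proof.
move=> d0; elim: n => [|n IH]; first by rewrite expr0 mul0r addr0.
rewrite exprS -natr1; apply: (@le_trans _ _ ((1 + d) * (1 + n%:R * d))).
  by rewrite -subr_ge0 (_ : _ - _ = n%:R * d * d) ?mulr_ge0//; ring.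
by rewrite ler_wpM2l// addr_ge0.
Qed.

(** Between [r] and 1 there is room for two more radii [r < t < s]: the terms
    at [s] are bounded, and the factor [n + 1] is absorbed by [(t / r) ^ n]
    through Bernoulli's inequality. *)
Lemma disc_cvg_diffs c : disc_cvg c -> disc_cvg (pseries_diffs c).
Proof.
move=> dc r /andP[r0 r1].
pose s := (2 + r) / 3; pose t := (1 + 2 * r) / 3.
have rt : r < t by rewrite /t; lra.
have ts : t < s by rewrite /t /s; lra.
have s1 : s < 1 by rewrite /s; lra.
have t0 : 0 < t := lt_trans r0 rt; have s0 : 0 < s := lt_trans t0 ts.
pose e := t / r - 1; have e0 : 0 < e by rewrite subr_gt0 ltr_pdivlMr// mul1r.
have er : 1 + e = t / r by rewrite /e addrC subrK.
have [M [_ /(_ (`|M| + 1))]] : bounded_fun (fun n => `|c n| * s ^+ n).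
  by apply: cvg_series_bounded; apply: dc; rewrite s0.
rewrite (le_lt_trans (ler_norm M)) ?ltrDl// => /(_ isT) bM.
have {}bM n : `|c n| * s ^+ n <= `|M| + 1.
  exact: le_trans (ler_norm _) (bM n I).
have M0 : 0 <= `|M| + 1 by rewrite addr_ge0.
pose K := (`|M| + 1) / s * (e^-1 + 1).
have K0 : 0 <= K by rewrite !mulr_ge0 ?addr_ge0 ?invr_ge0 ?(ltW s0) ?(ltW e0).
apply: (@series_le_cvg _ _ (geometric K (t / s))) => [n|n|n|].
- by rewrite mulr_ge0// exprn_ge0// ltW.
- by rewrite mulr_ge0// exprn_ge0// divr_ge0// ltW.
- rewrite /geometric /= /pseries_diffs normrM ger0_norm// expr_div_n.
  have h1 : n.+1%:R * r ^+ n <= (e^-1 + 1) * t ^+ n.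
    have : n.+1%:R <= (e^-1 + 1) * (t / r) ^+ n.
      rewrite -er; apply: (@le_trans _ _ ((e^-1 + 1) * (1 + n%:R * e))).
        rewrite -natr1 mulrDl mul1r mulrDr mulr1 mulrCA mulVf ?gt_eqF// mulr1.
        have : 0 <= e^-1 by rewrite invr_ge0 ltW.
        have : 0 <= n%:R * e by rewrite mulr_ge0// ltW.
        lra.
      by apply: ler_wpM2l; [rewrite addr_ge0// invr_ge0 ltW | exact/bernoulli_le/ltW].
    by rewrite expr_div_n mulrA ler_pdivlMr// exprn_gt0.
  have h2 : `|c n.+1| <= (`|M| + 1) / s / s ^+ n.
    by rewrite -mulrA -invfM -exprS ler_pdivlMr ?bM// exprn_gt0.
  apply: (@le_trans _ _ ((`|M| + 1) / s / s ^+ n * ((e^-1 + 1) * t ^+ n))).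
    rewrite mulrAC mulrC; apply: ler_pM => //.
    by rewrite mulr_ge0// exprn_ge0// ltW.
  by rewrite /K le_eqVlt; apply/orP; left; apply/eqP; ring.
- apply: is_cvg_geometric_series; rewrite ger0_norm; last by rewrite divr_ge0// ltW.
  by rewrite (ltr_pdivrMr _ _ s0) mul1r.
Qed.

Lemma disc_cvgP c (r : R) : disc_cvg c -> 0 <= r < 1 -> cvgn (pseries c r).
Proof.
move=> dc /andP[r0 r1]; pose s := (r + 1) / 2.
have rs : r < s by rewrite /s; lra.
have s01 : 0 < s < 1 by rewrite /s; apply/andP; split; lra.
have /andP[s0 _] := s01.
apply: (@is_cvg_pseries_inside _ _ s); last by rewrite !ger0_norm// ltW.
apply: normed_cvg; have := dc _ s01; rewrite /pseries /normed_series_of /=.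
suff -> : (fun n => `|c n| * s ^+ n) = (fun n => `|c n * s ^+ n|) by [].
by apply/funext => n; rewrite normrM [`|s ^+ n|]ger0_norm// exprn_ge0// ltW.
Qed.

Lemma disc_is_derive c (r : R) : disc_cvg c -> 0 <= r < 1 ->
  is_derive r (1 : R) (fun x : R => limn (pseries c x)) (limn (pseries (pseries_diffs c) r)).
Proof.
move=> dc /andP[r0 r1]; pose s := (r + 1) / 2.
have rs : r < s by rewrite /s; lra.
have s01 : 0 <= s < 1 by rewrite /s; apply/andP; split; lra.
have /andP[s0 _] := s01.
apply: (@pseries_snd_diffs _ _ s); last by rewrite !ger0_norm.
- exact: disc_cvgP.
- by apply: disc_cvgP => //; exact: disc_cvg_diffs.
- by apply: disc_cvgP => //; do 2 apply: disc_cvg_diffs.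
Qed.

Lemma pseries_conv (x y : R^nat) (r : R) : (forall n, 0 <= x n) -> (forall n, 0 <= y n) ->
  disc_cvg x -> disc_cvg y -> 0 <= r < 1 ->
  pseries (conv x y) r @ \oo --> limn (pseries x r) * limn (pseries y r).
Proof.
move=> x0 y0 dx dy r01; have /andP[r0 _] := r01.
rewrite (_ : pseries (conv x y) r = series (conv (fun n => x n * r ^+ n) (fun n => y n * r ^+ n))).
  apply: cvg_series_conv => [n|n||]; rewrite ?mulr_ge0 ?exprn_ge0//.
  - exact: disc_cvgP.
  - exact: disc_cvgP.
apply/funext => n; apply: eq_bigr => m _; rewrite /conv /= mulr_suml; apply: eq_bigr => i _.
by rewrite mulrACA -exprD subnKC// leq_ord.
Qed.

(** A recursion [(n + 1) a_n = sum_k a_k b_(n-k)] says that the logarithmic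
    derivative of the generating function of [a] has coefficients [b_(n+1)]. *)
Lemma pseries_expR (a b : R^nat) (r : R) :
  (forall n, 0 <= a n <= 1) -> (forall n, 0 <= b n <= 1) ->
  a 0%N = 1 -> b 0%N = 1 ->
  (forall n, n.+1%:R * a n = conv a b n) -> 0 <= r < 1 ->
  limn (pseries a r) = expR (limn (pseries (fun n => b n / n%:R) r)).
Proof.
move=> ha hb a0 b0 ab r01; have /andP[r0 r1] := r01.
have a_ge0 n : 0 <= a n by case/andP: (ha n).
have b_ge0 n : 0 <= b n by case/andP: (hb n).
have da : disc_cvg a by exact: disc_cvg_unit.
have db : disc_cvg (fun n => b n.+1) by apply: disc_cvg_unit => n; exact: hb.
pose e n := b n / n%:R.
have de : disc_cvg e by exact: disc_cvg_unit_div.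
have diffe : pseries_diffs e = fun n => b n.+1.
  by apply/funext => n; rewrite /pseries_diffs /e mulrCA mulfV ?mulr1.
have diffa : pseries_diffs a = conv a (fun n => b n.+1).
  apply/funext => n; have := ab n.+1; rewrite /conv big_ord_recr/= subnn b0 mulr1.
  rewrite -natr1 mulrDl mul1r => /addIr; rewrite /pseries_diffs => ->.
  by apply: eq_bigr => i _; rewrite subSn// leq_ord.
pose f x := limn (pseries a x) * expR (- limn (pseries e x)).
(* The differential equation says that [f] is constant. *)
have df (x : R) : 0 <= x < 1 -> is_derive x (1 : R) f 0.
  move=> x01.
  have Da := disc_is_derive da x01; have De := disc_is_derive de x01.
  apply: is_derive_eq.
  rewrite diffa diffe (cvg_lim _ (pseries_conv a_ge0 (fun n => b_ge0 n.+1) da db x01))//.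
  by rewrite /GRing.scale/=; ring.
have f0 : f 0 = 1.
  have p0 c : limn (pseries c 0) = c 0%N.
    apply: cvg_lim => //; apply: cvg_near_cst; exists 1%N => // -[//|n] _.
    rewrite /pseries /series /= big_nat_recl// expr0 mulr1 big1 ?addr0// => i _.
    by rewrite expr0n/= mulr0.
  by rewrite /f !p0 a0 /e invr0 mulr0 oppr0 expR0 mulr1.
suff fr : f r = 1.
  have := congr1 (fun z => z * expR (limn (pseries e r))) fr.
  by rewrite /= /f -mulrA -expRD addNr expR0 mulr1 mul1r.
move: r0; rewrite le_eqVlt => /predU1P[<-//|r0].
have := @MVT _ f (fun=> 0) 0 r r0.
case.
- by move=> x; rewrite in_itv/= => /andP[x0 xr]; apply: df; rewrite (ltW x0) (lt_trans xr).
- apply: derivable_within_continuous => x; rewrite in_itv/= => /andP[x0 xr].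
  by apply: ex_derive; apply: df; rewrite x0 (le_lt_trans xr).
- by move=> x _; rewrite mul0r f0 => /subr0_eq.
Qed.

(** For the constant sequence 1 the recursion holds and the generating function
    is [1 / (1 - r)]; dividing by it removes the singularity at [r = 1]. *)
Lemma pseries_expR_gap (a b : R^nat) (r : R) :
  (forall n, 0 <= a n <= 1) -> (forall n, 0 <= b n <= 1) ->
  a 0%N = 1 -> b 0%N = 1 ->
  (forall n, n.+1%:R * a n = conv a b n) -> 0 <= r < 1 ->
  (1 - r) * limn (pseries a r) =
  expR (- limn (pseries (fun n => (1 - b n) / n%:R) r)).
Proof.
move=> ha hb a0 b0 ab r01; have /andP[r0 r1] := r01.
have one (n : nat) : 0 <= (1 : R) <= 1 by rewrite ler01 lexx.
have := @pseries_expR (fun=> 1) (fun=> 1) r one one erefl erefl.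
rewrite (pseries_one r01) => /(_ _ r01) H.
have {}H : (1 - r)^-1 = expR (limn (pseries (fun n => 1 / n%:R) r)).
  apply: H => n; rewrite /conv mulr1; under eq_bigr do rewrite mulr1.
  by rewrite sumr_const card_ord.
rewrite (pseries_expR ha hb)// -[1 - r]invrK H -expRN -expRD; congr expR.
have -> : pseries (fun n => (1 - b n) / n%:R) r =
    pseries (fun n => 1 / n%:R) r - pseries (fun n => b n / n%:R) r.
  apply/funext => n; rewrite /pseries /series /= !fctE -sumrB.
  by apply: eq_bigr => i _; rewrite -!mulrBl.
rewrite limB; [|exact: disc_cvgP (disc_cvg_unit_div one) r01
  |exact: disc_cvgP (disc_cvg_unit_div hb) r01].
by rewrite opprB addrC.
Qed.

End unit_disc.

(** * Expectations of bounded functions *)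

Section bounded_expectation.
Context {R : realType} d {T : measurableType d} (P : probability T R).
Implicit Types f g : T -> R.

Lemma bounded_integrable f C : measurable_fun setT f ->
  (forall w, `|f w| <= C) -> P.-integrable setT (EFin \o f).
Proof.
move=> mf fC; apply: measurable_bounded_integrable => //.
  by rewrite (le_lt_trans (probability_le1 P _))// ltry.
exists C; split; first exact: num_real.
by move=> M CM w _ /=; exact: le_trans (fC w) (ltW CM).
Qed.

Lemma Rintegral_cst_prob (c : R) : \int[P]_w c = c.
Proof. by rewrite Rintegral_cst//= probability_setT mulr1. Qed.

Lemma bounded_ae_cvg_Rintegral (f_ : nat -> T -> R) f C :
  (forall n, measurable_fun setT (f_ n)) -> measurable_fun setT f ->
  (forall n w, `|f_ n w| <= C) ->
  {ae P, forall w, f_ n w @[n --> \oo] --> f w} ->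
  \int[P]_w f_ n w @[n --> \oo] --> \int[P]_w f w.
Proof.
move=> mf_ mf fC cf.
have [i _ h] := @dominated_convergence _ _ _ P setT measurableT
   (fun n => EFin \o f_ n) (EFin \o f) (EFin \o cst C)
   (fun n => (measurable_EFinP _ _).2 (mf_ n)) ((measurable_EFinP _ _).2 mf)
   ltac:(by apply: filterS cf => w cw _; by apply: cvg_EFin => //; exact: nearW)
   (finite_measure_integrable_cst P C measurableT)
   ltac:(by apply: aeW => w n _ /=; rewrite lee_fin).
apply: fine_cvg; rewrite /= fineK; last exact: integrable_fin_num.
exact: h.
Qed.

Lemma bounded_cvg_Rintegral (f_ : nat -> T -> R) f C :
  (forall n, measurable_fun setT (f_ n)) ->
  (forall n w, `|f_ n w| <= C) ->
  (forall w, f_ n w @[n --> \oo] --> f w) ->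
  \int[P]_w f_ n w @[n --> \oo] --> \int[P]_w f w.
Proof.
move=> mf_ fC cf; apply: bounded_ae_cvg_Rintegral fC _ => //; last exact: aeW.
by apply: (measurable_fun_cvg mf_) => w _; exact: cf.
Qed.

Lemma Rintegral_sum I (s : seq I) (f : I -> T -> R) :
  (forall i, P.-integrable setT (EFin \o f i)) ->
  \int[P]_w (\sum_(i <- s) f i w) = \sum_(i <- s) \int[P]_w f i w.
Proof.
move=> fi; elim: s => [|i s IH].
  by rewrite big_nil; under eq_Rintegral do rewrite big_nil; rewrite Rintegral_cst_prob.
rewrite big_cons -IH -RintegralD//.
  by apply: eq_Rintegral => w _; rewrite big_cons.
have := integrable_sum measurableT s (P := xpredT) (fun i _ => fi i).
by apply: eq_integrable => // w _ /=; rewrite -sumEFin.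
Qed.

Lemma Rintegral_indic_scale (c : R) (A : set T) : measurable A ->
  \int[P]_w (c * \1_A w) = c * fine (P A).
Proof.
move=> mA; rewrite RintegralZl//; last exact: integrable_indic.
by rewrite /Rintegral integral_indic// setIT.
Qed.

Lemma integrable_indic_scale (c : R) (A : set T) : measurable A ->
  P.-integrable setT (EFin \o (fun w => c * \1_A w)).
Proof.
move=> mA; have := integrableZl measurableT c (integrable_indic P mA).
by apply: eq_integrable => // w _ /=; rewrite EFinM.
Qed.

End bounded_expectation.

(** * Rounding *)

Section rounding.
Context {R : realType}.

(** Truncation to [-j, j] followed by rounding down to the grid of step
    [1 / (j + 1)]: a measurable function with finitely many values that tends
    to the identity. *)
Definition rounding_code (j : nat) (x : R) : nat :=
  Num.truncn ((Num.min (Num.max x (- j%:R)) j%:R + j%:R) * j.+1%:R).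

Definition rounding_value (j : nat) (i : nat) : R := i%:R / j.+1%:R - j%:R.

Definition rounding j x := rounding_value j (rounding_code j x).

Definition rounding_values (j : nat) : seq R :=
  [seq rounding_value j i | i <- iota 0 ((j + j) * j.+1).+1].

Lemma rounding_value_inj j : injective (rounding_value j).
Proof.
move=> a b /addIr /(congr1 ( *%R^~ (j.+1%:R))).
by rewrite !divfK ?pnatr_eq0// => /eqP; rewrite eqr_nat => /eqP.
Qed.

Lemma rounding_values_uniq j : uniq (rounding_values j).
Proof. by rewrite map_inj_uniq ?iota_uniq//; exact: rounding_value_inj. Qed.

Lemma clamp_bounds (j : nat) (x : R) :
  0 <= Num.min (Num.max x (- j%:R)) j%:R + j%:R <= j%:R + j%:R.
Proof.
move: (j%:R : R) (ler0n R j) => J J0.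
case: (leP x (- J)) => h1; [case: (leP (- J) J)|case: (leP x J)] => h2;
  by apply/andP; split; lra.
Qed.

Lemma rounding_in j x : rounding j x \in rounding_values j.
Proof.
rewrite /rounding /rounding_values mem_map; last exact: rounding_value_inj.
rewrite mem_iota add0n ltnS /= -(ler_nat R).
have /andP[h0 h1] := clamp_bounds j x.
have /truncn_itv/andP[h _] :
    0 <= (Num.min (Num.max x (- j%:R)) j%:R + j%:R) * j.+1%:R by rewrite mulr_ge0.
by apply: (le_trans h); rewrite natrM natrD ler_wpM2r.
Qed.

Lemma rounding_homo j : {homo rounding j : x y / x <= y}.
Proof.
move=> x y xy; rewrite lerD2r ler_wpM2r ?invr_ge0// ler_nat.
apply: le_truncn; rewrite ler_wpM2r// lerD2r.
by rewrite le_min2// le_max2.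
Qed.

Lemma measurable_rounding j : measurable_fun setT (rounding j).
Proof. by apply: nondecreasing_measurable => //; exact: rounding_homo. Qed.

Lemma cvg_rounding (x : R) : rounding j x @[j --> \oo] --> x.
Proof.
apply/cvgrPdist_le => e e0; near=> j.
have xj : `|x| <= j%:R by near: j; exact: nbhs_infty_ger.
have ej : j.+1%:R^-1 <= e.
  by apply: ltW; near: j; exact: (near_infty_natSinv_lt (PosNum e0)).
move: xj; rewrite ler_norml => /andP[h1 h2].
rewrite /rounding /rounding_value /rounding_code (max_idPl h1) (min_idPl h2).
set z := (x + j%:R) * j.+1%:R.
have z0 : 0 <= z by rewrite mulr_ge0// -lerBlDr sub0r.
have /andP[t1 t2] := truncn_itv z0.
have zE : x = z / j.+1%:R - j%:R by rewrite mulfK ?addrK ?pnatr_eq0.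
rewrite {1}zE opprD opprK addrACA addNr addr0 -mulrBl.
rewrite ger0_norm; last by rewrite mulr_ge0 ?invr_ge0// subr_ge0.
apply: le_trans ej; rewrite ler_pdivrMr// mulVf ?pnatr_eq0//.
by rewrite lerBlDl natr1 ltW.
Unshelve. all: by end_near. Qed.

End rounding.

(** * Walks with an arbitrary step law *)

Section convergence.
Context {R : realType}.
Implicit Types u v : nat -> R.

Lemma cvg_maxr u v (a b : R) : u n @[n --> \oo] --> a -> v n @[n --> \oo] --> b ->
  Num.max (u n) (v n) @[n --> \oo] --> Num.max a b.
Proof.
move=> ua vb; under eq_fun do rewrite maxr_absE; rewrite maxr_absE.
apply: cvgM; last exact: cvg_cst.
by apply: cvgD; [exact: cvgD | apply: cvg_norm; exact: cvgB].
Qed.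

Lemma cvg_minr u v (a b : R) : u n @[n --> \oo] --> a -> v n @[n --> \oo] --> b ->
  Num.min (u n) (v n) @[n --> \oo] --> Num.min a b.
Proof.
move=> ua vb; under eq_fun do rewrite minr_absE; rewrite minr_absE.
apply: cvgM; last exact: cvg_cst.
by apply: cvgB; [exact: cvgD | apply: cvg_norm; exact: cvgB].
Qed.

Lemma cvg_expRM u (c a : R) : u n @[n --> \oo] --> a ->
  expR (c * u n) @[n --> \oo] --> expR (c * a).
Proof.
move=> ua; have h : c * u n @[n --> \oo] --> c * a by exact: cvgM (cvg_cst c) ua.
exact: (continuous_cvg _ (@continuous_expR R _) h).
Qed.

Lemma cvg_eminus u (c a : R) : u n @[n --> \oo] --> a ->
  eminus c (u n) @[n --> \oo] --> eminus c a.
Proof. by move=> ua; apply: cvg_expRM; apply: cvg_maxr => //; exact: cvg_cst. Qed.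

Lemma cvg_lmax (y : nat -> nat -> R) (z : nat -> R) (s : seq nat) :
  (forall i, y j i @[j --> \oo] --> z i) ->
  lmax [seq y j i | i <- s] @[j --> \oo] --> lmax [seq z i | i <- s].
Proof.
move=> yz; elim: s => [|i s IH] /=; first exact: cvg_cst.
by apply: cvg_maxr; [exact: cvg_cst | exact: cvgD].
Qed.

Lemma cvg_lmin (y : nat -> nat -> R) (z : nat -> R) (s : seq nat) :
  (forall i, y j i @[j --> \oo] --> z i) ->
  lmin [seq y j i | i <- s] @[j --> \oo] --> lmin [seq z i | i <- s].
Proof.
move=> yz; elim: s => [|i s IH] /=; first exact: cvg_cst.
by apply: cvg_minr; [exact: cvg_cst | exact: cvgD].
Qed.

Lemma cvg_lsum (y : nat -> nat -> R) (z : nat -> R) (s : seq nat) :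
  (forall i, y j i @[j --> \oo] --> z i) ->
  lsum [seq y j i | i <- s] @[j --> \oo] --> lsum [seq z i | i <- s].
Proof.
move=> yz; elim: s => [|i s IH] /=; first exact: cvg_cst.
by rewrite lsum_cons; under eq_fun do rewrite lsum_cons; exact: cvgD.
Qed.

Lemma cvg_conv (x y : nat -> nat -> R) (a b : nat -> R) n :
  (forall i, x j i @[j --> \oo] --> a i) -> (forall i, y j i @[j --> \oo] --> b i) ->
  conv (x j) (y j) n @[j --> \oo] --> conv a b n.
Proof.
move=> xa yb; rewrite /conv.
by apply: cvg_big => [|i _]; [exact: add_continuous | exact: cvgM].
Qed.

End convergence.

Section words_of_variables.
Context {R : realType} d {T : measurableType d} (P : probability T R).
Variables (vs : seq R) (Y : nat -> T -> R).
Hypothesis vs_uniq : uniq vs.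
Hypothesis Yvs : forall i w, Y i w \in vs.
Hypothesis mY : forall i v, measurable (Y i @^-1` [set v]).
Let p v := fine (P (Y 0%N @^-1` [set v])).
Hypothesis Yp : forall i v, P (Y i @^-1` [set v]) = (p v)%:E.
Hypothesis Yind : forall n (A : nat -> R),
  P (\bigcap_(i < n) (Y i @^-1` [set A i])) = (\prod_(i < n) P (Y i @^-1` [set A i]))%E.

Definition word n w := [seq Y i w | i <- iota 0 n].

Fixpoint words n : seq (seq R) :=
  if n is n'.+1 then [seq v :: s | v <- vs, s <- words n'] else [:: [::]].

Lemma size_words n s : s \in words n -> size s = n.
Proof.
elim: n s => [|n IH] s /=; first by rewrite inE => /eqP ->.
by move=> /allpairsP[[v t]/= [_ /IH <- ->]].
Qed.

Lemma words_uniq n : uniq (words n).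
Proof.
elim: n => //= n IH; apply: allpairs_uniq => //.
by move=> [a b] [a' b'] _ _ /= [-> ->].
Qed.

Lemma mem_words n s : size s = n -> all (mem vs) s -> s \in words n.
Proof.
elim: n s => [|n IH] [|v s]//= [sn] /andP[vvs svs].
by apply/allpairsP; exists (v, s); split => //=; exact: IH.
Qed.

Lemma word_in n w : word n w \in words n.
Proof.
apply: mem_words; first by rewrite size_map size_iota.
by apply/allP => x /mapP[i _ ->]; exact: Yvs.
Qed.

Lemma ExE n F : Ex vs p n F = \sum_(s <- words n) (\prod_(v <- s) p v) * F s.
Proof.
elim: n F => [|n IH] F /=; first by rewrite big_seq1 big_nil mul1r.
rewrite big_allpairs_dep/=; apply: eq_bigr => v _; rewrite IH mulr_sumr.
by apply: eq_bigr => s _; rewrite big_cons mulrA.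
Qed.

Let cyl n (s : seq R) : set T := \bigcap_(i < n) (Y i @^-1` [set nth 0 s i]).

Lemma cylP n s w : size s = n -> cyl n s w <-> word n w = s.
Proof.
move=> sn; split => [h|<-].
  apply: (@eq_from_nth _ 0); first by rewrite size_map size_iota.
  move=> i; rewrite size_map size_iota => i_n.
  by rewrite (nth_map 0%N) ?size_iota// nth_iota// add0n; exact: h.
move=> i /= i_n; rewrite (nth_map 0%N) ?size_iota// nth_iota//.
Qed.

Lemma measurable_cyl n s : measurable (cyl n s).
Proof. by apply: bigcap_measurableType => i _; exact: mY. Qed.

(** Finitely many words are possible, so every function of the word is simple. *)
Lemma word_sumE n (G : seq R -> R) w :
  G (word n w) = \sum_(s <- words n) G s * \1_(cyl n s) w.
Proof.
rewrite (bigD1_seq (word n w)) ?word_in ?words_uniq//=.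
rewrite indicE mem_set ?mulr1; last by apply/cylP => //; rewrite size_map size_iota.
rewrite big_seq_cond big1 ?addr0// => s /andP[sn sw].
rewrite indicE memNset ?mulr0//.
by move=> /(cylP w (size_words sn)) e; rewrite e eqxx in sw.
Qed.

Lemma measurable_word n (G : seq R -> R) :
  measurable_fun setT (fun w => G (word n w)).
Proof.
under eq_fun do rewrite word_sumE.
apply: measurable_sum => s.
by apply: measurable_funM => //; apply: measurable_indic; exact: measurable_cyl.
Qed.

Lemma Rintegral_word n (G : seq R -> R) :
  \int[P]_w G (word n w) = Ex vs p n G.
Proof.
under eq_Rintegral do rewrite word_sumE.
rewrite Rintegral_sum => [|s]; last by apply: integrable_indic_scale; exact: measurable_cyl.
rewrite ExE !big_seq; apply: eq_bigr => s sn.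
rewrite Rintegral_indic_scale; last exact: measurable_cyl.
rewrite mulrC; congr (_ * _); rewrite /cyl (Yind n (nth 0 s)).
rewrite (eq_bigr (fun i : 'I_n => (p (nth 0 s i))%:E)) => [|i _]; last exact: Yp.
rewrite prodEFin/= -(size_words sn).
by rewrite [RHS](big_nth 0) big_mkord.
Qed.

Lemma sum_weights : \sum_(v <- vs) p v = 1.
Proof.
have := Rintegral_word 1 (fun=> 1); rewrite /= Rintegral_cst_prob => ->.
by rewrite -mulr_suml mulr1.
Qed.

End words_of_variables.

Section iid_walk.
Context {R : realType} d {T : measurableType d} (P : probability T R).
Variables (Y : nat -> T -> R) (th : R).
Hypothesis th0 : 0 <= th.
Hypothesis mY : forall i, measurable_fun setT (Y i).
Hypothesis Yid : forall i A, measurable A -> P (Y i @^-1` A) = P (Y 0%N @^-1` A).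
Hypothesis Yind : forall n (A : nat -> set R), (forall i, measurable (A i)) ->
  P (\bigcap_(i < n) (Y i @^-1` A i)) = (\prod_(i < n) P (Y i @^-1` A i))%E.

Definition walk_max n := \int[P]_w expR (- th * lmax (word Y n w)).
Definition walk_pos n := \int[P]_w eminus th (lsum (word Y n w)).
(** Two independent copies of the walk: the maximum of the first and the
    minimum of the second. *)
Definition walk_maxmin m n :=
  \int[P]_w \int[P]_v eminus th (lmax (word Y m w) + lmin (word Y n v)).

Lemma eminus_bounds (z : R) : 0 <= eminus th z <= 1.
Proof.
rewrite expR_ge0 -[leRHS]expR0 ler_expR mulNr oppr_le0 mulr_ge0//.
by rewrite le_max lexx orbT.
Qed.

Lemma eminus_norm (z : R) : `|eminus th z| <= 1.
Proof. by have /andP[h1 h2] := eminus_bounds z; rewrite ger0_norm. Qed.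

Lemma expR_lmax_bounds (s : seq R) : 0 <= expR (- th * lmax s) <= 1.
Proof.
by rewrite expR_ge0 -[leRHS]expR0 ler_expR mulNr oppr_le0 mulr_ge0// lmax_ge0.
Qed.

Lemma expR_lmax_norm (s : seq R) : `|expR (- th * lmax s)| <= 1.
Proof. by have /andP[h1 h2] := expR_lmax_bounds s; rewrite ger0_norm. Qed.

Let Yr j i w := rounding j (Y i w).
Let pr j v := fine (P (Yr j 0%N @^-1` [set v])).
Let vr (j : nat) : seq R := rounding_values j.

Let mYr j i : measurable_fun setT (Yr j i).
Proof. by apply: measurableT_comp (mY i); exact: measurable_rounding. Qed.

Let mYrset j i v : measurable (Yr j i @^-1` [set v]).
Proof. by rewrite -[X in measurable X]setTI; apply: mYr => //; exact: measurable_set1. Qed.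

Let pre j (v : R) : measurable (rounding j @^-1` [set v] : set R).
Proof.
by rewrite -[X in measurable X]setTI; apply: measurable_rounding.
Qed.

Let Yrp j i v : P (Yr j i @^-1` [set v]) = (pr j v)%:E.
Proof.
rewrite /pr fineK ?fin_num_measure//.
exact: (Yid i (pre j v)).
Qed.

Let Yrind j n (A : nat -> R) :
  P (\bigcap_(i < n) (Yr j i @^-1` [set A i])) =
  (\prod_(i < n) P (Yr j i @^-1` [set A i]))%E.
Proof. exact: (Yind n (fun i => pre j (A i))). Qed.

Let Yrvs j i w : Yr j i w \in vr j.
Proof. exact: rounding_in. Qed.

Let cvgYr i w : Yr j i w @[j --> \oo] --> Y i w.
Proof. exact: cvg_rounding. Qed.

Let RintYr j n (G : seq R -> R) :
  \int[P]_w G (word (Yr j) n w) = Ex (vr j) (pr j) n G.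
Proof.
by apply: Rintegral_word => //; exact: rounding_values_uniq.
Qed.

Let measYr j n (G : seq R -> R) : measurable_fun setT (fun w => G (word (Yr j) n w)).
Proof.
by apply: (measurable_word (rounding_values_uniq j)) => //; exact: mYrset.
Qed.

Let Yr1 j : \sum_(v <- vr j) pr j v = 1.
Proof. by apply: (sum_weights (Y := Yr j)) => //; exact: rounding_values_uniq. Qed.

(** Rounding the steps gives walks with a finite step law, to which the
    identities between finite sums apply; bounded functionals that are
    continuous in the steps pass to the limit. *)
Lemma cvg_word (G : seq R -> R) n :
  (forall s, `|G s| <= 1) ->
  (forall (y : nat -> nat -> R) z (r : seq nat), (forall i, y j i @[j --> \oo] --> z i) ->
     G [seq y j i | i <- r] @[j --> \oo] --> G [seq z i | i <- r]) ->
  Ex (vr j) (pr j) n G @[j --> \oo] --> \int[P]_w G (word Y n w).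
Proof.
move=> G1 Gc.
have -> : (fun j => Ex (vr j) (pr j) n G) = (fun j => \int[P]_w G (word (Yr j) n w)).
  by apply/funext => j; rewrite RintYr.
have cG w : G (word (Yr j) n w) @[j --> \oo] --> G (word Y n w).
  by apply: Gc => i; exact: cvgYr.
by apply: (@bounded_cvg_Rintegral _ _ _ P _ _ 1) => // j; exact: measYr.
Qed.

Let cvg_max n := @cvg_word _ n expR_lmax_norm
  (fun y z r h => cvg_expRM (cvg_lmax h)).

Let cvg_pos n := @cvg_word _ n (fun s => eminus_norm (lsum s))
  (fun y z r h => cvg_eminus (cvg_lsum h)).

Lemma cvg_maxmin m n : wmaxmin (vr j) (pr j) th m n @[j --> \oo] --> walk_maxmin m n.
Proof.
pose psi j z := Ex (vr j) (pr j) n (fun t => eminus th (z + lmin t)).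
have psiE j z : psi j z = \int[P]_v eminus th (z + lmin (word (Yr j) n v)).
  exact: esym (RintYr j n (fun t => eminus th (z + lmin t))).
have -> : (fun j => wmaxmin (vr j) (pr j) th m n) =
    (fun j => \int[P]_w psi j (lmax (word (Yr j) m w))).
  by apply/funext => j; exact: esym (RintYr j m (psi j \o @lmax R)).
rewrite /walk_maxmin.
apply: (@bounded_cvg_Rintegral _ _ _ P (fun j w => psi j (lmax (word (Yr j) m w))) _ 1) => [j|j w|w].
- exact: (measYr j m (psi j \o @lmax R)).
- rewrite psiE; set z := lmax _; apply: le_trans (_ : \int[P]_v 1 <= 1); last first.
    by rewrite Rintegral_cst_prob.
  have iz : P.-integrable setT (EFin \o (fun v => eminus th (z + lmin (word (Yr j) n v)))).
    apply: (@bounded_integrable _ _ _ _ _ 1) => [|v]; last exact: eminus_norm.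
    exact: (measYr j n (fun t => eminus th (z + lmin t))).
  apply: (le_trans (le_normr_Rintegral measurableT iz)); apply: le_Rintegral => //.
  - exact: integrable_norm.
  - exact: finite_measure_integrable_cst.
  - by move=> v _; exact: eminus_norm.
- rewrite (_ : (fun j => _) = (fun j => \int[P]_v
      eminus th (lmax (word (Yr j) m w) + lmin (word (Yr j) n v)))); last first.
    by apply/funext => j; exact: psiE.
  apply: (@bounded_cvg_Rintegral _ _ _ P (fun j v => eminus th
    (lmax (word (Yr j) m w) + lmin (word (Yr j) n v))) _ 1) => [j|j v|v].
  + exact: (measYr j n (fun t => eminus th (_ + lmin t))).
  + exact: eminus_norm.
  + apply: cvg_eminus; apply: cvgD; first by apply: cvg_lmax => i; exact: cvgYr.
    by apply: cvg_lmin => i; exact: cvgYr.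
Qed.

Theorem walk_max_pos n : n.+1%:R * walk_max n = conv walk_max walk_pos n.
Proof.
have h1 : n.+1%:R * wmax (vr j) (pr j) th n @[j --> \oo] --> n.+1%:R * walk_max n.
  by apply: cvgM; [exact: cvg_cst | exact: cvg_max n].
have h2 : conv (wmax (vr j) (pr j) th) (wpos (vr j) (pr j) th) n @[j --> \oo] -->
   conv walk_max walk_pos n.
  by apply: cvg_conv => i; [exact: cvg_max i | exact: cvg_pos i].
have e : (fun j => n.+1%:R * wmax (vr j) (pr j) th n) =
    (fun j => conv (wmax (vr j) (pr j) th) (wpos (vr j) (pr j) th) n).
  by apply/funext => j; exact: wmax_wpos.
by rewrite e in h1; exact: cvg_unique h1 h2.
Qed.

Theorem walk_max_maxmin m n :
  conv (fun k => walk_max (m + k)) (fun=> 1) n = conv walk_max (walk_maxmin m) n.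
Proof.
have h1 : conv (fun k => wmax (vr j) (pr j) th (m + k)) (fun=> 1) n @[j --> \oo] -->
    conv (fun k => walk_max (m + k)) (fun=> 1) n.
  by apply: (cvg_conv (y := fun _ _ => 1)) => i; [exact: cvg_max _ | exact: cvg_cst].
have h2 : conv (wmax (vr j) (pr j) th) (wmaxmin (vr j) (pr j) th m) n @[j --> \oo] -->
   conv walk_max (walk_maxmin m) n.
  by apply: cvg_conv => i; [exact: cvg_max i | exact: cvg_maxmin].
have e : (fun j => conv (fun k => wmax (vr j) (pr j) th (m + k)) (fun=> 1) n) =
    (fun j => conv (wmax (vr j) (pr j) th) (wmaxmin (vr j) (pr j) th m) n).
  by apply/funext => j; exact: wmax_wmaxmin.
by rewrite e in h1; exact: cvg_unique h1 h2.
Qed.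

End iid_walk.

Section walk_generating_functions.
Context {R : realType} d {T : measurableType d} (P : probability T R).
Variables (Y : nat -> T -> R) (th r : R).
Hypothesis th0 : 0 <= th.
Hypothesis mY : forall i, measurable_fun setT (Y i).
Hypothesis Yid : forall i A, measurable A -> P (Y i @^-1` A) = P (Y 0%N @^-1` A).
Hypothesis Yind : forall n (A : nat -> set R), (forall i, measurable (A i)) ->
  P (\bigcap_(i < n) (Y i @^-1` A i)) = (\prod_(i < n) P (Y i @^-1` A i))%E.
Hypothesis r01 : 0 <= r < 1.

Lemma measurable_lmax_map (s : seq nat) :
  measurable_fun setT (fun w => lmax [seq Y i w | i <- s]).
Proof.
elim: s => [|i s IH] /=; first exact: measurable_cst.
by apply: measurable_maxr => //; exact: measurable_funD.
Qed.

Lemma measurable_lmin_map (s : seq nat) :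
  measurable_fun setT (fun w => lmin [seq Y i w | i <- s]).
Proof.
elim: s => [|i s IH] /=; first exact: measurable_cst.
by apply: measurable_minr => //; exact: measurable_funD.
Qed.

Lemma Rintegral_unit_bounds (f : T -> R) : measurable_fun setT f ->
  (forall w, 0 <= f w <= 1) -> 0 <= \int[P]_w f w <= 1.
Proof.
move=> mf f01; apply/andP; split; first by apply: Rintegral_ge0 => w _; case/andP: (f01 w).
rewrite -(Rintegral_cst_prob P 1); apply: le_Rintegral => //.
- by apply: (@bounded_integrable _ _ _ _ _ 1) => // w; case/andP: (f01 w) => h1 h2; rewrite ger0_norm.
- exact: finite_measure_integrable_cst.
- by move=> w _; case/andP: (f01 w).
Qed.

Lemma measurable_eminus (f : T -> R) : measurable_fun setT f ->
  measurable_fun setT (fun w => eminus th (f w)).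
Proof.
move=> mf; have mg : measurable_fun setT (fun w => - th * Num.max (f w) 0).
  apply: measurable_funM; first exact: measurable_cst.
  by apply: measurable_maxr => //; exact: measurable_cst.
exact: measurableT_comp (@measurable_expR R) mg.
Qed.

Lemma walk_max_bounds n : 0 <= walk_max P Y th n <= 1.
Proof.
apply: Rintegral_unit_bounds => [|w]; last exact: expR_lmax_bounds.
apply: (measurableT_comp (@measurable_expR R)).
by apply: measurable_funM; [exact: measurable_cst | exact: measurable_lmax_map].
Qed.

Lemma walk_pos_bounds n : 0 <= walk_pos P Y th n <= 1.
Proof.
apply: Rintegral_unit_bounds => [|w]; last exact: eminus_bounds.
apply: measurable_eminus; rewrite /word /lsum.
under eq_fun do rewrite big_map.
exact: measurable_sum.
Qed.

Lemma eminus_anti (x y : R) : x <= y -> eminus th y <= eminus th x.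
Proof. by move=> xy; rewrite ler_expR !mulNr lerN2 ler_wpM2l// le_max2. Qed.

(** The expectation over the second walk is a monotone function of the value
    of the first one. *)
Lemma measurable_Rintegral_eminus (f : T -> R) : measurable_fun setT f ->
  measurable_fun setT (fun z : R => \int[P]_v eminus th (z + f v)).
Proof.
move=> mf.
have mz z : measurable_fun setT (fun v => eminus th (z + f v)).
  by apply: measurable_eminus; apply: measurable_funD => //; exact: measurable_cst.
have iz z : P.-integrable setT (EFin \o (fun v => eminus th (z + f v))).
  by apply: (@bounded_integrable _ _ _ _ _ 1) => // v; exact: eminus_norm.
suff : measurable_fun setT (fun z : R => - \int[P]_v eminus th (z + f v)).
  by move/measurable_funN; apply: eq_measurable_fun => z _ /=; rewrite opprK.
apply: nondecreasing_measurable => // x y xy; rewrite lerN2.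
by apply: le_Rintegral => // v _; apply: eminus_anti; rewrite lerD2r.
Qed.

Lemma walk_maxmin_bounds m n : 0 <= walk_maxmin P Y th m n <= 1.
Proof.
apply: Rintegral_unit_bounds => [|w].
  exact: (measurableT_comp (measurable_Rintegral_eminus (measurable_lmin_map _))
    (measurable_lmax_map _)).
apply: Rintegral_unit_bounds => [|v]; last exact: eminus_bounds.
apply: measurable_eminus; apply: measurable_funD; first exact: measurable_cst.
exact: measurable_lmin_map.
Qed.

(** The Laplace transform of the maximum at an independent geometric time. *)
Lemma walk_max_gf : (1 - r) * limn (pseries (walk_max P Y th) r) =
  expR (- limn (pseries (fun n => (1 - walk_pos P Y th n) / n%:R) r)).
Proof.
apply: pseries_expR_gap => //.
- exact: walk_max_bounds.
- exact: walk_pos_bounds.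
- rewrite /walk_max /word /= mulr0 expR0; exact: Rintegral_cst_prob.
- rewrite /walk_pos /word /= lsum_nil /eminus maxxx mulr0 expR0; exact: Rintegral_cst_prob.
- exact: walk_max_pos.
Qed.

Lemma walk_maxmin_gf m : limn (pseries (fun n => walk_max P Y th (m + n)) r) =
  (1 - r) * limn (pseries (walk_max P Y th) r) * limn (pseries (walk_maxmin P Y th m) r).
Proof.
have /andP[r0 r1] := r01.
have b1 (n : nat) : 0 <= (1 : R) <= 1 by rewrite ler01 lexx.
have ge0 (a : nat -> R) : (forall n, 0 <= a n <= 1) -> forall n, 0 <= a n.
  by move=> h n; case/andP: (h n).
have bmn n := walk_max_bounds (m + n).
have h1 := pseries_conv (ge0 _ bmn) (ge0 _ b1) (disc_cvg_unit bmn) (disc_cvg_unit b1) r01.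
have h2 := pseries_conv (ge0 _ walk_max_bounds) (ge0 _ (walk_maxmin_bounds m))
  (disc_cvg_unit walk_max_bounds) (disc_cvg_unit (walk_maxmin_bounds m)) r01.
have e : conv (fun n => walk_max P Y th (m + n)) (fun=> 1) =
    conv (walk_max P Y th) (walk_maxmin P Y th m).
  by apply/funext => n; exact: walk_max_maxmin.
rewrite e in h1.
have h : limn (pseries (fun n => walk_max P Y th (m + n)) r) / (1 - r) =
    limn (pseries (walk_max P Y th) r) * limn (pseries (walk_maxmin P Y th m) r).
  by rewrite -(pseries_one r01); exact: cvg_unique h1 h2.
have r1' : 1 - r != 0 by rewrite subr_eq0 gt_eqF.
by rewrite -mulrA -h mulrCA mulfV// mulr1.
Qed.

End walk_generating_functions.

(** * Extrema as extrema of partial sums *)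

Section extrema_partial_sums.
Context {R : realType}.
Implicit Types s : seq R.

Lemma lmax_ge s k : (k <= size s)%N -> lsum (take k s) <= lmax s.
Proof.
elim: s k => [|x s IH] [|k]//= ks; rewrite ?lsum_nil// le_max.
  by rewrite lexx.
by rewrite lsum_cons lerD2l IH// orbT.
Qed.

Lemma lmax_attained s : exists2 k, (k <= size s)%N & lmax s = lsum (take k s).
Proof.
elim: s => [|x s [k ks e]] /=; first by exists 0%N; rewrite ?lsum_nil.
case: (leP 0 (x + lmax s)) => h; last by exists 0%N; rewrite ?take0 ?lsum_nil.
by exists k.+1; rewrite //= lsum_cons e.
Qed.

Lemma lmin_le s k : (k <= size s)%N -> lmin s <= lsum (take k s).
Proof.
elim: s k => [|x s IH] [|k]//= ks; rewrite ?lsum_nil// ge_min.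
  by rewrite lexx.
by rewrite lsum_cons lerD2l IH// orbT.
Qed.

Lemma lmin_attained s : exists2 k, (k <= size s)%N & lmin s = lsum (take k s).
Proof.
elim: s => [|x s [k ks e]] /=; first by exists 0%N; rewrite ?lsum_nil.
case: (leP 0 (x + lmin s)) => h; first by exists 0%N; rewrite ?take0 ?lsum_nil.
by exists k.+1; rewrite //= lsum_cons e.
Qed.

End extrema_partial_sums.

(** * The skeleton of a Levy process *)

Section skeleton.
Context {R : realType} d {T : measurableType d} (P : probability T R).
Variables (X : R -> {RV P >-> R}) (h : R).
Hypothesis hX : levy_process X.
Hypothesis h0 : 0 <= h.

Definition increment (i : nat) (w : T) : R := X (i.+1%:R * h) w - X (i%:R * h) w.

Lemma measurable_increment i : measurable_fun setT (increment i).
Proof. exact: measurable_funB. Qed.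

Lemma increment_law i A : measurable A ->
  P (increment i @^-1` A) = P (increment 0 @^-1` A).
Proof.
move=> mA.
have E j : P (increment j @^-1` A) = P (X h @^-1` A).
  have := levy_stationary hX (s := j%:R * h) (t := h).
  rewrite mulr_ge0// h0 => /(_ isT isT _ mA) <-.
  congr (P _); rewrite /increment; apply/seteqP.
  by split => w /=; rewrite -natr1 mulrDl mul1r.
by rewrite !E.
Qed.

Lemma increment_indep n (A : nat -> set R) : (forall i, measurable (A i)) ->
  P (\bigcap_(i < n) (increment i @^-1` A i)) =
  (\prod_(i < n) P (increment i @^-1` A i))%E.
Proof.
move=> mA.
have t0 : 0 <= 0%:R * h by rewrite mul0r.
have ti i : i%:R * h <= i.+1%:R * h by rewrite ler_wpM2r// ler_nat.
exact: (@levy_independent _ _ _ _ _ hX n (fun i => i%:R * h) t0 ti A mA).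
Qed.

Lemma lsum_increment n w : lsum (word increment n w) = X (n%:R * h) w.
Proof.
rewrite /lsum /word big_map -{1}[n]subn0 -/(index_iota 0 n) big_mkord.
rewrite -(big_mkord xpredT (fun i => increment i w)) /increment.
by rewrite telescope_sumr// mul0r (levy_start hX) subr0.
Qed.

Lemma take_word (Y : nat -> T -> R) k n w : (k <= n)%N -> take k (word Y n w) = word Y k w.
Proof. by move=> kn; rewrite /word -map_take take_iota (minn_idPl kn). Qed.

Lemma lmax_increment_ge n k w : (k <= n)%N -> X (k%:R * h) w <= lmax (word increment n w).
Proof.
move=> kn; rewrite -lsum_increment -(take_word _ _ kn).
by apply: lmax_ge; rewrite size_map size_iota.
Qed.

Lemma lmax_increment_attained n w :
  exists2 k, (k <= n)%N & lmax (word increment n w) = X (k%:R * h) w.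
Proof.
have [k] := lmax_attained (word increment n w).
rewrite size_map size_iota => kn e; exists k => //.
by rewrite e take_word// lsum_increment.
Qed.

Lemma lmin_increment_le n k w : (k <= n)%N -> lmin (word increment n w) <= X (k%:R * h) w.
Proof.
move=> kn; rewrite -lsum_increment -(take_word _ _ kn).
by apply: lmin_le; rewrite size_map size_iota.
Qed.

Lemma lmin_increment_attained n w :
  exists2 k, (k <= n)%N & lmin (word increment n w) = X (k%:R * h) w.
Proof.
have [k] := lmin_attained (word increment n w).
rewrite size_map size_iota => kn e; exists k => //.
by rewrite e take_word// lsum_increment.
Qed.

End skeleton.

(** * Running infimum and overall supremum of a cadlag path *)

Section paths.
Context {R : realType}.
Variable f : R -> R.
Hypothesis cf : cadlag f.

Lemma cadlag_right (s : R) (e : R) : 0 <= s -> 0 < e ->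
  exists2 dl, 0 < dl & forall y, s < y < s + dl -> `|f s - f y| < e.
Proof.
move=> s0 e0; have /cvgrPdist_lt/(_ e e0) := cf.1 s s0.
case=> dl /= dl0 h; exists dl => // y /andP[sy ysd].
apply: h => //=; rewrite /ball/= distrC ger0_norm ?subr_ge0 ?ltW//.
by rewrite ltrBlDl.
Qed.

Lemma cadlag_left (s : R) : 0 < s ->
  exists2 dl, 0 < dl & exists B, forall y, s - dl < y < s -> `|f y| <= B.
Proof.
move=> s0; have /cvg_ex[l /cvgrPdist_lt/(_ 1 ltr01)] := cf.2 s s0.
case=> dl /= dl0 h; exists dl => //; exists (`|l| + 1) => y /andP[sy ys].
have {}h : `|l - f y| < 1.
  apply: h => //=; rewrite /ball/= ger0_norm ?subr_ge0 ?ltW//.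
  by rewrite ltrBlDl -ltrBlDr.
rewrite -[f y](subKr l); apply: (le_trans (ler_normB _ _)).
by rewrite lerD2l ltW.
Qed.

(** Every time has a neighbourhood on which the path is bounded, by its right
    limit and its left limit; conclude by compactness. *)
Lemma cadlag_bounded (t : R) : exists B : R, forall u : R, 0 <= u <= t -> `|f u| <= B.
Proof.
have /compact_near_coveringP : compact `[0, t] := @segment_compact R 0 t.
move=> /(_ R (nbhs +oo) (fun i x => 0 <= x -> `|f x| <= i) _)[].
  move=> x; rewrite /= in_itv/= => /andP[x0 _].
  have [d1 d10 h1] := cadlag_right x0 ltr01.
  have [d2 d20 [B h2]] : exists2 dl, 0 < dl & exists B, forall y,
      0 <= y -> x - dl < y < x -> `|f y| <= B.
    move: x0; rewrite le_eqVlt => /predU1P[<-|x0].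
      by exists 1 => //; exists 0 => y y0 /andP[_]; rewrite ltNge y0.
    by have [dl dl0 [B h]] := cadlag_left x0; exists dl => //; exists B => y _; exact: h.
  exists (ball x (Num.min d1 d2), [set i | `|B| + `|f x| + 1 < i]).
    split; first by apply: nbhsx_ballx; rewrite lt_min d10.
    by exists (`|B| + `|f x| + 1); split => //; exact: num_real.
  move=> [y i] /= [+ Bi] y0; rewrite /ball/= lt_min => /andP[xy1 xy2].
  have ifx : `|f x| + 1 <= i by apply: le_trans (ltW Bi); rewrite -addrA lerDr.
  have iB : `|B| <= i by apply: le_trans (ltW Bi); rewrite -addrA lerDl addr_ge0.
  case: (ltgtP x y) => [xy|yx|<-].
  - apply: le_trans ifx; rewrite -[f y](subKr (f x)).
    apply: (le_trans (ler_normB _ _)); rewrite lerD2l ltW// h1// xy/=.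
    by move: xy1; rewrite distrC ger0_norm ?subr_ge0 ?ltW// ltrBlDl.
  - apply: le_trans iB; apply: le_trans (ler_norm _).
    apply: h2 => //; rewrite yx andbT.
    by move: xy2; rewrite ger0_norm ?subr_ge0 ?ltW// ltrBlDl -ltrBlDr.
  - by apply: le_trans ifx; rewrite lerDl.
move=> M [Mr h]; exists (M + 1) => u /andP[u0 ut].
by apply: (h (M + 1)) => //=; rewrite ?ltrDl// in_itv/= u0.
Qed.

Let past (t : R) := [set f u | u in [set u : R | 0 <= u /\ (u%:E <= t%:E)%E]].

Let has_lbound_past t : has_lbound (past t).
Proof.
have [B hB] := cadlag_bounded t; exists (- B) => _ [u [u0 ut] <-]; rewrite lee_fin in ut.
by have := hB u; rewrite u0 ut => /(_ isT); rewrite ler_norml => /andP[].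
Qed.

Lemma running_inf_le (t u : R) : 0 <= u <= t -> running_inf f t%:E <= f u.
Proof.
move=> /andP[u0 ut]; apply: ge_inf; first exact: has_lbound_past.
by exists u => //; split => //; rewrite lee_fin.
Qed.

Lemma running_inf_approx (t e : R) : 0 <= t -> 0 < e ->
  exists2 u, 0 <= u <= t & f u < running_inf f t%:E + e.
Proof.
move=> t0 e0; have hi : has_inf (past t).
  split; last exact: has_lbound_past.
  by exists (f 0); exists 0 => //; split; rewrite ?lee_fin.
have [_ [u [u0 ut] <-] h] := inf_adherent e0 hi; rewrite lee_fin in ut.
by exists u => //; rewrite u0.
Qed.

Lemma running_inf_mono (s t : R) : 0 <= s <= t ->
  running_inf f t%:E <= running_inf f s%:E.
Proof.
move=> /andP[s0 st]; apply: lb_le_inf.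
  by exists (f 0); exists 0 => //; split; rewrite ?lee_fin.
move=> _ [u [u0 us] <-]; rewrite lee_fin in us; apply: running_inf_le.
by rewrite u0 (le_trans us).
Qed.

Lemma workload_ge0 (q0 u : R) : 0 <= u -> 0 <= workload q0 f u.
Proof.
move=> u0; have := running_inf_le (t := u) (u := u); rewrite u0 lexx => /(_ isT) h.
by rewrite /workload -lerBlDr sub0r le_max lerN2 h orbT.
Qed.

(** At a time [u] where the path is close to its running infimum, the
    reflection term is at most [Num.max q0 (- running_inf f t)], so the workload
    at [u] is close to the lower bound valid at all times. *)
Lemma running_inf_workload (q0 t : R) : 0 <= t ->
  running_inf (workload q0 f) t%:E = Num.max 0 (q0 + running_inf f t%:E).
Proof.
move=> t0; have ge u : 0 <= u <= t ->
    Num.max 0 (q0 + running_inf f t%:E) <= workload q0 f u.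
  move=> ut; have /andP[u0 _] := ut; rewrite ge_max workload_ge0//=.
  by apply: lerD; rewrite ?running_inf_le// le_max lexx.
apply/eqP; rewrite eq_le; apply/andP; split; last first.
  apply: lb_le_inf; first by exists (workload q0 f 0); exists 0 => //; split; rewrite ?lee_fin.
  by move=> _ [u [u0 ut] <-]; rewrite lee_fin in ut; apply: ge; rewrite u0.
apply/ler_addgt0Pr => e e0; have [u ut fu] := running_inf_approx t0 e0.
have /andP[u0 _] := ut.
apply: (@le_trans _ _ (workload q0 f u)).
  apply: ge_inf.
    exists 0 => _ [v [v0 _] <-]; exact: workload_ge0.
  by exists u => //; case/andP: ut => ? ?; split; rewrite ?lee_fin.
apply: (@le_trans _ _ (Num.max q0 (- running_inf f t%:E) + (running_inf f t%:E + e))).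
  rewrite /workload; apply: lerD; last exact: ltW.
  by apply: le_max2 => //; rewrite lerN2 running_inf_mono.
by rewrite addrA lerD2r addr_maxl addNr maxC.
Qed.

(** Once the path is below [- q0], the workload has been empty. *)
Lemma running_inf_workload_pinfty (q0 : R) :
  f x @[x --> +oo] --> -oo -> running_inf (workload q0 f) +oo%E = 0.
Proof.
move=> foo; have /cvgrNyPlt/(_ (- q0)) := foo => -[M [_ hM]].
pose t := `|M| + 1.
have Mt : M < t by rewrite (le_lt_trans (ler_norm M))// ltrDl.
have t0 : 0 <= t by rewrite addr_ge0.
have ft := hM _ Mt.
have it : running_inf (workload q0 f) t%:E = 0.
  rewrite running_inf_workload//; apply/max_idPl; rewrite -lerBrDl sub0r.
  by apply: le_trans (ltW ft); apply: running_inf_le; rewrite t0 lexx.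
apply/eqP; rewrite eq_le; apply/andP; split; last first.
  apply: lb_le_inf; first by exists (workload q0 f 0); exists 0 => //; split; rewrite ?leey.
  by move=> _ [u [u0 _] <-]; exact: workload_ge0.
rewrite -it; apply: lb_le_inf.
  by exists (workload q0 f 0); exists 0 => //; split; rewrite ?lee_fin.
move=> _ [u [u0 _] <-]; apply: ge_inf.
  by exists 0 => _ [v [v0 _] <-]; exact: workload_ge0.
by exists u => //; split; rewrite ?leey.
Qed.

(** Dyadic, so that the grids are nested. *)
Definition mesh (k : nat) : R := (2 ^+ k)^-1.

Lemma mesh_gt0 k : 0 < mesh k.
Proof. by rewrite invr_gt0 exprn_gt0. Qed.

Lemma cvg_mesh : mesh k @[k --> \oo] --> 0.
Proof.
rewrite /mesh; under eq_fun do rewrite -exprVn.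
by apply: cvg_expr; rewrite ger0_norm ?invr_ge0// invf_lt1// ltr1n.
Qed.

(** Strictly after [s]: the path is only right-continuous, and its values at
    these points converge to the value at [s] even if it jumps there. *)
Definition grid_index (k : nat) (s : R) : nat := (Num.truncn (s / mesh k)).+1.

Lemma grid_index_bounds k s : 0 <= s ->
  s < (grid_index k s)%:R * mesh k <= s + mesh k.
Proof.
move=> s0; have m0 := mesh_gt0 k.
have /truncn_itv/andP[h1 h2] : 0 <= s / mesh k by rewrite divr_ge0// ltW.
rewrite -ltr_pdivrMr// h2/= /grid_index -natr1 mulrDl mul1r lerD2r.
by rewrite -ler_pdivlMr.
Qed.

Lemma grid_index_homo k s t : s <= t -> (grid_index k s <= grid_index k t)%N.
Proof. by move=> st; rewrite ltnS le_truncn// ler_wpM2r// invr_ge0 ltW ?mesh_gt0. Qed.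

Lemma cvg_grid_right (s e : R) : 0 <= s -> 0 < e ->
  \forall k \near \oo, forall y, s < y <= s + mesh k -> `|f s - f y| < e.
Proof.
move=> s0 e0; have [dl dl0 h] := cadlag_right s0 e0.
have /cvgr0Pnorm_lt/(_ dl dl0) := cvg_mesh.
apply: filterS => k; rewrite gtr0_norm ?mesh_gt0// => kd y /andP[sy ys].
by apply: h; rewrite sy (le_lt_trans ys)// ltrD2l.
Qed.

(** A minimum over the grid may use the grid point just after [t]; its value is
    close to the value at [t] by right-continuity. *)
Lemma cvg_grid_min (t : R) (m : nat -> R) : 0 <= t ->
  (forall k j, (j <= grid_index k t)%N -> m k <= f (j%:R * mesh k)) ->
  (forall k, exists2 j, (j <= grid_index k t)%N & m k = f (j%:R * mesh k)) ->
  m k @[k --> \oo] --> running_inf f t%:E.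
Proof.
move=> t0 m_le m_at; apply/cvgrPdist_le => e e0.
have [s st fs] := running_inf_approx t0 (divr_gt0 e0 (ltr0Sn _ 1)).
have /andP[s0 st'] := st.
have gt := cvg_grid_right t0 e0.
have gs := cvg_grid_right s0 (divr_gt0 e0 (ltr0Sn _ 1)).
apply: filterS2 gt gs => k ht hs.
have [j jk mj] := m_at k.
have lo : running_inf f t%:E - e <= m k.
  rewrite mj; have [jt|jt] := leP (j%:R * mesh k) t.
    rewrite lerBlDr; apply: (le_trans (running_inf_le (u := j%:R * mesh k) _)).
      by rewrite jt mulr_ge0// ltW ?mesh_gt0.
    by rewrite lerDl ltW.
  have /ht : t < j%:R * mesh k <= t + mesh k.
    rewrite jt/=; have /andP[_] := grid_index_bounds k t0; apply: le_trans.
    by rewrite ler_wpM2r ?ler_nat// ltW ?mesh_gt0.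
  have : running_inf f t%:E <= f t by apply: running_inf_le; rewrite t0 lexx.
  by rewrite ltr_norml => + /andP[_]; lra.
have hi : m k <= running_inf f t%:E + e.
  apply: (le_trans (m_le k _ (grid_index_homo k st'))).
  have /hs := grid_index_bounds k s0.
  by rewrite ltr_norml => /andP[+ _]; move: fs; lra.
by rewrite ler_norml; apply/andP; split; move: lo hi; lra.
Qed.

(** The grid of mesh [2^-k] is followed up to the [4^k]-th point, hence up to
    time [2^k]: mesh and horizon go to their limits together. *)
Lemma cvg_grid_max (M : nat -> R) :
  (forall k j, (j <= 4 ^ k)%N -> f (j%:R * mesh k) <= M k) ->
  (forall k, exists2 j, (j <= 4 ^ k)%N & M k = f (j%:R * mesh k)) ->
  nondecreasing_seq M /\ (M k)%:E @[k --> \oo] --> overall_sup f.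
Proof.
move=> M_ge M_at.
have ndM : nondecreasing_seq M.
  apply/nondecreasing_seqP => k; have [j jk ->] := M_at k.
  have -> : j%:R * mesh k = (2 * j)%N%:R * mesh k.+1.
    rewrite /mesh exprS natrM invfM mulrACA mulfV ?mul1r//.
  by apply: M_ge; rewrite expnS; apply: leq_mul.
split => //.
have ndE : nondecreasing_seq (fun k => (M k)%:E).
  by move=> i j ij; rewrite lee_fin; exact: ndM.
suff -> : overall_sup f = ereal_sup (range (fun k => (M k)%:E)).
  exact: ereal_nondecreasing_cvgn.
apply/eqP; rewrite eq_le; apply/andP; split.
  apply: ub_ereal_sup => _ [s /= + <-]; rewrite in_itv/= andbT => s0.
  apply/lee_addgt0Pr => e e0.
  have gs := cvg_grid_right s0 e0.
  have : \forall k \near \oo, s + 1 <= 2 ^+ k.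
    have : \forall k \near \oo, s + 1 <= k%:R by exact: nbhs_infty_ger.
    apply: filterS => k /le_trans; apply; rewrite -natrX ler_nat.
    exact/ltnW/ltn_expl.
  move=> big; have [k [hk kb]] := filter_ex (filterI gs big).
  have idx : (grid_index k s <= 4 ^ k)%N.
    rewrite -(ler_nat R) natrX.
    have /andP[_] := grid_index_bounds k s0.
    rewrite -ler_pdivlMr ?mesh_gt0// => /le_trans; apply.
    rewrite /mesh invrK -[4]/(2 * 2)%:R natrM exprMn.
    apply: ler_wpM2r; first exact: exprn_ge0.
    apply: le_trans kb; rewrite lerD2l invf_le1 ?exprn_gt0//.
    by rewrite exprn_ege1// ler1n.
  have /hk := grid_index_bounds k s0.
  rewrite ltr_norml => /andP[_ h].
  apply: (@le_trans _ _ ((M k)%:E + e%:E)%E).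
    by rewrite -EFinD lee_fin; have := M_ge k _ idx; lra.
  by apply: leeD => //; apply: ereal_sup_ubound; exists k.
apply: ub_ereal_sup => _ [k _ <-]; have [j _ ->] := M_at k.
apply: ereal_sup_ubound; exists (j%:R * mesh k) => //=.
by rewrite in_itv/= andbT mulr_ge0// ltW// mesh_gt0.
Qed.

End paths.

(** * Independence *)

Section independence.
Context {R : realType} d {T : measurableType d} (P : probability T R).

Lemma rounding_sumE (j : nat) (F : R -> R) (U : T -> R) w :
  F (rounding j (U w)) = \sum_(v <- rounding_values j)
    F v * \1_(U @^-1` (rounding j @^-1` [set v])) w.
Proof.
rewrite (bigD1_seq (rounding j (U w))) ?rounding_in ?rounding_values_uniq//=.
rewrite indicE mem_set// mulr1 big1 ?addr0// => v vn.
by rewrite indicE memNset ?mulr0//= => e; rewrite e eqxx in vn.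
Qed.

Lemma measurable_preimage_rounding (j : nat) (v : R) (U : T -> R) :
  measurable_fun setT U -> measurable (U @^-1` (rounding j @^-1` [set v])).
Proof.
move=> mU; rewrite -[X in measurable X]setTI; apply: mU => //.
by rewrite -[X in measurable X]setTI; apply: measurable_rounding.
Qed.

Lemma rounding_norm_le (j : nat) (x : R) : `|rounding j x| <= `|x| + 1.
Proof.
have /andP[c0 c1] := clamp_bounds j x.
rewrite /rounding /rounding_value /rounding_code.
set c := Num.min _ _ in c0 c1 *.
have J0 : 0 < j.+1%:R :> R by [].
have z0 : 0 <= (c + j%:R) * j.+1%:R by rewrite mulr_ge0.
have /andP[t1 t2] := truncn_itv z0.
set n := Num.truncn _ in t1 t2 *.
have h1 : n%:R / j.+1%:R <= c + j%:R by rewrite ler_pdivrMr.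
have h2 : c + j%:R <= n%:R / j.+1%:R + 1.
  rewrite -(ler_pM2r J0) [leRHS]mulrDl mul1r divfK ?gt_eqF//.
  by apply: (le_trans (ltW t2)); rewrite -natr1 lerD2l ler1n.
have h3 : `|c| <= `|x|.
  rewrite /c; move: (j%:R : R) (ler0n R j) => J J0'.
  have := ler_norm x; have := ler_norm (- x); rewrite normrN ler_norml => h4 h5.
  case: (leP x (- J)) => h; [case: (leP (- J) J)|case: (leP x J)] => h';
    by apply/andP; split; lra.
apply: (@le_trans _ _ (`|c| + 1)); last by rewrite lerD2r.
move: h1 h2; set a := n%:R / _; move: (j%:R : R) => J h1 h2.
have := ler_norm c; have := ler_norm (- c); rewrite normrN => h4 h5.
by rewrite ler_norml; apply/andP; split; lra.
Qed.

(** Independence is given as a product rule for events; rounding reduces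
    expectations to finite sums of such products. *)
Lemma indep_event_Rintegral (A : set T) (Z : T -> R) (C : R) :
  measurable A -> measurable_fun setT Z -> (forall w, `|Z w| <= C) ->
  (forall B, measurable B -> P (A `&` Z @^-1` B) = (P A * P (Z @^-1` B))%E) ->
  \int[P]_w (\1_A w * Z w) = fine (P A) * \int[P]_w Z w.
Proof.
move=> mA mZ ZC ind.
have Zb j w : `|rounding j (Z w)| <= C + 1.
  by apply: (le_trans (rounding_norm_le _ _)); rewrite lerD2r.
have mZj j : measurable_fun setT (fun w => rounding j (Z w)).
  exact: measurableT_comp (@measurable_rounding R j) mZ.
have h1 : \int[P]_w rounding j (Z w) @[j --> \oo] --> \int[P]_w Z w.
  by apply: bounded_cvg_Rintegral => // w; exact: cvg_rounding.
have h2 : \int[P]_w (\1_A w * rounding j (Z w)) @[j --> \oo] --> \int[P]_w (\1_A w * Z w).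
  apply: (@bounded_cvg_Rintegral _ _ _ P (fun j w => \1_A w * rounding j (Z w)) _ (C + 1)).
  - by move=> j; apply: measurable_funM.
  - move=> j w; rewrite normrM; apply: le_trans (Zb j w).
    by rewrite indicE; case: (_ \in _); rewrite ?normr1 ?normr0 ?mul1r ?mul0r.
  - by move=> w; apply: cvgM; [exact: cvg_cst | exact: cvg_rounding].
have h3 : fine (P A) * \int[P]_w rounding j (Z w) @[j --> \oo] --> fine (P A) * \int[P]_w Z w.
  by apply: cvgM => //; exact: cvg_cst.
have e : (fun j => \int[P]_w (\1_A w * rounding j (Z w))) =
         (fun j => fine (P A) * \int[P]_w rounding j (Z w)).
  apply/funext => j.
  have mS v := measurable_preimage_rounding j v mZ.
  under eq_Rintegral do rewrite (rounding_sumE j id) mulr_sumr.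
  under [in RHS]eq_Rintegral do rewrite (rounding_sumE j id).
  rewrite (Rintegral_sum _ (f := fun v w => v * \1_(Z @^-1` (rounding j @^-1` [set v])) w)); last first.
    by move=> v; exact: integrable_indic_scale.
  have eI v w : \1_A w * (v * \1_(Z @^-1` (rounding j @^-1` [set v])) w) =
      v * \1_(A `&` Z @^-1` (rounding j @^-1` [set v])) w.
    by rewrite mulrCA indicI.
  under eq_Rintegral do under eq_bigr do rewrite eI.
  rewrite Rintegral_sum; last first.
    by move=> v; apply: integrable_indic_scale; exact: measurableI.
  rewrite mulr_sumr; apply: eq_bigr => v _.
  rewrite !Rintegral_indic_scale//; last exact: measurableI.
  rewrite ind; last by rewrite -[X in measurable X]setTI; apply: measurable_rounding.
  by rewrite fineM ?fin_num_measure// mulrCA.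
by rewrite e in h2; exact: cvg_unique h2 h3.
Qed.

(** Integrating out one of two independent variables, again by rounding. *)
Lemma indep_eminus (th : R) (U V : T -> R) : 0 <= th ->
  measurable_fun setT U -> measurable_fun setT V ->
  (forall B C, measurable B -> measurable C ->
    P (U @^-1` B `&` V @^-1` C) = (P (U @^-1` B) * P (V @^-1` C))%E) ->
  \int[P]_w eminus th (U w + V w) = \int[P]_w \int[P]_v eminus th (U w + V v).
Proof.
move=> th0 mU mV ind.
have mUj j : measurable_fun setT (fun w => rounding j (U w)).
  exact: measurableT_comp (@measurable_rounding R j) mU.
have mzV z : measurable_fun setT (fun v => eminus th (z + V v)).
  by apply: measurable_eminus; apply: measurable_funD => //; exact: measurable_cst.
pose psi z := \int[P]_v eminus th (z + V v).
have psi1 z : `|psi z| <= 1.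
  have /andP[h1 h2] : 0 <= psi z <= 1.
    by apply: Rintegral_unit_bounds => // v; exact: eminus_bounds.
  by rewrite ger0_norm.
have mpsi : measurable_fun setT psi by apply: measurable_Rintegral_eminus.
have h1 : \int[P]_w eminus th (rounding j (U w) + V w) @[j --> \oo] -->
    \int[P]_w eminus th (U w + V w).
  apply: (@bounded_cvg_Rintegral _ _ _ P (fun j w => eminus th (rounding j (U w) + V w)) _ 1).
  - by move=> j; apply: measurable_eminus; exact: measurable_funD.
  - by move=> j w; exact: eminus_norm.
  - by move=> w; apply: cvg_eminus; apply: cvgD; [exact: cvg_rounding | exact: cvg_cst].
have h2 : \int[P]_w psi (rounding j (U w)) @[j --> \oo] --> \int[P]_w psi (U w).
  apply: (@bounded_cvg_Rintegral _ _ _ P (fun j w => psi (rounding j (U w))) _ 1) => //.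
  - by move=> j; exact: measurableT_comp mpsi (mUj j).
  - move=> w; apply: (@bounded_cvg_Rintegral _ _ _ P (fun j v => eminus th (rounding j (U w) + V v)) _ 1) => //.
    + by move=> j v; exact: eminus_norm.
    + by move=> v; apply: cvg_eminus; apply: cvgD; [exact: cvg_rounding | exact: cvg_cst].
have e : (fun j => \int[P]_w eminus th (rounding j (U w) + V w)) =
         (fun j => \int[P]_w psi (rounding j (U w))).
  apply/funext => j.
  have mS v := measurable_preimage_rounding j v mU.
  under [in RHS]eq_Rintegral do rewrite (rounding_sumE j psi).
  rewrite [RHS]Rintegral_sum; last by move=> v; exact: integrable_indic_scale.
  under eq_Rintegral => w _ do rewrite (rounding_sumE j (fun v => eminus th (v + V w))).
  pose f v w := eminus th (v + V w) * \1_(U @^-1` (rounding j @^-1` [set v])) w.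
  rewrite (Rintegral_sum _ (f := f)); last first.
    move=> v; apply: (@bounded_integrable _ _ _ _ _ 1).
      by apply: measurable_funM => //; exact: measurable_indic.
    move=> w; rewrite normrM; apply: le_trans (eminus_norm th0 (v + V w)).
    by rewrite indicE; case: (_ \in _); rewrite ?normr1 ?normr0 ?mulr1 ?mulr0.
  apply: eq_bigr => v _; rewrite Rintegral_indic_scale// mulrC.
  rewrite -(indep_event_Rintegral (C := 1))//.
  - by apply: eq_Rintegral => w _; rewrite mulrC.
  - by move=> w; exact: eminus_norm.
  - move=> B mB.
    rewrite (_ : (fun w => eminus th (v + V w)) @^-1` B =
        V @^-1` ((fun y => eminus th (v + y)) @^-1` B))//.
    apply: ind.
      by rewrite -[X in measurable X]setTI; apply: measurable_rounding.
    rewrite -[X in measurable X]setTI; apply: measurable_eminus => //.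
    by apply: measurable_funD => //; exact: measurable_cst.
by rewrite e in h1; exact: cvg_unique h1 h2.
Qed.

End independence.

(** Capped at 1, so that dominated convergence applies without moments. *)
Lemma eminus_lipschitz (R : realType) (th x y : R) : 0 <= th ->
  `|eminus th x - eminus th y| <= Num.min 1 (th * `|x - y|).
Proof.
move=> th0; wlog xy : x y / x <= y => [hw|].
  have [/hw//|/ltW/hw] := leP x y; by rewrite distrC [`|y - x|]distrC.
have a := eminus_anti th0 xy.
rewrite ger0_norm ?subr_ge0// distrC ger0_norm ?subr_ge0//.
have /andP[x0 x1] := eminus_bounds th0 x; have /andP[y0 y1] := eminus_bounds th0 y.
rewrite le_min; apply/andP; split; first lra.
have -> : eminus th y = eminus th x * expR (- th * (Num.max y 0 - Num.max x 0)).
  by rewrite /eminus -expRD; congr expR; ring.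
rewrite -{1}[eminus th x]mulr1 -mulrBr.
have m : 0 <= Num.max y 0 - Num.max x 0 <= y - x.
  by case: (leP x 0) => hx; case: (leP y 0) => hy; apply/andP; split; lra.
have /andP[m0 m1] := m.
apply: (@le_trans _ _ (1 * (th * (Num.max y 0 - Num.max x 0)))); last first.
  by rewrite mul1r ler_wpM2l.
have : 1 - expR (- th * (Num.max y 0 - Num.max x 0)) <= th * (Num.max y 0 - Num.max x 0).
  by have := expR_ge1Dx (- th * (Num.max y 0 - Num.max x 0)); rewrite mulNr; lra.
apply: ler_pM => //.
rewrite subr_ge0 -[leRHS]expR0 ler_expR mulNr oppr_le0 mulr_ge0//.
Qed.

(** * Exponential times *)

Lemma exponential_prob_lt (R : realType) (q x : R) : 0 < q -> 0 <= x ->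
  exponential_prob q [set z | z < x] = (1 - expR (- q * x))%:E.
Proof.
move=> q0; rewrite le_eqVlt => /predU1P[<-|x0].
  rewrite mulr0 expR0 subrr /exponential_prob; apply: integral0_eq => z /= z0.
  by rewrite lt0_exponential_pdf.
transitivity (exponential_prob q `[0, x]); last by rewrite exponential_prob_itv0c.
rewrite /exponential_prob -integral_itv_bndo_bndc; last first.
  by apply: measurable_funTS; apply/measurable_EFinP; exact: measurable_exponential_pdf.
rewrite [LHS]integral_mkcond [RHS]integral_mkcond; apply: eq_integral => z _.
rewrite !patchE; case: ifPn => [|].
  rewrite inE/= => zx; case: ifPn => //; rewrite notin_setE/= in_itv/= zx andbT => /negP.
  by rewrite -ltNge => z0; rewrite lt0_exponential_pdf.
rewrite notin_setE/= => zx; case: ifPn => //; rewrite inE/= in_itv/= => /andP[_ zx'].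
by rewrite zx' in zx.
Qed.

(** * Abel means *)

Section abel_means.
Context {R : realType}.
Variable r : R.
Hypothesis r01 : 0 <= r < 1.
Implicit Types x y : nat -> R.

(** The expectation of [x] at an independent geometric time of parameter [r]. *)
Definition abel x := (1 - r) * limn (pseries x r).

Lemma cvg_abel x : disc_cvg x -> (1 - r) * pseries x r n @[n --> \oo] --> abel x.
Proof. by move=> dx; apply: cvgM; [exact: cvg_cst | exact: disc_cvgP]. Qed.

Lemma le_abel x y : disc_cvg x -> disc_cvg y -> (forall n, x n <= y n) -> abel x <= abel y.
Proof.
move=> dx dy xy; have /andP[r0 r1] := r01.
rewrite ler_wpM2l ?subr_ge0 ?(ltW r1)//.
apply: lim_series_le; [exact: disc_cvgP | exact: disc_cvgP |].
by move=> n; rewrite ler_wpM2r// exprn_ge0.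
Qed.

Lemma abelB x y : disc_cvg x -> disc_cvg y -> abel (fun n => x n - y n) = abel x - abel y.
Proof.
move=> dx dy; rewrite /abel -mulrBr -limB; [|exact: disc_cvgP..].
suff -> : pseries (fun n => x n - y n) r = pseries x r - pseries y r by [].
apply/funext => n; rewrite /pseries /series /= !fctE -sumrB.
by apply: eq_bigr => i _; rewrite mulrBl.
Qed.

Lemma disc_cvg_cst (c : R) : disc_cvg (fun=> c).
Proof. by apply: (@disc_cvg_bounded _ _ `|c|). Qed.

Lemma abel_cst (c : R) : abel (fun=> c) = c.
Proof.
have /andP[r0 r1] := r01.
have h : limn (pseries (fun=> c) r) = c * (1 - r)^-1.
  by apply: cvg_lim => //; apply: cvg_geometric_series; rewrite ger0_norm.
by rewrite /abel h mulrCA mulfV ?mulr1// subr_eq0 gt_eqF.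
Qed.

Lemma abel_dist x y (e : R) : disc_cvg x -> disc_cvg y -> (forall n, `|x n - y n| <= e) ->
  `|abel x - abel y| <= e.
Proof.
move=> dx dy xy; rewrite -abelB//.
have dxy : disc_cvg (fun n => x n - y n) by apply: (disc_cvg_bounded xy).
rewrite ler_norml; apply/andP; split.
- rewrite -[leLHS]abel_cst; apply: le_abel => [||n]; [exact: disc_cvg_cst|by []|].
  by have := xy n; rewrite ler_norml => /andP[].
- rewrite -[leRHS]abel_cst; apply: le_abel => [||n]; [by []|exact: disc_cvg_cst|].
  by have := xy n; rewrite ler_norml => /andP[].
Qed.

Lemma pseries_recl x n : pseries x r n.+1 = x 0%N + r * pseries (fun i => x i.+1) r n.
Proof.
rewrite /pseries /series /= big_nat_recl// expr0 mulr1; congr (_ + _).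
by rewrite mulr_sumr; apply: eq_bigr => i _; rewrite exprS mulrCA.
Qed.

Lemma abel_recl x : disc_cvg x -> disc_cvg (fun n => x n.+1) ->
  abel x = (1 - r) * x 0%N + r * abel (fun n => x n.+1).
Proof.
move=> dx dx'; rewrite /abel mulrCA -mulrDr; congr (_ * _).
have h : pseries x r n.+1 @[n --> \oo] --> x 0%N + r * limn (pseries (fun i => x i.+1) r).
  under eq_fun do rewrite pseries_recl.
  by apply: cvgD; [exact: cvg_cst | apply: cvgM; [exact: cvg_cst | exact: disc_cvgP]].
by apply: cvg_lim => //; rewrite -cvg_shiftS; exact: h.
Qed.

(** The first [n0] terms have total weight [1 - r ^ n0]. *)
Lemma abel_le_split x (c : R) n0 : (forall n, 0 <= x n <= 1) -> 0 <= c ->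
  (forall n, (n0 <= n)%N -> x n <= c) -> abel x <= 1 - r ^+ n0 + c.
Proof.
move=> x01 c0 xc; have dx := disc_cvg_unit x01; have /andP[r0 r1] := r01.
elim: n0 x x01 dx xc => [|n0 IH] x x01 dx xc.
  rewrite expr0 subrr add0r -[leRHS]abel_cst.
  by apply: le_abel => // [|n]; [exact: disc_cvg_cst | exact: xc].
have x01' n : 0 <= x n.+1 <= 1 by exact: x01.
rewrite abel_recl//; last exact: disc_cvg_unit.
have h := IH (fun n => x n.+1) x01' (disc_cvg_unit x01') (fun n hn => xc n.+1 hn).
have /andP[_ x1] := x01 0%N.
apply: (@le_trans _ _ ((1 - r) * 1 + r * (1 - r ^+ n0 + c))).
  by apply: lerD; rewrite ler_wpM2l// subr_ge0 ltW.
by have : r * c <= c; [rewrite ler_piMl// ltW | rewrite exprS; lra].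
Qed.

End abel_means.

Section levy_limit.
Context {R : realType} {d : measure_display} {T : measurableType d} {P : probability T R}.
Variables (X : R -> {RV P >-> R}) (Q0 : {RV P >-> R}) (th : R).
Hypothesis hX : levy_process X.
Hypothesis hQ0_ge0 : forall w, 0 <= Q0 w.
Hypothesis hQ0_law : same_law P (fun w => (Q0 w)%:E)
                          (fun w => overall_sup (fun t => X t w)).
Hypothesis th0 : 0 <= th.

Let inc k := increment X (mesh k).
Let S w := overall_sup (fun t => X t w).

Definition grid_max k w := lmax (word (increment X (mesh k)) (4 ^ k) w).

Let mesh_ge0 k : 0 <= mesh k :> R. Proof. exact/ltW/mesh_gt0. Qed.

Lemma grid_max_cvg w :
  nondecreasing_seq (grid_max ^~ w) /\ (grid_max k w)%:E @[k --> \oo] --> S w.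
Proof.
apply: cvg_grid_max; first exact: levy_cadlag hX w.
- by move=> k j jk; exact: lmax_increment_ge.
- by move=> k; exact: lmax_increment_attained.
Qed.

Let minc k i : measurable_fun setT (inc k i). Proof. exact: measurable_increment. Qed.

Let mlmax k n : measurable_fun setT (fun w => lmax (word (inc k) n w)).
Proof. by apply: measurable_lmax_map. Qed.

Let mlmin k n : measurable_fun setT (fun w => lmin (word (inc k) n w)).
Proof. by apply: measurable_lmin_map. Qed.

Lemma measurable_overall_sup : measurable_fun setT S.
Proof.
apply: (emeasurable_fun_cvg (fun k w => (grid_max k w)%:E)) => [k|w _].
  by apply/measurable_EFinP; exact: mlmax.
exact: (grid_max_cvg w).2.
Qed.

Lemma le_overall_sup t w : 0 <= t -> ((X t w)%:E <= S w)%E.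
Proof. by move=> t0; apply: ereal_sup_ubound; exists t => //=; rewrite in_itv/= t0. Qed.

Lemma lmax_le_overall_sup k n w : ((lmax (word (inc k) n w))%:E <= S w)%E.
Proof.
have [j _ ->] := lmax_increment_attained (mesh k) hX n w.
by apply: le_overall_sup; rewrite mulr_ge0.
Qed.

(** The supremum has the law of the real-valued [Q0]. *)
Lemma overall_sup_fin : {ae P, forall w, S w = (fine (S w))%:E}.
Proof.
exists (S @^-1` [set +oo%E]); split.
- by rewrite -[X in measurable X]setTI; apply: measurable_overall_sup.
- have := hQ0_law (A := [set +oo%E]) (emeasurable_set1 _) => /= <-.
  by rewrite (_ : _ @^-1` _ = set0) ?measure0// -subset0 => w.
- move=> w /= Sw; have : (0 <= S w)%E.
    by have := le_overall_sup w (lexx 0); rewrite (levy_start hX).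
  by case: (S w) Sw => [s|//|//] [].
Qed.

Lemma Rintegral_Q0 (psi : R -> R) : measurable_fun setT psi -> (forall z, 0 <= psi z) ->
  \int[P]_w psi (Q0 w) = \int[P]_w psi (fine (S w)).
Proof.
move=> mpsi psi0; rewrite /Rintegral; congr fine.
have mf : measurable_fun setT (fun y : \bar R => (psi (fine y))%:E).
  by apply/measurable_EFinP; exact: measurableT_comp mpsi (fine_measurable measurableT).
have mQ : measurable_fun setT (fun w => (Q0 w)%:E) by exact/measurable_EFinP.
have := @ge0_integral_pushforward _ _ _ _ R _ mQ P setT _ measurableT mf.
rewrite preimage_setT /= => <-; last by move=> y _; rewrite lee_fin.
have mSS : measurable_fun setT S by exact: measurable_overall_sup.
have := @ge0_integral_pushforward _ _ _ _ R _ mSS P setT _ measurableT mf.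
rewrite preimage_setT /= => <-; last by move=> y _; rewrite lee_fin.
apply: eq_measure_integral => A mA _.
exact: (hQ0_law (A := A) mA).
Qed.

Definition max_transform := \int[P]_w expR (- th * Q0 w).
Local Notation ainf := max_transform.

Definition grid_transform k := walk_max P (increment X (mesh k)) th (4 ^ k).

Let mexp (f : T -> R) : measurable_fun setT f -> measurable_fun setT (fun w => expR (- th * f w)).
Proof.
move=> mf; apply: (measurableT_comp (@measurable_expR R)).
by apply: measurable_funM; [exact: measurable_cst|].
Qed.

Let mS : measurable_fun setT (fun w => fine (S w)).
Proof. exact: measurableT_comp (fine_measurable measurableT) measurable_overall_sup. Qed.

Let ainfE : ainf = \int[P]_w expR (- th * fine (S w)).
Proof.
apply: (Rintegral_Q0 (psi := fun z => expR (- th * z))) => [|z]; last exact: expR_ge0.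
apply: (measurableT_comp (@measurable_expR R)).
by apply: measurable_funM; [exact: measurable_cst|].
Qed.

Lemma max_transform_gt0 : 0 < ainf.
Proof.
rewrite lt_neqAle Rintegral_ge0 ?andbT; last by move=> *; exact: expR_ge0.
apply/eqP => /esym h.
have i : P.-integrable setT (EFin \o (fun w => expR (- th * Q0 w))).
  apply: (@bounded_integrable _ _ _ _ _ 1) => [|w]; first exact: mexp.
  by rewrite ger0_norm ?expR_ge0// -expR0 ler_expR mulNr oppr_le0 mulr_ge0.
have : (\int[P]_w `|(expR (- th * Q0 w))%:E| = 0)%E.
  under eq_integral do rewrite abse_EFin ger0_norm ?expR_ge0//.
  by rewrite -[LHS]fineK ?(integrable_fin_num _ i)//; congr EFin.
move/(ae_eq_integral_abs _ measurableT) => /=.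
have me : measurable_fun setT (fun w => (expR (- th * Q0 w))%:E).
  by apply/measurable_EFinP; exact: mexp.
move=> /(_ me) [N [mN N0 hN]].
have : P setT = 0%E.
  apply/eqP; rewrite eq_le measure_ge0 andbT -N0; apply: le_measure; rewrite ?inE//.
  by move=> w _; apply: hN => /= /(_ I) [] /eqP; rewrite gt_eqF// expR_gt0.
by rewrite probability_setT => -[] /eqP; rewrite oner_eq0.
Qed.

Lemma max_transform_le k n : ainf <= walk_max P (inc k) th n.
Proof.
rewrite ainfE /walk_max /Rintegral.
have i1 (f : T -> R) : measurable_fun setT f -> (forall w, 0 <= f w) ->
    P.-integrable setT (EFin \o (fun w => expR (- th * f w))).
  move=> mf f0; apply: (@bounded_integrable _ _ _ _ _ 1) => [|w]; first exact: mexp.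
  by rewrite ger0_norm ?expR_ge0// -expR0 ler_expR mulNr oppr_le0 mulr_ge0.
have S0 w : 0 <= fine (S w).
  by apply: fine_ge0; have := le_overall_sup w (lexx 0); rewrite (levy_start hX).
have iS := i1 _ mS S0; have iM := i1 _ (mlmax k n) (fun w => lmax_ge0 _).
apply: fine_le; [exact: integrable_fin_num | exact: integrable_fin_num |].
apply: ae_ge0_le_integral => //.
- exact: (measurable_int P iS).
- exact: (measurable_int P iM).
- apply: filterS overall_sup_fin => w Sw _.
  rewrite lee_fin ler_expR !mulNr lerN2 ler_wpM2l//.
  by rewrite -lee_fin -Sw; exact: lmax_le_overall_sup.
Qed.

Lemma grid_max_ae_cvg : {ae P, forall w, grid_max k w @[k --> \oo] --> fine (S w)}.
Proof.
apply: filterS overall_sup_fin => w Sw.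
have := (grid_max_cvg w).2; rewrite Sw => h.
by have /fine_cvgP[_] := h.
Qed.

Lemma grid_transform_cvg : grid_transform k @[k --> \oo] --> ainf.
Proof.
rewrite ainfE; apply: (bounded_ae_cvg_Rintegral (C := 1)).
- by move=> k; apply: mexp; exact: mlmax.
- exact: mexp.
- by move=> k w; exact: expR_lmax_norm.
- apply: filterS grid_max_ae_cvg => w h; exact: cvg_expRM h.
Qed.

(** After time [2 ^ k0] the finer grid has visited all points of the grid
    [k0] up to that time. *)
Lemma walk_max_le_grid k0 k n : (k0 <= k)%N -> (2 ^ k0 * 2 ^ k <= n)%N ->
  walk_max P (inc k) th n <= grid_transform k0.
Proof.
move=> kk nk; apply: le_Rintegral => //.
- apply: (@bounded_integrable _ _ _ _ _ 1) => [|w]; first by apply: mexp; exact: mlmax.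
  exact: expR_lmax_norm.
- apply: (@bounded_integrable _ _ _ _ _ 1) => [|w]; first by apply: mexp; exact: mlmax.
  exact: expR_lmax_norm.
move=> w _; rewrite ler_expR !mulNr lerN2 ler_wpM2l//.
have [j jk ->] := lmax_increment_attained (mesh k0) hX (4 ^ k0) w.
have -> : j%:R * mesh k0 = (j * 2 ^ (k - k0))%:R * mesh k :> R.
  rewrite /mesh natrM natrX -{2}(subnK kk) exprD invfM mulrA.
  by rewrite mulfK// expf_neq0.
apply: lmax_increment_ge => //; apply: leq_trans nk.
have -> : (2 ^ k0 * 2 ^ k = 4 ^ k0 * 2 ^ (k - k0))%N.
  have -> : (4 ^ k0 = 2 ^ k0 * 2 ^ k0)%N by rewrite -expnMn.
  by rewrite -mulnA -[in RHS]expnD subnKC.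
by rewrite leq_mul2r jk orbT.
Qed.

Section rate.
Variable q : R.
Hypothesis q0 : 0 < q.
Let r k : R := expR (- q * mesh k).

Lemma rate_bounds k : 0 <= r k < 1.
Proof.
by rewrite expR_ge0/= -expR0 ltr_expR mulNr oppr_lt0 mulr_gt0// mesh_gt0.
Qed.

Lemma cvg_rate : r k @[k --> \oo] --> (1 : R).
Proof. by rewrite -expR0 -[X in expR X](mulr0 (- q)); apply: cvg_expRM; exact: cvg_mesh. Qed.

(** The Laplace transform of the maximum at an exponential time of rate [q],
    rounded to the grid: on a grid of mesh [h] that time is geometric of
    parameter [exp(-q h)]. *)
Definition killed_transform k := abel (expR (- q * mesh k))
  (walk_max P (increment X (mesh k)) th).

Let wm_bounds k n : 0 <= walk_max P (inc k) th n <= 1.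
Proof. exact: walk_max_bounds. Qed.

Lemma killed_transform_ge k : ainf <= killed_transform k.
Proof.
rewrite /killed_transform -[leLHS](abel_cst (rate_bounds k)).
apply: (le_abel (rate_bounds k)).
- exact: disc_cvg_cst.
- exact: disc_cvg_unit (wm_bounds k).
- exact: max_transform_le.
Qed.

(** For small [q] the geometric time is beyond [2 ^ k0] with high probability;
    this is what identifies the limit as [q] goes to 0. *)
Lemma killed_transform_le k0 k : (k0 <= k)%N ->
  killed_transform k <= 1 - expR (- q * 2 ^+ k0) + grid_transform k0.
Proof.
move=> kk.
have -> : expR (- q * 2 ^+ k0) = r k ^+ (2 ^ k0 * 2 ^ k)%N.
  rewrite -expRM_natl natrM !natrX /mesh; congr expR.
  by rewrite mulrACA mulfV ?expf_neq0// mulr1 mulrC.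
apply: abel_le_split => //; first exact: rate_bounds.
- exact: wm_bounds.
- by case/andP: (wm_bounds k0 (4 ^ k0)%N).
- by move=> n hn; exact: walk_max_le_grid.
Qed.

Let ind_inc k n (A : nat -> set R) : (forall i, measurable (A i)) ->
  P (\bigcap_(i < n) (inc k i @^-1` A i)) = (\prod_(i < n) P (inc k i @^-1` A i))%E.
Proof. exact: increment_indep. Qed.

Let law_inc k i A : measurable A -> P (inc k i @^-1` A) = P (inc k 0%N @^-1` A).
Proof. exact: increment_law. Qed.

Lemma killed_transformE k : killed_transform k =
  expR (- limn (pseries (fun n => (1 - \int[P]_w eminus th (X (n%:R * mesh k) w)) / n%:R) (r k))).
Proof.
have -> : (fun n => (1 - \int[P]_w eminus th (X (n%:R * mesh k) w)) / n%:R) =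
    (fun n => (1 - walk_pos P (inc k) th n) / n%:R).
  apply/funext => n; congr ((1 - _) / _).
  by apply: eq_Rintegral => w _; rewrite lsum_increment.
exact: (walk_max_gf th0 (minc k) (law_inc k) (ind_inc k) (rate_bounds k)).
Qed.

(** Maximum over a long horizon plus minimum up to the geometric time of an
    independent copy: the grid version of [Q_0] plus the infimum of [X] up to
    the exponential time. *)
Definition killed_maxmin k :=
  abel (expR (- q * mesh k)) (walk_maxmin P (increment X (mesh k)) th (4 ^ k)).

(** The product is exactly a mean of transforms of the maximum over horizons at
    least [2 ^ k], all of which are close to the transform of the overall
    supremum. *)
Lemma killed_maxmin_cvg : killed_transform k * killed_maxmin k @[k --> \oo] --> ainf.
Proof.
have e k : killed_transform k * killed_maxmin k =
    abel (r k) (fun n => walk_max P (inc k) th (4 ^ k + n)).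
  have h := walk_maxmin_gf th0 (minc k) (law_inc k) (ind_inc k) (rate_bounds k) (4 ^ k).
  by rewrite [RHS]/abel h; exact: mulrCA.
under eq_fun do rewrite e.
apply: (@squeeze_cvgr _ _ _ _ (fun=> ainf) grid_transform); last 2 first.
- exact: cvg_cst.
- exact: grid_transform_cvg.
have dm k : disc_cvg (fun n => walk_max P (inc k) th (4 ^ k + n)).
  by apply: disc_cvg_unit => n; exact: wm_bounds.
apply: nearW => k; apply/andP; split.
  rewrite -[leLHS](abel_cst (rate_bounds k)).
  by apply: (le_abel (rate_bounds k)) => [||n]; [exact: disc_cvg_cst|exact: dm|exact: max_transform_le].
rewrite -[leRHS](abel_cst (rate_bounds k)); apply: (le_abel (rate_bounds k)) => [||n].
- exact: dm.
- exact: disc_cvg_cst.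
- apply: walk_max_le_grid => //.
  by rewrite -expnMn leq_addr.
Qed.

End rate.
End levy_limit.

(** * Expectations of functions known up to a null set *)

Section ae_expectation.
Context {R : realType} {d : measure_display} {T : measurableType d} (P : probability T R).
Implicit Types f g : T -> R.

Lemma ge0_le_integral_nonmeasurable (f g : T -> \bar R) :
  (forall w, (0 <= f w)%E) -> (forall w, (f w <= g w)%E) ->
  (\int[P]_w f w <= \int[P]_w g w)%E.
Proof.
move=> f0 fg; have g0 w : (0 <= g w)%E := le_trans (f0 w) (fg w).
rewrite !ge0_integralTE//; apply: le_ereal_sup => _ [h /= hf <-].
by exists h => //= w; exact: le_trans (hf w) (fg w).
Qed.

(** At the exceptional points where the exponential time is negative or
    infinite, the integrand of the theorem is not known to be measurable. It is
    squeezed between measurable functions that differ from [g] only on a null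
    set. *)
Lemma expectation_ae_eq f g : measurable_fun setT g ->
  (forall w, 0 <= f w <= 1) -> (forall w, 0 <= g w <= 1) ->
  {ae P, forall w, f w = g w} -> fine 'E_P[f] = \int[P]_w g w.
Proof.
move=> mg f01 g01 [N [mN N0 fgN]]; rewrite unlock /Rintegral; congr fine.
have fg w : ~ N w -> f w = g w by move=> Nw; apply/not_notP => h; apply: Nw; exact: fgN.
have aeN (a b : T -> \bar R) : (forall w, ~ N w -> a w = b w) -> ae_eq P setT a b.
  by move=> h; exists N; split => // w /= hw; apply: contrapT => /h hab; apply: hw.
have mI : measurable_fun setT (\1_N : T -> R) by exact: measurable_indic.
have mIC : measurable_fun setT (\1_(~` N) : T -> R) by apply: measurable_indic; exact: measurableC.
have mE : measurable_fun setT (fun w => (g w)%:E) by exact/measurable_EFinP.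
apply/eqP; rewrite eq_le; apply/andP; split.
  apply: (@le_trans _ _ (\int[P]_w (Num.max (g w) (\1_N w))%:E)%E).
    apply: ge0_le_integral_nonmeasurable => w; rewrite lee_fin; first by case/andP: (f01 w).
    rewrite le_max; have [Nw|Nw] := pselect (N w); last by rewrite fg// lexx.
    by rewrite indicE mem_set//; case/andP: (f01 w) => _ ->; rewrite orbT.
  rewrite le_eqVlt; apply/orP; left; apply/eqP; apply: ae_eq_integral => //.
    by apply/measurable_EFinP; exact: measurable_maxr.
  apply: aeN => w Nw; rewrite indicE memNset//; congr EFin.
  by apply/max_idPl; case/andP: (g01 w).
apply: (@le_trans _ _ (\int[P]_w (Num.min (g w) (\1_(~` N) w))%:E)%E).
  rewrite le_eqVlt; apply/orP; left; apply/eqP; apply: ae_eq_integral => //.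
    by apply/measurable_EFinP; exact: measurable_minr.
  apply: aeN => w Nw; rewrite indicE mem_set//; congr EFin.
  by apply/esym/min_idPl; case/andP: (g01 w).
apply: ge0_le_integral_nonmeasurable => w; rewrite lee_fin.
  by rewrite le_min; case/andP: (g01 w) => -> _ /=.
rewrite ge_min; have [Nw|Nw] := pselect (N w); last by rewrite fg// lexx.
have -> : \1_(~` N) w = 0 :> R by rewrite indicE memNset//=; exact.
by case/andP: (f01 w) => ->; rewrite orbT.
Qed.

End ae_expectation.

Section sigma_algebras.
Context {R : realType} {d : measure_display} {T : measurableType d} {P : probability T R}.
Variables (X : R -> {RV P >-> R}) (Q0 : {RV P >-> R}) (h : R).
Hypothesis h0 : 0 <= h.

(** Measurability with respect to the generated sigma-algebra is obtained by
    making that sigma-algebra the ambient one. *)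
Lemma sigma_process_lmin n (C : set R) : measurable C ->
  sigma_process X ((fun w => lmin (word (increment X h) n w)) @^-1` C).
Proof.
move=> mC.
pose TG := g_sigma_algebraType (\bigcup_(t in `[0, +oo[) sigma_fun (X t)).
have mX t : 0 <= t -> measurable_fun (setT : set TG) (X t : TG -> R).
  move=> t0 _ B mB; apply: sub_sigma_algebra; exists t; first by rewrite /= in_itv/= t0.
  by exists B.
have mi i : measurable_fun (setT : set TG) (increment X h i : TG -> R).
  by apply: measurable_funB; apply: mX; rewrite mulr_ge0.
have := @measurable_lmin_map R _ TG _ mi (iota 0 n) measurableT C mC.
by rewrite setTI.
Qed.

Lemma sigma_process_fun_lmin n (th : R) (C : set R) : measurable C ->
  sigma_process_fun X Q0
    ((fun w => eminus th (Q0 w + lmin (word (increment X h) n w))) @^-1` C).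
Proof.
move=> mC.
pose TG := g_sigma_algebraType
  ((\bigcup_(t in `[0, +oo[) sigma_fun (X t)) `|` sigma_fun Q0).
have mX t : 0 <= t -> measurable_fun (setT : set TG) (X t : TG -> R).
  move=> t0 _ B mB; apply: sub_sigma_algebra; left; exists t; first by rewrite /= in_itv/= t0.
  by exists B.
have mQ : measurable_fun (setT : set TG) (Q0 : TG -> R).
  by move=> _ B mB; apply: sub_sigma_algebra; right; exists B.
have mi i : measurable_fun (setT : set TG) (increment X h i : TG -> R).
  by apply: measurable_funB; apply: mX; rewrite mulr_ge0.
have ml := @measurable_lmin_map R _ TG _ mi (iota 0 n).
have := @measurable_eminus R _ TG th _ (measurable_funD mQ ml) measurableT C mC.
by rewrite setTI.
Qed.

End sigma_algebras.

Section killed_workload.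
Context {R : realType} {d : measure_display} {T : measurableType d} {P : probability T R}.
Variables (X : R -> {RV P >-> R}) (Q0 : {RV P >-> R}) (th q : R) (e : {RV P >-> \bar R}).
Hypothesis hX : levy_process X.
Hypothesis hQ0_indep : independent_sets P (sigma_fun Q0) (sigma_process X).
Hypothesis hQ0_law : same_law P (fun w => (Q0 w)%:E)
                          (fun w => overall_sup (fun t => X t w)).
Hypothesis th0 : 0 <= th.
Hypothesis q0 : 0 < q.
Hypothesis he : exponential_time P q e.
Hypothesis he_indep : independent_sets P (sigma_fun e) (sigma_process_fun X Q0).

Local Notation inc k := (increment X (mesh k)).
Local Notation r k := (expR (- q * mesh k)).
Local Notation S w := (overall_sup (fun t => X t w)).
Local Notation eta k n w := (lmin (word (inc k) n w)).

(** The exponential time as a nonnegative real at every point. *)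
Definition time_part w : R := Num.max 0 (fine (e w)).

Let mesh_ge0 k : 0 <= mesh k :> R. Proof. exact/ltW/mesh_gt0. Qed.

Let mlmin k n : measurable_fun setT (fun w => eta k n w).
Proof. by apply: measurable_lmin_map => i; exact: measurable_increment. Qed.

Let mlmax k n : measurable_fun setT (fun w => lmax (word (inc k) n w)).
Proof. by apply: measurable_lmax_map => i; exact: measurable_increment. Qed.

Let mQeta k n : measurable_fun setT (fun w => eminus th (Q0 w + eta k n w)).
Proof. by apply: measurable_eminus; exact: measurable_funD. Qed.

Let F k n := \int[P]_w eminus th (Q0 w + eta k n w).
Let psi k n z := \int[P]_v eminus th (z + eta k n v).

Let mpsi k n : measurable_fun setT (psi k n).
Proof. by apply: measurable_Rintegral_eminus. Qed.

Let psi_bounds k n z : 0 <= psi k n z <= 1.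
Proof.
apply: Rintegral_unit_bounds => [|v]; last exact: eminus_bounds.
by apply: measurable_eminus; apply: measurable_funD.
Qed.

Let F_bounds k n : 0 <= F k n <= 1.
Proof. by apply: Rintegral_unit_bounds => // w; exact: eminus_bounds. Qed.

Let FE k n : F k n = \int[P]_w psi k n (fine (S w)).
Proof.
rewrite -(Rintegral_Q0 hX hQ0_law (mpsi k n)); last first.
  by move=> z; case/andP: (psi_bounds k n z).
apply: indep_eminus => // B C mB mC; apply: hQ0_indep.
  by exists B => //; rewrite setTI.
exact: sigma_process_lmin.
Qed.

(* The overall supremum has the law of [Q0] but is not independent of the
   process; its place next to an independent minimum is taken by an iterated
   integral, where replacing the grid maximum by the supremum costs at most
   [dist]. *)
Let dist k w := Num.min 1 (th * `|grid_max X k w - fine (S w)|).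

Let dist_bounds k w : 0 <= dist k w <= 1.
Proof. by rewrite le_min ge_min lexx ler01 mulr_ge0. Qed.

Let mS : measurable_fun setT (fun w => fine (S w)).
Proof. exact: measurableT_comp (fine_measurable measurableT) (measurable_overall_sup hX). Qed.

Let mdist k : measurable_fun setT (dist k).
Proof.
apply: measurable_minr; first exact: measurable_cst.
apply: measurable_funM; first exact: measurable_cst.
apply: (measurableT_comp (@normr_measurable R setT)).
by apply: measurable_funB => //; exact: mlmax.
Qed.

Let cvg_dist : \int[P]_w dist k w @[k --> \oo] --> (0 : R).
Proof.
rewrite -[X in _ --> X](Rintegral_cst_prob P 0).
apply: (bounded_ae_cvg_Rintegral (C := 1)) => //.
- by move=> k w; have /andP[h1 h2] := dist_bounds k w; rewrite ger0_norm.
- apply: filterS (grid_max_ae_cvg hX hQ0_law) => w h.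
  have : Num.min 1 (th * `|grid_max X k w - fine (S w)|) @[k --> \oo] -->
      Num.min 1 (th * `|fine (S w) - fine (S w)|).
    apply: cvg_minr; first exact: cvg_cst.
    apply: cvgM; first exact: cvg_cst.
    by apply: cvg_norm; apply: cvgB => //; exact: cvg_cst.
  by rewrite subrr normr0 mulr0 (min_idPr ler01).
Qed.

Let maxmin_dist k n :
  `|walk_maxmin P (inc k) th (4 ^ k) n - F k n| <= \int[P]_w dist k w.
Proof.
have iM : P.-integrable setT (EFin \o (fun w => psi k n (grid_max X k w))).
  apply: (@bounded_integrable _ _ _ _ _ 1) => [|w].
    exact: measurableT_comp (mpsi k n) (mlmax k (4 ^ k)%N).
  by have /andP[h1 h2] := psi_bounds k n (grid_max X k w); rewrite ger0_norm.
have iS : P.-integrable setT (EFin \o (fun w => psi k n (fine (S w)))).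
  apply: (@bounded_integrable _ _ _ _ _ 1) => [|w].
    exact: measurableT_comp (mpsi k n) mS.
  by have /andP[h1 h2] := psi_bounds k n (fine (S w)); rewrite ger0_norm.
have iz z : P.-integrable setT (EFin \o (fun v => eminus th (z + eta k n v))).
  apply: (@bounded_integrable _ _ _ _ _ 1) => [|w]; last exact: eminus_norm.
  by apply: measurable_eminus; exact: measurable_funD.
rewrite FE -RintegralB//.
have iB : P.-integrable setT
    (EFin \o (fun w => psi k n (grid_max X k w) - psi k n (fine (S w)))).
  exact: integrableB iM iS.
apply: (le_trans (le_normr_Rintegral measurableT iB)); apply: le_Rintegral => //.
- exact: integrable_norm.
- apply: (@bounded_integrable _ _ _ _ _ 1) => // w.
  by have /andP[h1 h2] := dist_bounds k w; rewrite ger0_norm.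
move=> w _; rewrite /psi -RintegralB//.
have iz' a b : P.-integrable setT
    (EFin \o (fun v => eminus th (a + eta k n v) - eminus th (b + eta k n v))).
  exact: integrableB (iz a) (iz b).
apply: (le_trans (le_normr_Rintegral measurableT (iz' _ _))).
rewrite -[leRHS](Rintegral_cst_prob P); apply: le_Rintegral => //.
- by have := integrable_norm (iz' (grid_max X k w) (fine (S w))).
- exact: finite_measure_integrable_cst.
move=> v _; apply: (le_trans (eminus_lipschitz _ _ th0)).
by rewrite opprD addrACA subrr addr0.
Qed.

Let N k n : set T := [set w | Num.truncn (time_part w / mesh k) = n].

Let m_truncn (c : R) n : measurable [set z : R | Num.truncn (Num.max 0 z / c) = n].
Proof.
have m1 : measurable_fun setT (fun z : R => Num.max 0 z / c).
  apply: measurable_funM; last exact: measurable_cst.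
  by apply: measurable_maxr; [exact: measurable_cst | exact: measurable_id].
have m2 : measurable_fun setT (fun z : R => (Num.truncn z)%:R : R).
  by apply: nondecreasing_measurable => // x y xy; rewrite ler_nat le_truncn.
have := measurableT_comp m2 m1 measurableT (measurable_set1 n%:R).
rewrite setTI; congr measurable; apply/seteqP; split => z /=.
  by move/eqP; rewrite eqr_nat => /eqP.
by move=> ->.
Qed.

Let sigma_e (D : set R) : measurable D -> sigma_fun e [set w | D (fine (e w))].
Proof.
move=> mD; exists (fine @^-1` D); rewrite ?setTI//.
by rewrite -[X in measurable X]setTI; exact: fine_measurable.
Qed.

Let sigma_N k n : sigma_fun e (N k n).
Proof. exact: sigma_e (m_truncn (mesh k) n). Qed.

Let mN k n : measurable (N k n).
Proof.
have [A mA] := sigma_N k n; rewrite setTI => <-.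
by rewrite -[X in measurable X]setTI; exact: (measurable_funP e).
Qed.

Let P_lt x : 0 <= x -> P [set w | time_part w < x] = (1 - expR (- q * x))%:E.
Proof.
move=> x0; rewrite -(exponential_prob_lt q0 x0).
have : P (e @^-1` (fine @^-1` [set z | z < x])) =
    exponential_prob q (EFin @^-1` (fine @^-1` [set z | z < x])).
  move: he; rewrite /exponential_time gt_eqF// => /(_ _); apply.
  rewrite -[X in measurable X]setTI; apply: fine_measurable => //.
  by rewrite -set_itvNyo; exact: measurable_itv.
move: x0; rewrite le_eqVlt => /predU1P[<- _|x0].
  rewrite exponential_prob_lt// mulr0 expR0 subrr.
  rewrite (_ : [set w | _] = set0) ?measure0// -subset0 => w /=.
  by rewrite ltNge /time_part le_max lexx.
move=> <-; congr (P _); apply/seteqP; split => w /=; rewrite /time_part gt_max x0//.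
Qed.

Let P_N k n : fine (P (N k n)) = (1 - r k) * r k ^+ n.
Proof.
set h : R := mesh k; have m0 : 0 < h by exact: mesh_gt0.
have t0 w : 0 <= time_part w by rewrite le_max lexx.
have mlt (x : R) : measurable [set w | time_part w < x].
  have : measurable [set z : R | Num.max 0 z < x].
    have := measurable_maxr (measurable_cst (0 : R)) (@measurable_id _ R setT) measurableT.
    by move/(_ [set z | z < x]); rewrite setTI; apply; rewrite -set_itvNyo; exact: measurable_itv.
  move=> mD; have [A mA] := sigma_e mD.
  rewrite setTI => <-; rewrite -[X in measurable X]setTI; exact: (measurable_funP e).
have NE : N k n = [set w | time_part w < n.+1%:R * h] `\` [set w | time_part w < n%:R * h].
  apply/seteqP; split => w /=.
    move=> /eqP; rewrite truncn_eq ?divr_ge0 ?(ltW m0)//.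
    by rewrite ler_pdivlMr// ltr_pdivrMr// => /andP[h1 h2]; split => //; apply/negP; rewrite -leNgt.
  move=> [h1 /negP]; rewrite -leNgt => h2; apply/eqP.
  by rewrite truncn_eq ?divr_ge0 ?(ltW m0)// ler_pdivlMr// ltr_pdivrMr// h2.
rewrite NE measureD//=; last by rewrite ltey_eq fin_num_measure.
rewrite (_ : _ `&` _ = [set w | time_part w < n%:R * h]); last first.
  apply/setIidr => w /= hw; apply: lt_le_trans hw _.
  by rewrite ler_wpM2r ?(ltW m0)// ler_nat.
rewrite !P_lt ?mulr_ge0 ?(ltW m0)// -EFinB/= -expRM_natr.
rewrite (_ : - q * (n.+1%:R * h) = - q * h + - q * h * n%:R); last by rewrite -natr1; ring.
rewrite expRD (_ : - q * (n%:R * h) = - q * h * n%:R); last by ring.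
by ring.
Qed.

Let Z k w := eminus th (Q0 w + eta k (grid_index k (time_part w)) w).
Let Zn k n w := \1_(N k n) w * eminus th (Q0 w + eta k n.+1 w).

Let mZn k n : measurable_fun setT (Zn k n).
Proof. by apply: measurable_funM => //; apply: measurable_indic. Qed.

Let Rint_Zn k n : \int[P]_w Zn k n w = (1 - r k) * (F k n.+1 * r k ^+ n).
Proof.
rewrite (indep_event_Rintegral (C := 1))//.
- by rewrite P_N mulrAC mulrA.
- by move=> w; exact: eminus_norm.
- move=> B mB; apply: he_indep; first exact: sigma_N.
  exact: sigma_process_fun_lmin.
Qed.

Let cvg_Zn k w : \sum_(n < J) Zn k n w @[J --> \oo] --> Z k w.
Proof.
apply: cvg_near_cst; exists (Num.truncn (time_part w / mesh k)).+1 => // J /= hJ.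
rewrite (bigD1 (Ordinal hJ))//= /Zn indicE mem_set// mul1r big1 ?addr0// => i ij.
rewrite indicE memNset ?mul0r// /N /= => h.
by move: ij; rewrite -val_eqE/= -h eqxx.
Qed.

Let sum_Zn_bound k J w : `|\sum_(n < J) Zn k n w| <= 1.
Proof.
have Zn0 n : 0 <= Zn k n w.
  by rewrite mulr_ge0//; case/andP: (eminus_bounds th0 (Q0 w + eta k n.+1 w)).
have nd : nondecreasing_seq (fun J => \sum_(n < J) Zn k n w).
  by apply/nondecreasing_seqP => m; rewrite big_ord_recr lerDl.
rewrite ger0_norm ?sumr_ge0//; apply: (@le_trans _ _ (Z k w)).
  by rewrite -(cvg_lim _ (@cvg_Zn k w))//; apply: nondecreasing_cvgn_le => //; apply: cvgP; exact: cvg_Zn.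
by case/andP: (eminus_bounds th0 (Q0 w + eta k (grid_index k (time_part w)) w)).
Qed.

Let msum k J : measurable_fun setT (fun w => \sum_(n < J) Zn k n w).
Proof. by apply: measurable_sum => n; exact: mZn. Qed.

Let mZ k : measurable_fun setT (Z k).
Proof. by apply: (measurable_fun_cvg (msum k)) => w _; exact: cvg_Zn. Qed.

Let Rint_Z k : \int[P]_w Z k w = abel (r k) (fun n => F k n.+1).
Proof.
have h1 : \int[P]_w (\sum_(n < J) Zn k n w) @[J --> \oo] --> \int[P]_w Z k w.
  by apply: (@bounded_cvg_Rintegral _ _ _ P (fun J w => \sum_(n < J) Zn k n w) _ 1).
have h2 := cvg_abel (rate_bounds q0 k) (disc_cvg_unit (fun n => F_bounds k n.+1)).
have E : (fun J => \int[P]_w (\sum_(n < J) Zn k n w)) =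
    (fun J => (1 - r k) * pseries (fun n => F k n.+1) (r k) J).
  apply/funext => J; rewrite (Rintegral_sum (index_enum 'I_J) (f := fun n w => Zn k n w)).
    rewrite /pseries /series /= big_mkord mulr_sumr.
    by apply: eq_bigr => n _; rewrite Rint_Zn.
  move=> n; apply: (@bounded_integrable _ _ _ _ _ 1) => // w.
  rewrite /Zn normrM; apply: le_trans (eminus_norm th0 (Q0 w + eta k n.+1 w)).
  by rewrite indicE; case: (_ \in _); rewrite ?normr1 ?normr0 ?mul1r ?mul0r.
by rewrite E in h1; exact: cvg_unique h1 h2.
Qed.

Definition killed_workload :=
  \int[P]_w expR (- th * running_inf (workload (Q0 w) (fun t => X t w)) (time_part w)%:E).

Let cvg_Z w : Z k w @[k --> \oo] -->
  expR (- th * running_inf (workload (Q0 w) (fun t => X t w)) (time_part w)%:E).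
Proof.
have t0 : 0 <= time_part w by rewrite le_max lexx.
have cX := levy_cadlag hX w.
rewrite running_inf_workload// maxC -/(eminus th _).
apply: cvg_eminus; apply: cvgD; first exact: cvg_cst.
apply: cvg_grid_min => //.
- by move=> k j jk; exact: lmin_increment_le.
- by move=> k; exact: lmin_increment_attained.
Qed.

Lemma measurable_killed_workload : measurable_fun setT (fun w =>
  expR (- th * running_inf (workload (Q0 w) (fun t => X t w)) (time_part w)%:E)).
Proof. by apply: (measurable_fun_cvg mZ) => w _; exact: cvg_Z. Qed.

(** Conditioning on the grid cell of the exponential time turns the expectation
    into a geometric mean. The infimum is taken up to the right end of the cell,
    hence a shift of the index by one, which is harmless as the parameter of the
    mean tends to 1. *)
Lemma killed_workload_cvg : killed_maxmin X th q k @[k --> \oo] --> killed_workload.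
Proof.
have h1 : \int[P]_w Z k w @[k --> \oo] --> killed_workload.
  apply: (@bounded_cvg_Rintegral _ _ _ P Z _ 1) => // k w; exact: eminus_norm.
have h2 : abel (r k) (F k) @[k --> \oo] --> killed_workload.
  have E : (fun k => abel (r k) (F k)) =
      (fun k => (1 - r k) * F k 0%N + r k * \int[P]_w Z k w).
    apply/funext => k; rewrite Rint_Z; apply: abel_recl; first exact: rate_bounds.
    - exact: disc_cvg_unit (F_bounds k).
    - exact: disc_cvg_unit (fun n => F_bounds k n.+1).
  rewrite E -[killed_workload]add0r -[X in _ --> 0 + X]mul1r; apply: cvgD; last first.
    by apply: cvgM => //; exact: cvg_rate.
  apply: (@squeeze_cvgr _ _ _ _ (fun=> 0) (fun k => 1 - r k)); last 2 first.
  - exact: cvg_cst.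
  - by rewrite -(subrr (1 : R)); apply: cvgB; [exact: cvg_cst | exact: cvg_rate].
  apply: nearW => k; have /andP[r0 r1] := rate_bounds q0 k.
  have /andP[f0 f1] := F_bounds k 0%N.
  by rewrite mulr_ge0 ?subr_ge0 ?(ltW r1)//= ler_piMr// subr_ge0 ltW.
have h3 : (killed_maxmin X th q k - abel (r k) (F k)) @[k --> \oo] --> (0 : R).
  apply: norm_cvg0; apply: (@squeeze_cvgr _ _ _ _ (fun=> 0) (fun k => \int[P]_w dist k w)) => //.
    apply: nearW => k; rewrite normr_ge0/=; apply: abel_dist; first exact: rate_bounds.
    - apply: disc_cvg_unit => n; apply: walk_maxmin_bounds => // i; exact: measurable_increment.
    - exact: disc_cvg_unit (F_bounds k).
    - exact: maxmin_dist.
  exact: cvg_cst.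
have h4 : (killed_maxmin X th q k - abel (r k) (F k)) + abel (r k) (F k) @[k --> \oo] -->
    0 + killed_workload by exact: cvgD.
rewrite add0r in h4; apply: cvg_trans h4; apply: near_eq_cvg.
by apply: nearW => k; rewrite subrK.
Qed.

End killed_workload.

(** * Riemann sums of right-continuous functions on the half-line *)

Section dominated.
Context {R : realType} {d : measure_display} {T : measurableType d}.
Variable mu : {measure set T -> \bar R}.

Section theorem.
Variables (D : set T) (f_ : nat -> T -> R) (f B : T -> R).
Hypothesis mD : measurable D.
Hypothesis mf_ : forall n, measurable_fun D (f_ n).
Hypothesis iB : mu.-integrable D (EFin \o B).
Hypothesis fB : forall n x, D x -> `|f_ n x| <= B x.
Hypothesis cf : forall x, D x -> f_ n x @[n --> \oo] --> f x.

Let dominated : mu.-integrable D (EFin \o f) /\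
  \int[mu]_(x in D) f_ n x @[n --> \oo] --> \int[mu]_(x in D) f x.
Proof.
have mf : measurable_fun D f by exact: measurable_fun_cvg mf_ cf.
have [i _ h] := @dominated_convergence _ _ _ mu D mD
   (fun n => EFin \o f_ n) (EFin \o f) (EFin \o B)
   (fun n => (measurable_EFinP _ _).2 (mf_ n)) ((measurable_EFinP _ _).2 mf)
   ltac:(by apply: aeW => w Dw; apply: cvg_EFin; [exact: nearW | exact: cf])
   iB ltac:(by apply: aeW => w n Dw /=; rewrite lee_fin; exact: fB).
split => //; apply: fine_cvg; rewrite /= fineK; last exact: integrable_fin_num.
exact: h.
Qed.

Lemma dominated_integrable_lim : mu.-integrable D (EFin \o f).
Proof. by case: dominated. Qed.

Lemma dominated_cvg_Rintegral :
  \int[mu]_(x in D) f_ n x @[n --> \oo] --> \int[mu]_(x in D) f x.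
Proof. by case: dominated. Qed.

End theorem.

End dominated.

Section riemann_sums.
Context {R : realType}.
Local Notation mu := (@lebesgue_measure R).
Local Notation half := (`[0, +oo[%classic : set R).
Implicit Types f B : R -> R.

Definition step (k : nat) (t : R) : R := (grid_index k t)%:R * mesh k.

Lemma step_bounds k t : 0 <= t -> t < step k t <= t + mesh k.
Proof. exact: grid_index_bounds. Qed.

Definition cell (k n : nat) : set R := `[n%:R * mesh k, n.+1%:R * mesh k[.

Lemma cellP k n (t : R) : 0 <= t -> cell k n t <-> grid_index k t = n.+1.
Proof.
move=> t0; have m0 : 0 < mesh k :> R by exact: mesh_gt0.
have -> : (grid_index k t = n.+1) <-> Num.truncn (t / mesh k) == n.
  by rewrite /grid_index; split => [[->]//|/eqP ->].
by rewrite truncn_eq ?divr_ge0 ?(ltW m0)// ler_pdivlMr// ltr_pdivrMr// /cell/= in_itv/=.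
Qed.

(** The step function with the values of [f] at the right ends of the cells;
    its integral is a Riemann sum. *)
Definition stepsum f k J (t : R) : R :=
  \sum_(n < J) f (n.+1%:R * mesh k) * \1_(cell k n) t.

Lemma stepsumE f k J t : 0 <= t ->
  stepsum f k J t = if (grid_index k t <= J)%N then f (step k t) else 0.
Proof.
move=> t0; rewrite /stepsum.
case: ifPn => [|hJ].
  rewrite {1}/grid_index => hJ.
  rewrite (bigD1 (Ordinal hJ))//= indicE mem_set ?mulr1; last exact/cellP.
  rewrite big1 ?addr0// => i ij; rewrite indicE memNset ?mulr0// => /(cellP _ _ t0).
  by rewrite /grid_index => -[h]; move: ij; rewrite -val_eqE/= h eqxx.
rewrite big1// => i _; rewrite indicE memNset ?mulr0// => /(cellP _ _ t0) h.
by move: hJ; rewrite h ltn_ord.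
Qed.

Lemma cvg_stepsum f k t : 0 <= t -> stepsum f k J t @[J --> \oo] --> f (step k t).
Proof.
move=> t0; apply: cvg_near_cst; exists (grid_index k t) => // J /= hJ.
by rewrite stepsumE// hJ.
Qed.

Lemma measurable_stepsum D f k J : measurable_fun D (stepsum f k J).
Proof.
apply: measurable_sum => n; apply: measurable_funM; first exact: measurable_cst.
by apply: measurable_indic; exact: measurable_itv.
Qed.

Lemma measurable_step f k : measurable_fun half (f \o step k).
Proof.
apply: (measurable_fun_cvg (fun J => @measurable_stepsum half f k J)) => t /=.
by rewrite in_itv/= andbT; exact: cvg_stepsum.
Qed.

Lemma Rintegral_stepsum f k J :
  \int[mu]_(t in half) stepsum f k J t = \sum_(n < J) mesh k * f (n.+1%:R * mesh k).
Proof.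
have m0 : 0 < mesh k :> R by exact: mesh_gt0.
have mu_cell n : mu (cell k n) = (mesh k)%:E.
  rewrite /cell lebesgue_measure_itv/= lte_fin ltr_pM2r// ltr_nat ltnSn.
  by rewrite -EFinD -mulrBl -natr1 addrAC subrr add0r mul1r.
have ic n : mu.-integrable half (EFin \o (\1_(cell k n) : R -> R)).
  exact: integrableS (integrable_indic_itv _ _ _ _).
have icf n : mu.-integrable half (EFin \o (fun t => f (n.+1%:R * mesh k) * \1_(cell k n) t)).
  have : mu.-integrable half (fun t => (f (n.+1%:R * mesh k))%:E * (EFin \o (\1_(cell k n) : R -> R)) t)%E.
    by apply: integrableZl => //; exact: ic.
  by apply: eq_integrable => // t _ /=; rewrite EFinM.
have cell_half n : cell k n `&` half = cell k n.
  apply/setIidl => t; rewrite /cell/= !in_itv/= andbT => /andP[h _].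
  by apply: le_trans h; rewrite mulr_ge0// ltW.
have Rc n : \int[mu]_(t in half) (f (n.+1%:R * mesh k) * \1_(cell k n) t) =
    mesh k * f (n.+1%:R * mesh k).
  rewrite RintegralZl// mulrC; congr (_ * _).
  rewrite /Rintegral integral_indic.
  - by rewrite cell_half; exact: (congr1 fine (mu_cell n)).
  - by [].
  - by rewrite /cell; exact: measurable_itv.
elim: J => [|J IH].
  rewrite big_ord0 /stepsum; under eq_Rintegral do rewrite big_ord0.
  by rewrite Rintegral_cst// mul0r.
rewrite big_ord_recr/= -IH -Rc -RintegralD//.
  by apply: eq_Rintegral => t _; rewrite /stepsum big_ord_recr.
have : mu.-integrable half (fun t => \sum_(i <- index_enum 'I_J)
    (f (i.+1%:R * mesh k) * \1_(cell k i) t)%R%:E)%E.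
  by apply: integrable_sum => // i _; exact: icf.
by apply: eq_integrable => // t _ /=; rewrite /stepsum sumEFin.
Qed.

(** A nonincreasing integrable bound of [f] also bounds the step functions, as
    they look at [f] to the right of the current point. *)
Section theorem.
Variables (f B : R -> R).
Hypothesis f_right : forall t, 0 <= t -> f (step k t) @[k --> \oo] --> f t.
Hypothesis fB : forall t, 0 <= t -> `|f t| <= B t.
Hypothesis B_anti : forall s t, 0 <= s <= t -> B t <= B s.
Hypothesis iB : mu.-integrable half (EFin \o B).

Let step_le k t : 0 <= t -> `|f (step k t)| <= B t.
Proof.
move=> t0; have /andP[h _] := step_bounds k t0.
by apply: (le_trans (fB (le_trans t0 (ltW h)))); apply: B_anti; rewrite t0 ltW.
Qed.

Lemma riemann_sum_cvg k : \sum_(n < J) mesh k * f (n.+1%:R * mesh k) @[J --> \oo] -->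
  \int[mu]_(t in half) f (step k t).
Proof.
rewrite (_ : (fun J => _) = (fun J => \int[mu]_(t in half) stepsum f k J t)); last first.
  by apply/funext => J; rewrite Rintegral_stepsum.
apply: (@dominated_cvg_Rintegral R _ _ mu half (stepsum f k) (f \o step k) B) => //.
- by move=> J; exact: measurable_stepsum.
- move=> J t /=; rewrite in_itv/= andbT => t0; rewrite stepsumE//.
  case: ifP => _; first exact: step_le.
  by rewrite normr0; apply: le_trans (fB t0).
- by move=> t /=; rewrite in_itv/= andbT; exact: cvg_stepsum.
Qed.

Lemma riemann_integrable : mu.-integrable half (EFin \o f).
Proof.
apply: (@dominated_integrable_lim R _ _ mu half (fun k => f \o step k) f B) => //.
- by move=> k; exact: measurable_step.
- by move=> k t /=; rewrite in_itv/= andbT; exact: step_le.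
- by move=> t /=; rewrite in_itv/= andbT; exact: f_right.
Qed.

Lemma riemann_cvg : \int[mu]_(t in half) f (step k t) @[k --> \oo] -->
  \int[mu]_(t in half) f t.
Proof.
apply: (@dominated_cvg_Rintegral R _ _ mu half (fun k => f \o step k) f B) => //.
- by move=> k; exact: measurable_step.
- by move=> k t /=; rewrite in_itv/= andbT; exact: step_le.
- by move=> t /=; rewrite in_itv/= andbT; exact: f_right.
Qed.

End theorem.

End riemann_sums.

Lemma monotone_integrable_lim (R : realType) (d : measure_display) (T : measurableType d)
    (mu : {measure set T -> \bar R}) (D : set T) (f_ : nat -> T -> R) (f : T -> R) (c : R) :
  measurable D -> (forall n, mu.-integrable D (EFin \o f_ n)) ->
  (forall n x, D x -> 0 <= f_ n x) ->
  (forall x, D x -> nondecreasing_seq (f_ ^~ x)) ->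
  (forall x, D x -> f_ n x @[n --> \oo] --> f x) ->
  (forall n, \int[mu]_(x in D) f_ n x <= c) ->
  mu.-integrable D (EFin \o f).
Proof.
move=> mD if_ f0 nd cf fc.
have mf_ n : measurable_fun D (f_ n) by apply/measurable_EFinP; exact: (measurable_int mu (if_ n)).
have mf : measurable_fun D f by exact: measurable_fun_cvg mf_ cf.
have fx0 x : D x -> 0 <= f x.
  move=> Dx; rewrite -(cvg_lim _ (cf x Dx))//; apply: limr_ge; first exact: cvgP (cf x Dx).
  by apply: nearW => n; exact: f0.
apply/integrableP; split; first exact/measurable_EFinP.
apply: (@le_lt_trans _ _ c%:E); last exact: ltry.
have E : (\int[mu]_(x in D) `|(EFin \o f) x| = \int[mu]_(x in D) (limn (fun n => (f_ n x)%:E)))%E.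
  apply: eq_integral => x /[!inE] Dx /=; rewrite ger0_norm ?fx0//.
  by apply/esym/cvg_lim => //; apply: cvg_EFin; [exact: nearW | exact: cf].
rewrite E (@monotone_convergence _ _ _ mu D mD (fun n x => (f_ n x)%:E)).
- apply: lime_le.
    apply: ereal_nondecreasing_is_cvgn => m n mn; apply: ge0_le_integral => //.
    + by move=> x Dx; rewrite lee_fin f0.
    + by apply/measurable_EFinP.
    + by apply/measurable_EFinP.
    + by move=> x Dx; rewrite lee_fin; exact: nd.
  apply: nearW => n; have := fc n; rewrite -lee_fin /Rintegral fineK//.
  by have h := integrable_fin_num mD (if_ n).
- by move=> n; apply/measurable_EFinP.
- by move=> n x Dx; rewrite lee_fin f0.
- by move=> x Dx m n mn; rewrite lee_fin; exact: nd.
Qed.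

(** * The law of the process at fixed times *)

Lemma measurable_expRN (R : realType) (D : set R) (c : R) :
  measurable_fun D (fun t : R => expR (- c * t)).
Proof.
by apply: measurable_funTS; apply: (@measurableT_comp _ _ _ _ _ _ (@expR R)).
Qed.


Section gap.
Context {R : realType} {d : measure_display} {T : measurableType d} {P : probability T R}.
Variables (X : R -> {RV P >-> R}) (th : R).
Hypothesis hX : levy_process X.
Hypothesis th0 : 0 <= th.
Local Notation mu := (@lebesgue_measure R).
Local Notation half := (`[0, +oo[%classic : set R).

(** [gap t] is [E (1 - exp(-th X_t^+))], the mass that the kernel of [kappa_bar]
    sees at time [t]. *)
Definition gap (t : R) : R := 1 - \int[P]_w eminus th (X t w).

Let mem t : measurable_fun setT (fun w => eminus th (X t w)).
Proof. exact: measurable_eminus. Qed.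

Lemma gap_bounds t : 0 <= gap t <= 1.
Proof.
have /andP[h1 h2] : 0 <= \int[P]_w eminus th (X t w) <= 1.
  by apply: Rintegral_unit_bounds => // w; exact: eminus_bounds.
by rewrite /gap; apply/andP; split; lra.
Qed.

Lemma gap0 : gap 0 = 0.
Proof.
rewrite /gap; under eq_Rintegral do rewrite (levy_start hX) /eminus maxxx mulr0 expR0.
by rewrite Rintegral_cst_prob subrr.
Qed.

Lemma cvg_process_step w t : 0 <= t -> X (step k t) w @[k --> \oo] --> X t w.
Proof.
move=> t0; apply/cvgrPdist_lt => e e0.
apply: filterS (cvg_grid_right (levy_cadlag hX w) t0 e0) => k; apply.
exact: step_bounds.
Qed.

Lemma cvg_gap_step t : 0 <= t -> gap (step k t) @[k --> \oo] --> gap t.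
Proof.
move=> t0; apply: cvgB; first exact: cvg_cst.
apply: (@bounded_cvg_Rintegral _ _ _ P (fun k w => eminus th (X (step k t) w)) _ 1) => //.
- by move=> k w; exact: eminus_norm.
- by move=> w; apply: cvg_eminus; exact: cvg_process_step.
Qed.

Lemma cvg_step (t : R) : 0 <= t -> step k t @[k --> \oo] --> t.
Proof.
move=> t0; apply: (@squeeze_cvgr _ _ _ _ (fun=> t) (fun k => t + mesh k)).
- by apply: nearW => k; have /andP[h1 h2] := step_bounds k t0; rewrite (ltW h1).
- exact: cvg_cst.
- by rewrite -[X in _ --> X]addr0; apply: cvgD; [exact: cvg_cst | exact: cvg_mesh].
Qed.

Section rates.
Variables (p q : R).
Hypothesis p0 : 0 < p.
Hypothesis pq : p < q.

(** Since [gap t / t] is not yet known to be integrable near 0 and at infinity,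
    Riemann sums are passed to the limit for the difference of two rates, which
    is dominated by an exponential. *)
Definition rate_gap t : R := (expR (- p * t) - expR (- q * t)) / t * gap t.

Lemma exp_diff_bounds (t : R) : 0 <= t ->
  0 <= (expR (- p * t) - expR (- q * t)) / t <= (q - p) * expR (- p * t).
Proof.
rewrite le_eqVlt => /predU1P[<-|t0].
  by rewrite invr0 mulr0 lexx mulr_ge0 ?expR_ge0// subr_ge0 ltW.
apply/andP; split.
  by rewrite divr_ge0 ?(ltW t0)// subr_ge0 ler_expR !mulNr lerN2 ler_wpM2r ?(ltW t0) ?(ltW pq).
rewrite ler_pdivrMr//.
have -> : expR (- q * t) = expR (- p * t) * expR (- (q - p) * t).
  by rewrite -expRD; congr expR; ring.
have := expR_ge1Dx (- (q - p) * t); have := expR_gt0 (- p * t).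
move: (expR (- p * t)) (expR (- (q - p) * t)) => a b a0 b1.
rewrite -{1}[a]mulr1 -mulrBr mulrAC [leRHS]mulrC ler_wpM2l ?(ltW a0)//.
by move: b1; rewrite mulNr; lra.
Qed.

Let B t := (q - p) * expR (- p * t).

Lemma rate_gap_bounds t : 0 <= t -> 0 <= rate_gap t <= B t.
Proof.
move=> t0; have /andP[h1 h2] := exp_diff_bounds t0; have /andP[g0 g1] := gap_bounds t.
by rewrite mulr_ge0//= (le_trans _ h2)// ler_piMr.
Qed.

Let rate_gap_norm t : 0 <= t -> `|rate_gap t| <= B t.
Proof. by move=> t0; have /andP[h1 h2] := rate_gap_bounds t0; rewrite ger0_norm. Qed.

Let B_anti s t : 0 <= s <= t -> B t <= B s.
Proof.
move=> /andP[s0 st]; rewrite ler_wpM2l ?subr_ge0 ?(ltW pq)// ler_expR !mulNr lerN2.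
by rewrite ler_wpM2l// ltW.
Qed.

Lemma integrable_expRN : mu.-integrable half (EFin \o (fun t => expR (- p * t))).
Proof.
have i1 : mu.-integrable half (EFin \o exponential_pdf p).
  by apply: integrableS (integrable_exponential_pdf p0).
have : mu.-integrable half (fun t => p^-1%:E * (EFin \o exponential_pdf p) t)%E.
  by apply: integrableZl.
apply: eq_integrable => // t; rewrite inE/= in_itv/= andbT => t0.
by rewrite exponential_pdfE// -EFinM mulrA mulVf ?mul1r ?gt_eqF.
Qed.

Let iB : mu.-integrable half (EFin \o B).
Proof.
have : mu.-integrable half (fun t => (q - p)%:E * (EFin \o (fun t => expR (- p * t))) t)%E.
  by apply: integrableZl => //; exact: integrable_expRN.
by apply: eq_integrable => // t _ /=; rewrite EFinM.
Qed.

Lemma cvg_rate_gap_step t : 0 <= t -> rate_gap (step k t) @[k --> \oo] --> rate_gap t.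
Proof.
rewrite le_eqVlt => /predU1P[<-|t0].
  rewrite [X in _ --> X]/rate_gap gap0 mulr0.
  apply: (@squeeze_cvgr _ _ _ _ (fun=> 0) (fun k => (q - p) * gap (step k 0))).
  - apply: nearW => k; have /andP[/ltW s0 _] := step_bounds k (lexx (0 : R)).
    have /andP[-> _] := rate_gap_bounds s0.
    have /andP[g0 g1] := gap_bounds (step k 0).
    rewrite /rate_gap ler_wpM2r//; have /andP[_ h] := exp_diff_bounds s0.
    apply: (le_trans h); rewrite ler_piMr ?subr_ge0 ?(ltW pq)//.
    by rewrite -expR0 ler_expR mulNr oppr_le0 mulr_ge0// ltW.
  - exact: cvg_cst.
  - have h : gap (step k 0) @[k --> \oo] --> (0 : R).
      by rewrite -[X in _ --> X]gap0; apply: cvg_gap_step.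
    by rewrite -[X in _ --> X](mulr0 (q - p)); apply: cvgM => //; exact: cvg_cst.
have s : step k t @[k --> \oo] --> t by apply: cvg_step; exact: ltW.
apply: cvgM; last exact/cvg_gap_step/ltW.
apply: cvgM; last by apply: cvgV => //; rewrite gt_eqF.
by apply: cvgB; exact: cvg_expRM.
Qed.

Lemma rate_gap_integrable : mu.-integrable half (EFin \o rate_gap).
Proof. exact: (riemann_integrable cvg_rate_gap_step rate_gap_norm B_anti iB). Qed.

(** Minus the logarithm of [killed_transform], by Spitzer's identity: a Riemann
    sum for the integral of [exp(-r t) gap t / t]. *)
Definition log_series (r : R) k := limn (pseries (fun n => gap (n%:R * mesh k) / n%:R) (expR (- r * mesh k))).

Lemma log_series_diff k :
  log_series p k - log_series q k = \int[mu]_(t in half) rate_gap (step k t).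
Proof.
have m0 : 0 < mesh k :> R by exact: mesh_gt0.
have h1 : \sum_(n < J) mesh k * rate_gap (n.+1%:R * mesh k) @[J --> \oo] -->
    \int[mu]_(t in half) rate_gap (step k t).
  exact: (riemann_sum_cvg rate_gap_norm B_anti iB).
have dg : disc_cvg (fun n => gap (n%:R * mesh k) / n%:R).
  by apply: disc_cvg_unit_div => n; exact: gap_bounds.
have cs r : 0 < r -> pseries (fun n => gap (n%:R * mesh k) / n%:R) (expR (- r * mesh k)) n
    @[n --> \oo] --> log_series r k.
  by move=> r0; apply: disc_cvgP => //; exact: rate_bounds.
pose D n : R := pseries (fun n => gap (n%:R * mesh k) / n%:R) (expR (- p * mesh k)) n -
  pseries (fun n => gap (n%:R * mesh k) / n%:R) (expR (- q * mesh k)) n.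
have h2 : D n.+1 @[n --> \oo] --> log_series p k - log_series q k.
  have : D n @[n --> \oo] --> log_series p k - log_series q k.
    by apply: cvgB; apply: cs => //; exact: lt_trans pq.
  by rewrite -(cvg_shiftS D).
suff E : (fun J => \sum_(n < J) mesh k * rate_gap (n.+1%:R * mesh k)) = (fun J => D J.+1).
  by rewrite E in h1; exact: cvg_unique h2 h1.
apply/funext => J; rewrite /D /pseries /series /= -sumrB big_nat_recl//.
rewrite !invr0 !mulr0 !mul0r subrr add0r big_mkord; apply: eq_bigr => n _.
rewrite -mulrBr /rate_gap -!expRM_natl.
rewrite (_ : n.+1%:R * (- p * mesh k) = - p * (n.+1%:R * mesh k)); last by ring.
rewrite (_ : n.+1%:R * (- q * mesh k) = - q * (n.+1%:R * mesh k)); last by ring.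
have n0 : n.+1%:R != 0 :> R by rewrite pnatr_eq0.
move: (n.+1%:R : R) n0 (mesh k : R) (lt0r_neq0 m0) => a a0 b b0.
by field; rewrite a0 b0.
Qed.

Lemma log_series_diff_cvg : log_series p k - log_series q k @[k --> \oo] -->
  \int[mu]_(t in half) rate_gap t.
Proof.
rewrite (_ : (fun k => _) = (fun k => \int[mu]_(t in half) rate_gap (step k t))).
  exact: (riemann_cvg cvg_rate_gap_step rate_gap_norm B_anti iB).
by apply/funext => k; exact: log_series_diff.
Qed.

End rates.

End gap.

Lemma cvg_expR_vanish (R : realType) (u : R^nat) (c : R) : u @ \oo --> (0 : R) ->
  expR (- u j * c) @[j --> \oo] --> (1 : R).
Proof.
move=> /(@cvg_expRM R u (- c)); rewrite mulr0 expR0.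
rewrite (_ : (fun j => expR (- c * u j)) = (fun j => expR (- u j * c))) //.
by apply/funext => j; congr expR; rewrite mulNr mulrC mulNr.
Qed.

(** The bookkeeping of the limit as the rate [p j] goes to 0. The grid limit of
    [L j] is known up to the constant [w]; the two-sided bounds, which do not
    depend on the fine grid, force the limit in [j] to be [- ln a]. *)
Lemma double_limit_unique (R : realType) (p I G : R^nat) (L : nat -> R^nat) (J a w : R) :
  p @ \oo --> (0 : R) -> I @ \oo --> J -> 0 < a -> G @ \oo --> a -> (forall k, a <= G k) ->
  (forall j, L j @ \oo --> I j + (w - ln a)) ->
  (forall j k, L j k <= - ln a) ->
  (forall k0 j k, (k0 <= k)%N -> - ln (1 - expR (- p j * 2 ^+ k0) + G k0) <= L j k) ->
  J = - w.
Proof.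
move=> p0 IJ a0 Ga aG LI Lle Lge.
apply/eqP; rewrite eq_le; apply/andP; split.
  rewrite -(cvg_lim _ IJ)//; apply: limr_le; first exact: cvgP IJ.
  apply: nearW => j.
  suff : I j + (w - ln a) <= - ln a by lra.
  rewrite -(cvg_lim _ (LI j))//; apply: limr_le; first exact: cvgP (LI j).
  by apply: nearW => k; exact: Lle.
have ge k0 : - ln (G k0) <= J + (w - ln a).
  have g0 : 0 < G k0 by exact: lt_le_trans a0 (aG k0).
  have lo : - ln (1 - expR (- p j * 2 ^+ k0) + G k0) @[j --> \oo] --> - ln (G k0).
    apply: cvgN; apply: (continuous_cvg _ (continuous_ln g0)).
    rewrite -[X in _ --> X]add0r; apply: cvgD; last exact: cvg_cst.
    rewrite -(subrr (1 : R)); apply: cvgB; first exact: cvg_cst.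
    exact: cvg_expR_vanish.
  have hi : I j + (w - ln a) @[j --> \oo] --> J + (w - ln a).
    by apply: cvgD; [exact: IJ | exact: cvg_cst].
  rewrite -(cvg_lim _ lo)// -(cvg_lim _ hi)//.
  apply: ler_lim; [exact: cvgP lo | exact: cvgP hi |].
  apply: nearW => j.
  rewrite -(cvg_lim _ (LI j))//; apply: limr_ge; first exact: cvgP (LI j).
  by exists k0 => // k /= kk; exact: Lge.
suff : - ln a <= J + (w - ln a) by lra.
have h : - ln (G k0) @[k0 --> \oo] --> - ln a.
  by apply: cvgN; exact: (continuous_cvg _ (continuous_ln a0) Ga).
rewrite -[leLHS](cvg_lim _ h)//; apply: limr_le; first exact: cvgP h.
exact: nearW.
Qed.

Section exponent.
Context {R : realType} {d : measure_display} {T : measurableType d} {P : probability T R}.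
Variables (X : R -> {RV P >-> R}) (Q0 : {RV P >-> R}) (th : R).
Hypothesis hX : levy_process X.
Hypothesis hQ0_ge0 : forall w, 0 <= Q0 w.
Hypothesis hQ0_law : same_law P (fun w => (Q0 w)%:E)
                          (fun w => overall_sup (fun t => X t w)).
Hypothesis th0 : 0 <= th.
Local Notation mu := (@lebesgue_measure R).
Local Notation half := (`[0, +oo[%classic : set R).
Local Notation ainf := (max_transform Q0 th).
Local Notation g := (gap X th).
Local Notation L := (log_series X th).

Lemma killed_transform_log q k : 0 < q -> killed_transform X th q k = expR (- L q k).
Proof. by move=> q0; exact: killed_transformE. Qed.

Lemma log_series_le q k : 0 < q -> L q k <= - ln ainf.
Proof.
move=> q0; have a0 := max_transform_gt0 hQ0_ge0 th0.
have := killed_transform_ge hX hQ0_law th0 q0 k.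
rewrite killed_transform_log// -{1}[ainf]lnK ?posrE// ler_expR.
by rewrite lerNr.
Qed.

Lemma log_series_ge0 q k : 0 < q -> 0 <= L q k.
Proof.
move=> q0; rewrite -oppr_le0 -ler_expR expR0 -killed_transform_log//.
have b n : 0 <= walk_max P (increment X (mesh k)) th n <= 1.
  by apply: walk_max_bounds => // i; exact: measurable_increment.
rewrite /killed_transform -[leRHS](abel_cst (rate_bounds q0 k)).
apply: (le_abel (rate_bounds q0 k)) => [||n].
- exact: disc_cvg_unit.
- exact: disc_cvg_cst.
- by case/andP: (b n).
Qed.

Lemma log_series_ge k0 q k : 0 < q -> (k0 <= k)%N ->
  - ln (1 - expR (- q * 2 ^+ k0) + grid_transform X th k0) <= L q k.
Proof.
move=> q0 kk; have := killed_transform_le hX th0 q0 kk.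
rewrite killed_transform_log// => h; rewrite lerNl.
by rewrite -[leLHS](@expRK R) ler_ln ?posrE ?expR_gt0//; apply: lt_le_trans h; exact: expR_gt0.
Qed.

Lemma rate_gap_le p q : 0 < p -> p < q ->
  \int[mu]_(t in half) rate_gap X th p q t <= - ln ainf.
Proof.
move=> p0 pq; have h := log_series_diff_cvg hX th0 p0 pq.
rewrite -(cvg_lim _ h)//; apply: limr_le; first exact: cvgP h.
apply: nearW => k; have := log_series_le k p0; have := log_series_ge0 k (lt_trans p0 pq).
by lra.
Qed.

Definition gap_density t := g t / t.

Lemma gap_density_ge0 t : 0 <= t -> 0 <= gap_density t.
Proof. by move=> t0; have /andP[g0 _] := gap_bounds X th0 t; rewrite divr_ge0. Qed.

Lemma rate_gapE p q t : rate_gap X th p q t = (expR (- p * t) - expR (- q * t)) * gap_density t.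
Proof. by rewrite /rate_gap /gap_density mulrAC mulrA. Qed.

Lemma gap_density0 : gap_density 0 = 0.
Proof. by rewrite /gap_density invr0 mulr0. Qed.

(** Letting the two rates go to 0 and to infinity, monotone convergence turns
    the uniform bound [rate_gap_le] into integrability. *)
Lemma integrable_gap_density : mu.-integrable half (EFin \o gap_density).
Proof.
pose p (j : nat) : R := j.+1%:R^-1; pose q (j : nat) : R := j.+2%:R.
have p0 j : 0 < p j by rewrite invr_gt0.
have pq j : p j < q j.
  apply: (@le_lt_trans _ _ 1); first by rewrite invf_le1// ler1n.
  by rewrite ltr1n.
apply: (@monotone_integrable_lim _ _ _ mu half (fun j => rate_gap X th (p j) (q j)) _ (- ln ainf)) => //.
- by move=> j; exact: rate_gap_integrable.
- move=> j t /=; rewrite in_itv/= andbT => t0.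
  by case/andP: (rate_gap_bounds X th0 (pq j) t0).
- move=> t /=; rewrite in_itv/= andbT => t0 i j ij; rewrite !rate_gapE.
  apply: ler_wpM2r; first exact: gap_density_ge0.
  apply: lerB; rewrite ler_expR !mulNr lerN2 ler_wpM2r//.
    by rewrite /p lef_pV2 ?posrE// ler_nat.
  by rewrite ler_nat.
- move=> t /=; rewrite in_itv/= andbT le_eqVlt => /predU1P[<-|t0].
    rewrite gap_density0; under eq_fun do rewrite rate_gapE gap_density0 mulr0.
    exact: cvg_cst.
  under eq_fun do rewrite rate_gapE.
  suff : (expR (- p j * t) - expR (- q j * t)) * gap_density t @[j --> \oo] -->
      (1 - 0) * gap_density t by rewrite subr0 mul1r.
  apply: cvgM; last exact: cvg_cst.
  apply: cvgB.
    under eq_fun do rewrite mulNr mulrC -mulNr.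
    rewrite -expR0 -[X in expR X](mulr0 (- t)); apply: cvg_expRM.
    exact: cvg_harmonic.
  have h : (fun j => expR (- t) ^+ (j + 2)) @ \oo --> (0 : R).
    rewrite (cvg_shiftn 2 (fun j => expR (- t) ^+ j)).
    by apply: cvg_expr; rewrite ger0_norm ?expR_ge0// -expR0 ltr_expR oppr_lt0.
  apply: cvg_trans h; apply: near_eq_cvg; apply: nearW => j.
  by rewrite -expRM_natl addn2 /q mulrN mulNr.
- by move=> j; exact: rate_gap_le.
Qed.

Section rate.
Variables (q : R) (e : {RV P >-> \bar R}).
Hypothesis q0 : 0 < q.
Hypothesis hQ0_indep : independent_sets P (sigma_fun Q0) (sigma_process X).
Hypothesis he : exponential_time P q e.
Hypothesis he_indep : independent_sets P (sigma_fun e) (sigma_process_fun X Q0).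
Local Notation W := (killed_workload X Q0 th e).

Let cW := killed_workload_cvg hX hQ0_indep hQ0_law th0 q0 he he_indep.

Lemma killed_workload_ge : ainf <= W.
Proof.
rewrite -(cvg_lim _ cW)// -(cvg_lim _ (killed_maxmin_cvg hX hQ0_law th0 q0))//.
apply: ler_lim; [exact: cvgP (killed_maxmin_cvg hX hQ0_law th0 q0) | exact: cvgP cW |].
apply: nearW => k; rewrite ler_piMl//.
  have b n : 0 <= walk_maxmin P (increment X (mesh k)) th (4 ^ k) n <= 1.
    by apply: walk_maxmin_bounds => // i; exact: measurable_increment.
  rewrite /killed_maxmin -[leLHS](abel_cst (rate_bounds q0 k)).
  apply: (le_abel (rate_bounds q0 k)) => [||n].
  - exact: disc_cvg_cst.
  - exact: disc_cvg_unit.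
  - by case/andP: (b n).
by rewrite killed_transform_log// -expR0 ler_expR oppr_le0 log_series_ge0.
Qed.

Let a0 : 0 < ainf := max_transform_gt0 hQ0_ge0 th0.
Let W0 : 0 < W := lt_le_trans a0 killed_workload_ge.

(** The product of [exp(- L q k)] and of the transform of the workload tends to
    the transform of [Q0]. *)
Lemma log_series_cvg : L q k @[k --> \oo] --> ln W - ln ainf.
Proof.
have h : killed_transform X th q k @[k --> \oo] --> ainf / W.
  have h1 : (killed_transform X th q k * killed_maxmin X th q k) / killed_maxmin X th q k
      @[k --> \oo] --> ainf / W.
    apply: cvgM; first exact: (killed_maxmin_cvg hX hQ0_law th0 q0).
    by apply: cvgV => //; rewrite gt_eqF.
  apply: cvg_trans h1; apply: near_eq_cvg.
  have /cvgr_gt/(_ _ W0) := cW; apply: filterS => k m0.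
  by rewrite mulfK// gt_eqF.
have h2 : ln (killed_transform X th q k) @[k --> \oo] --> ln (ainf / W).
  by apply: (continuous_cvg _ (continuous_ln _) h); rewrite divr_gt0.
have -> : ln W - ln ainf = - ln (ainf / W) by rewrite ln_div ?posrE// opprB.
rewrite (_ : L q = fun k => - ln (killed_transform X th q k)); first exact: cvgN.
by apply/funext => k; rewrite killed_transform_log// expRK opprK.
Qed.

Lemma log_series_small_cvg p : 0 < p -> p < q ->
  L p k @[k --> \oo] --> \int[mu]_(t in half) rate_gap X th p q t + (ln W - ln ainf).
Proof.
move=> p0 pq; rewrite (_ : L p = fun k => (L p k - L q k) + L q k).
  exact: cvgD (log_series_diff_cvg hX th0 p0 pq) log_series_cvg.
by apply/funext => k; rewrite subrK.
Qed.

Let J := \int[mu]_(t in half) ((1 - expR (- q * t)) * gap_density t).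

Let p (j : nat) : R := q / j.+2%:R.
Let p0 j : 0 < p j. Proof. by rewrite divr_gt0. Qed.
Let pq j : p j < q. Proof. by rewrite ltr_pdivrMr// ltr_pMr// ltr1n. Qed.

Let p_cvg : p j @[j --> \oo] --> (0 : R).
Proof.
rewrite -[X in _ --> X](mulr0 q); apply: cvgM; first exact: cvg_cst.
have -> : (fun j => j.+2%:R^-1) = [sequence (@harmonic R) n.+1]_n by [].
by rewrite cvg_shiftS; exact: cvg_harmonic.
Qed.

Let expR_p_cvg c : expR (- p j * c) @[j --> \oo] --> (1 : R).
Proof. exact: cvg_expR_vanish p_cvg. Qed.

Let J_cvg : \int[mu]_(t in half) rate_gap X th (p j) q t @[j --> \oo] --> J.
Proof.
apply: (@dominated_cvg_Rintegral R _ _ mu half (fun j => rate_gap X th (p j) q)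
  (fun t => (1 - expR (- q * t)) * gap_density t) gap_density) => //.
- by move=> j; apply/measurable_EFinP; case/integrableP: (rate_gap_integrable hX th0 (p0 j) (pq j)).
- exact: integrable_gap_density.
- move=> j t /=; rewrite in_itv/= andbT => t0.
  have /andP[h _] := rate_gap_bounds X th0 (pq j) t0.
  rewrite ger0_norm// rate_gapE ler_piMl//; first exact: gap_density_ge0.
  have : expR (- p j * t) <= 1 by rewrite -expR0 ler_expR mulNr oppr_le0 mulr_ge0// ltW.
  by have := expR_gt0 (- q * t); lra.
- move=> t _; under eq_fun do rewrite rate_gapE.
  apply: cvgM; last exact: cvg_cst.
  apply: cvgB; last exact: cvg_cst.
  exact: expR_p_cvg.
Qed.

(** The limit of [L p k] in [k] is an integral over the difference of the rates
    [p] and [q] plus the constant [ln W - ln ainf]; as [p] goes to 0 that limit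
    must tend to [- ln ainf], since an exponential time of small rate sees the
    overall supremum. *)
Theorem killed_workload_exponent : W = expR (- J).
Proof.
suff -> : J = - ln W by rewrite opprK lnK.
apply: (double_limit_unique p_cvg J_cvg (L := fun j => L (p j)) (G := grid_transform X th)
  a0 (grid_transform_cvg hX hQ0_law th0)).
- by move=> k; exact: max_transform_le hX hQ0_law th0 k (4 ^ k)%N.
- by move=> j; exact: log_series_small_cvg.
- by move=> j k; exact: log_series_le.
- by move=> k0 j k; exact: log_series_ge.
Qed.

End rate.

End exponent.

(** * The probability of being positive *)

Section exponential_time.
Context {R : realType} {d : measure_display} {T : measurableType d} {P : probability T R}.
Variables (q : R) (e : {RV P >-> \bar R}).
Hypothesis q0 : 0 < q.
Hypothesis he : exponential_time P q e.

Let law A : measurable A -> P (e @^-1` A) = exponential_prob q (EFin @^-1` A).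
Proof. by move: he; rewrite /exponential_time gt_eqF//; apply. Qed.

Lemma exponential_time_lt (x : R) : 0 <= x ->
  P (e @^-1` [set z | (z < x%:E)%E]) = (1 - expR (- q * x))%:E.
Proof.
move=> x0; rewrite -exponential_prob_lt//.
have mA : measurable [set z : \bar R | (z < x%:E)%E].
  by rewrite -[X in measurable X]setTI; apply: emeasurable_fun_infty_o.
by rewrite law.
Qed.

Lemma exponential_time_pinfty : P (e @^-1` [set +oo%E]) = 0%E.
Proof.
rewrite law; last exact: emeasurable_set1.
have -> : (EFin @^-1` [set +oo%E] : set R) = set0 by apply/seteqP; split.
exact: measure0.
Qed.

Lemma exponential_time_ae : {ae P, forall w, e w = (time_part e w)%:E}.
Proof.
exists (e @^-1` [set z | (z < 0%:E)%E] `|` e @^-1` [set +oo%E]).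
have m1 : measurable (e @^-1` [set z | (z < 0%:E)%E]).
  rewrite -[X in measurable X]setTI; apply: (measurable_funP e) => //.
  by rewrite -[X in measurable X]setTI; apply: emeasurable_fun_infty_o.
have m2 : measurable (e @^-1` [set +oo%E]).
  by rewrite -[X in measurable X]setTI; apply: (measurable_funP e).
split; first exact: measurableU.
  rewrite measureU0//; last exact: exponential_time_pinfty.
  by apply: (etrans (exponential_time_lt (lexx 0))); rewrite mulr0 expR0 subrr.
move=> w /= h; apply: contrapT => /not_orP[/negP]; rewrite -leNgt => e0 eoo.
apply: h; rewrite /time_part; move: e0 eoo; case: (e w) => //= r; rewrite lee_fin => r0 _.
by rewrite max_r.
Qed.

Lemma exponential_time_ge (x : R) : 0 <= x ->
  P (e @^-1` [set z | (x%:E <= z < +oo)%E]) = (expR (- q * x))%:E.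
Proof.
move=> x0.
have ml : measurable (e @^-1` [set z | (z < x%:E)%E]).
  rewrite -[X in measurable X]setTI; apply: (measurable_funP e) => //.
  by rewrite -[X in measurable X]setTI; apply: emeasurable_fun_infty_o.
have mo : measurable (e @^-1` [set +oo%E]).
  by rewrite -[X in measurable X]setTI; apply: (measurable_funP e).
have E : e @^-1` [set z | (x%:E <= z < +oo)%E] = ~` (e @^-1` [set z | (z < x%:E)%E] `|` e @^-1` [set +oo%E]).
  apply/seteqP; split => w /=.
    by move=> /andP[h1 h2] [|h3]; [rewrite ltNge h1 | rewrite h3 in h2].
  move=> /not_orP[/negP]; rewrite -leNgt => -> /eqP h /=; by rewrite ltey.
rewrite E probability_setC; last exact: measurableU.
rewrite measureU0//; last exact: exponential_time_pinfty.
apply: (etrans (congr1 (fun y => 1 - y)%E (exponential_time_lt x0))).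
by rewrite -EFinB; congr EFin; rewrite opprB addrC subrK.
Qed.

End exponential_time.

Section positivity.
Context {R : realType} {d : measure_display} {T : measurableType d} {P : probability T R}.
Variables (X : R -> {RV P >-> R}) (Q0 : {RV P >-> R}).
Hypothesis hX : levy_process X.
Hypothesis hlim : {ae P, forall w, X t w @[t --> +oo] --> -oo}.
Hypothesis hQ0_ge0 : forall w, 0 <= Q0 w.
Hypothesis hQ0_indep : independent_sets P (sigma_fun Q0) (sigma_process X).
Hypothesis hQ0_law : same_law P (fun w => (Q0 w)%:E)
                          (fun w => overall_sup (fun t => X t w)).
Variables (q : R) (e : {RV P >-> \bar R}).
Hypothesis q0 : 0 < q.
Hypothesis he : exponential_time P q e.
Hypothesis he_indep : independent_sets P (sigma_fun e) (sigma_process_fun X Q0).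
Local Notation mu := (@lebesgue_measure R).
Local Notation half := (`[0, +oo[%classic : set R).

Let B (n : nat) : set T := [set w | Q0 w + X n%:R w < 0].

Let mB n : measurable (B n).
Proof.
rewrite -[X in measurable X]setTI.
have m : measurable_fun setT (fun w => Q0 w + X n%:R w) by exact: measurable_funD.
by have := m measurableT `]-oo, 0[%classic; apply => //.
Qed.

(** The path drifts to minus infinity, so these probabilities tend to 1. *)
Lemma workload_emptied_positive : exists n, 0 < fine (P (B n)).
Proof.
have h : \int[P]_w (\1_(B n) w : R) @[n --> \oo] --> \int[P]_w (1 : R).
  apply: (@bounded_ae_cvg_Rintegral _ _ _ P (fun n w => \1_(B n) w) (fun=> 1) 1) => //.
  - by move=> n; exact: measurable_indic.
  - by move=> n w; rewrite indicE; case: (_ \in _); rewrite ?normr1 ?normr0.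
  - apply: filterS hlim => w hw.
    have {hw} h : X n%:R w @[n --> \oo] --> -oo.
      exact: (cvg_comp _ _ (@cvgr_idn R) hw).
    have /cvgrNyPlt/(_ (- Q0 w)) h' := h.
    apply: cvg_near_cst; apply: filterS h' => n hn.
    by rewrite indicE mem_set// /B/= -ltrBrDl sub0r.
have h' : fine (P (B n)) @[n --> \oo] --> (1 : R).
  rewrite Rintegral_cst_prob in h; move: h.
  rewrite (_ : (fun n => _) = (fun n => fine (P (B n))))//.
  by apply/funext => n; rewrite /Rintegral integral_indic// setIT.
have /cvgr_gt/(_ 0 ltr01) [N _ hN] := h'.
by exists N; exact: hN (leqnn N).
Qed.

Let integrand th w := expR (- th * running_inf (workload (Q0 w) (fun t => X t w))
  (time_part e w)%:E).

(** With positive probability the workload has been empty before the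
    exponential time; then its infimum is 0 and the Laplace parameter does not
    matter. *)
Lemma killed_workload_bounded_below : exists2 rho : R, 0 < rho &
  forall th, 0 <= th -> rho <= killed_workload X Q0 th e.
Proof.
have [n Bn] := workload_emptied_positive.
pose E : set T := e @^-1` [set z | (n%:R%:E <= z < +oo)%E].
have PE := exponential_time_ge q0 he (ler0n R n).
exists (expR (- q * n%:R) * fine (P (B n))); first by rewrite mulr_gt0 ?expR_gt0.
move=> th th0.
have mEn : measurable [set z : \bar R | (n%:R%:E <= z < +oo)%E].
  have -> : [set z : \bar R | (n%:R%:E <= z < +oo)%E] =
      [set z | (n%:R%:E <= z)%E] `&` [set z | (z < +oo)%E].
    by apply/seteqP; split => z /= => [/andP[]//|[-> ->]].
  apply: measurableI; rewrite -[X in measurable X]setTI.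
    exact: emeasurable_fun_c_infty.
  exact: emeasurable_fun_infty_o.
have mE : measurable E.
  by rewrite -[X in measurable X]setTI; apply: (measurable_funP e).
have PEB : P (E `&` B n) = (P E * P (B n))%E.
  apply: he_indep; first by exists [set z | (n%:R%:E <= z < +oo)%E]; rewrite ?setTI.
  pose TG := g_sigma_algebraType
    ((\bigcup_(t in `[0, +oo[) sigma_fun (X t)) `|` sigma_fun Q0).
  have mX t : 0 <= t -> measurable_fun (setT : set TG) (X t : TG -> R).
    move=> t0 _ C mC; apply: sub_sigma_algebra; left; exists t; first by rewrite /= in_itv/= t0.
    by exists C.
  have mQ : measurable_fun (setT : set TG) (Q0 : TG -> R).
    by move=> _ C mC; apply: sub_sigma_algebra; right; exists C.
  have m := measurable_funD mQ (mX n%:R (ler0n R n)).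
  have := m measurableT `]-oo, 0[%classic (measurable_itv _); rewrite setTI.
  by congr sigma_process_fun; apply/seteqP; split => w; rewrite /= in_itv.
have -> : expR (- q * n%:R) * fine (P (B n)) = \int[P]_w \1_(E `&` B n) w.
  rewrite /Rintegral integral_indic//; last exact: measurableI.
  rewrite setIT; apply/esym/(etrans (congr1 fine PEB)).
  by rewrite fineM ?fin_num_measure//; congr (_ * _); rewrite /E PE.
have i01 w : 0 <= integrand th w <= 1.
  rewrite /integrand expR_ge0 -[leRHS]expR0 ler_expR mulNr oppr_le0 mulr_ge0//.
  have t0 : 0 <= time_part e w by rewrite le_max lexx.
  by rewrite running_inf_workload ?le_max ?lexx//; exact: levy_cadlag hX w.
apply: le_Rintegral => //.
- by apply: integrable_indic => //; exact: measurableI.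
- apply: (@bounded_integrable _ _ _ P _ 1); first exact: (measurable_killed_workload Q0 th e hX).
  by move=> w; case/andP: (i01 w) => h1 h2; rewrite ger0_norm.
- move=> w _; have [[Ew Bw]|nEB] := pselect ((E `&` B n) w); last first.
    by rewrite indicE memNset//; case/andP: (i01 w).
  rewrite indicE mem_set// /integrand.
  move: Ew; rewrite /E /= /time_part; case: (e w) => [r||]//=; rewrite ?ltxx ?andbF// => /andP[nr _].
  rewrite lee_fin in nr; have r0 : 0 <= r := le_trans (ler0n R n) nr.
  rewrite max_r// running_inf_workload//; last exact: levy_cadlag hX w.
  rewrite max_l ?mulr0 ?expR0//; apply: le_trans (ltW Bw); rewrite lerD2l.
  apply: (@running_inf_le _ _ (levy_cadlag hX w)); rewrite ler0n; exact: nr.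
Qed.

Definition pos_prob (t : R) : R := \int[P]_w \1_[set w | 0 < X t w] w.

Lemma measurable_positive t : measurable [set w | 0 < X t w].
Proof.
have -> : [set w | 0 < X t w] = X t @^-1` `]0, +oo[%classic.
  by apply/seteqP; split => w /=; rewrite in_itv/= andbT.
by rewrite -[X in measurable X]setTI; apply: (measurable_funP (X t)).
Qed.

Let mpos := measurable_positive.

Lemma cvg_gap_pos_prob t : gap X j%:R t @[j --> \oo] --> pos_prob t.
Proof.
have -> : pos_prob t = 1 - \int[P]_w (1 - \1_[set w | 0 < X t w] w).
  rewrite RintegralB//; last by apply: integrable_indic.
    by rewrite Rintegral_cst_prob subKr.
  by apply: (@bounded_integrable _ _ _ P _ 1) => // w; rewrite normr1.
apply: cvgB; first exact: cvg_cst.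
apply: (@bounded_cvg_Rintegral _ _ _ P (fun j w => eminus j%:R (X t w)) _ 1).
- by move=> j; exact: measurable_eminus.
- by move=> j w; exact: eminus_norm.
- move=> w; rewrite indicE; have [p|np] := ltP 0 (X t w).
    rewrite mem_set// subrr.
    have : expR (- X t w) ^+ j @[j --> \oo] --> (0 : R).
      by apply: cvg_expr; rewrite ger0_norm ?expR_ge0// -expR0 ltr_expR oppr_lt0.
    rewrite (_ : (fun j => _) = (fun j => eminus j%:R (X t w)))//.
    by apply/funext => j; rewrite -expRM_natl /eminus max_l ?ltW// mulrN mulNr.
  rewrite memNset/=; last by apply/negP; rewrite -leNgt.
  rewrite subr0 (_ : (fun j => _) = (fun=> 1)); first exact: cvg_cst.
  by apply/funext => j; rewrite /eminus max_r// mulr0 expR0.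
Qed.

Lemma pos_prob_bounds t : 0 <= pos_prob t <= 1.
Proof.
apply: Rintegral_unit_bounds; first exact: measurable_indic.
by move=> w; rewrite indicE; case: (_ \in _); rewrite lexx ler01.
Qed.

Lemma gap_nondecreasing t : nondecreasing_seq (fun j => gap X j%:R t).
Proof.
move=> i j ij; rewrite /gap lerD2l lerN2; apply: le_Rintegral => //.
- by apply: (@bounded_integrable _ _ _ P _ 1) => [|w]; [exact: measurable_eminus | exact: eminus_norm].
- by apply: (@bounded_integrable _ _ _ P _ 1) => [|w]; [exact: measurable_eminus | exact: eminus_norm].
- move=> w _; rewrite /eminus ler_expR !mulNr lerN2 ler_wpM2r ?ler_nat//.
  by rewrite le_max lexx orbT.
Qed.

Let expR_le1 t : 0 <= t -> 0 <= 1 - expR (- q * t) <= 1.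
Proof.
move=> t0; have : expR (- q * t) <= 1 by rewrite -expR0 ler_expR mulNr oppr_le0 mulr_ge0// ltW.
by have := expR_gt0 (- q * t); lra.
Qed.

(** [pos_prob] is the monotone limit of [gap] as the Laplace parameter goes to
    infinity, and [killed_workload_exponent] bounds the integrals because the
    transforms stay away from 0. This is where the negative drift makes the
    kernel of [kappa_bar] integrable at infinity. *)
Lemma integrable_pos_prob_killed :
  mu.-integrable half (EFin \o (fun t => (1 - expR (- q * t)) * (pos_prob t / t))).
Proof.
have [rho rho0 hrho] := killed_workload_bounded_below.
apply: (@monotone_integrable_lim _ _ _ mu half
  (fun j t => (1 - expR (- q * t)) * gap_density X j%:R t) _ (- ln rho)) => //.
- move=> j; have j0 := ler0n R j.
  have ig := integrable_gap_density hX hQ0_ge0 hQ0_law j0.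
  apply: (le_integrable _ _ _ ig) => //.
    apply/measurable_EFinP; apply: measurable_funM.
      by apply: measurable_funB => //; exact: measurable_expRN.
    by apply/measurable_EFinP; case/integrableP: ig.
  move=> t /=; rewrite in_itv/= andbT => t0; have /andP[h1 h2] := expR_le1 t0.
  have g0 := gap_density_ge0 X j0 t0.
  by rewrite lee_fin normrM (ger0_norm h1) (ger0_norm g0) ler_piMl.
- move=> j t /=; rewrite in_itv/= andbT => t0; have /andP[h1 h2] := expR_le1 t0.
  by rewrite mulr_ge0// gap_density_ge0.
- move=> t /=; rewrite in_itv/= andbT => t0 i j ij; have /andP[h1 h2] := expR_le1 t0.
  by apply: ler_wpM2l => //; apply: ler_wpM2r; [rewrite invr_ge0 | exact: gap_nondecreasing].
- move=> t _; apply: cvgM; first exact: cvg_cst.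
  by apply: cvgM; [exact: cvg_gap_pos_prob | exact: cvg_cst].
- move=> j; have j0 := ler0n R j.
  have W := killed_workload_exponent hX hQ0_ge0 hQ0_law j0 q0 hQ0_indep he he_indep.
  rewrite -lerN2 opprK; have := hrho _ j0; rewrite W => h.
  by rewrite -[leRHS](@expRK R) ler_ln ?posrE ?expR_gt0.
Qed.

Lemma integrable_pos_prob_rates (p r : R) : 0 < p -> 0 < r ->
  mu.-integrable half (EFin \o (fun t => (expR (- p * t) - expR (- r * t)) * (pos_prob t / t))).
Proof.
wlog : p r / p <= r => [hw p0 r0|].
  have [pr|/ltW pr] := leP p r; first exact: hw.
  have := integrableN (hw _ _ pr r0 p0); apply: eq_integrable => // t _ /=.
  by rewrite -mulNr opprB.
rewrite le_eqVlt => /predU1P[<-|pr] p0 r0.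
  rewrite (_ : EFin \o _ = cst 0%E); first exact: integrable0.
  by apply/funext => t /=; rewrite subrr mul0r.
have ib : mu.-integrable half (EFin \o (fun t => (r - p) * expR (- p * t))).
  have : mu.-integrable half (fun t => (r - p)%:E * (EFin \o (fun t => expR (- p * t))) t)%E.
    by apply: integrableZl => //; exact: integrable_expRN.
  by apply: eq_integrable => // t _ /=; rewrite EFinM.
apply: (le_integrable _ _ _ ib) => //.
  apply/measurable_EFinP.
  have mr j : measurable_fun half (rate_gap X j%:R p r).
    by apply/measurable_EFinP; case/integrableP: (rate_gap_integrable hX (ler0n R j) p0 pr).
  apply: (measurable_fun_cvg mr) => t _.
  under eq_fun do rewrite rate_gapE.
  apply: cvgM; first exact: cvg_cst.
  by apply: cvgM; [exact: cvg_gap_pos_prob | exact: cvg_cst].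
move=> t /=; rewrite in_itv/= andbT => t0.
have /andP[h1 h2] := exp_diff_bounds pr t0.
have /andP[g0 g1] := pos_prob_bounds t.
rewrite lee_fin mulrA mulrAC normrM ger0_norm// (ger0_norm g0).
rewrite (@ger0_norm _ ((r - p) * _)).
  by apply: le_trans h2; exact: ler_piMr.
exact: le_trans h2.
Qed.

(** The integrands of the exponents of [kappa_bar] at the arguments [(0, 0)] and
    [(q, 0)]. For the first one, the rate [q] is inserted between 1 and 0. *)
Lemma integrable_pos_prob_rate (a : R) : a = 0 \/ a = q ->
  mu.-integrable half (EFin \o (fun t => (expR (- 1 * t) - expR (- a * t)) * (pos_prob t / t))).
Proof.
case=> ->; last exact: integrable_pos_prob_rates.
have : mu.-integrable half (fun t =>
    (EFin \o (fun t => (expR (- 1 * t) - expR (- q * t)) * (pos_prob t / t))%R) t -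
    (EFin \o (fun t => (1 - expR (- q * t)) * (pos_prob t / t))%R) t)%E.
  apply: integrableB => //; first exact: integrable_pos_prob_rates.
  exact: integrable_pos_prob_killed.
apply: eq_integrable => // t _ /=.
by rewrite -EFinB -mulrBl; congr (_ * _)%:E; rewrite oppr0 mul0r expR0; lra.
Qed.

End positivity.

(** * The exponents at real arguments *)

Section real_arguments.
Local Open Scope complex_scope.
Context {R : realType}.

Lemma cexp_real (x : R) : cexp x%:C = (expR x)%:C.
Proof. by rewrite /cexp /= cos0 sin0 mulr1. Qed.

Lemma cintegral_real (d : measure_display) (T : measurableType d)
    (mu : {measure set T -> \bar R}) (D : set T) (f : T -> R) :
  cintegral mu D (fun x => (f x)%:C) = (\int[mu]_(x in D) f x)%:C.
Proof. by rewrite /cintegral /= /Rintegral integral0. Qed.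

End real_arguments.

Section kernel.
Context {R : realType} {d : measure_display} {T : measurableType d} {P : probability T R}.
Variable X : R -> {RV P >-> R}.
Local Notation mu := (@lebesgue_measure R).

Lemma Rintegral_distribution_pos (t b c k : R) : 0 <= b ->
  \int[distribution P (X t)]_(x in `]0, +oo[) (c + k * (1 - eminus b x)) =
  c * pos_prob X t + k * gap X b t.
Proof.
move=> b0.
have mem : measurable_fun setT (fun x : R => eminus b x).
  exact: (@measurable_eminus R _ R b id).
have memX : measurable_fun setT (fun w => eminus b (X t w)).
  exact: measurable_eminus.
have mpos : measurable [set w | 0 < X t w] by exact: measurable_positive.
have mF : measurable_fun setT (fun x => c + k * (1 - eminus b x)).
  apply: measurable_funD => //; apply: measurable_funM => //.
  exact: measurable_funB.
have i1 : P.-integrable setT (EFin \o (fun w => c * \1_[set w | 0 < X t w] w)).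
  apply: (@bounded_integrable _ _ _ P _ `|c|).
    by apply: measurable_funM.
  by move=> w; rewrite normrM indicE; case: (_ \in _); rewrite ?normr1 ?normr0 ?mulr1 ?mulr0.
have i0 : P.-integrable setT (EFin \o (fun w => 1 - eminus b (X t w))).
  apply: (@bounded_integrable _ _ _ P _ 1); first exact: measurable_funB.
  by move=> w; have /andP[h1 h2] := eminus_bounds b0 (X t w); rewrite ger0_norm; lra.
have i2 : P.-integrable setT (EFin \o (fun w => k * (1 - eminus b (X t w)))).
  apply: (@bounded_integrable _ _ _ P _ `|k|).
    by apply: measurable_funM => //; exact: measurable_funB.
  move=> w; have /andP[h1 h2] := eminus_bounds b0 (X t w).
  by rewrite normrM ler_piMr// ger0_norm; lra.
have iF : P.-integrable (X t @^-1` `]0, +oo[%classic)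
    ((fun x => (c + k * (1 - eminus b x))%:E) \o X t).
  apply: (@integrableS _ _ _ P setT) => //.
    by rewrite -[X in measurable X]setTI; apply: (measurable_funP (X t)).
  apply: (@bounded_integrable _ _ _ P (fun w => c + k * (1 - eminus b (X t w))) (`|c| + `|k|)).
    by apply: measurableT_comp mF _.
  move=> w; have /andP[h1 h2] := eminus_bounds b0 (X t w).
  apply: (le_trans (ler_normD _ _)); rewrite lerD2l.
  by rewrite normrM ler_piMr// ger0_norm; lra.
transitivity (\int[P]_w (c * \1_[set w | 0 < X t w] w + k * (1 - eminus b (X t w)))).
  rewrite /Rintegral; congr fine.
  rewrite [LHS](@integral_pushforward _ _ _ _ _ (X t) _ P _
    (fun x => (c + k * (1 - eminus b x))%:E)) //; last exact/measurable_EFinP.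
  rewrite integral_mkcond; apply: eq_integral => w _; rewrite patchE indicE.
  case: ifPn => [|].
    rewrite inE/= in_itv/= andbT => h; rewrite mem_set//= mulr1//.
  rewrite notin_setE/= in_itv/= andbT => /negP; rewrite -leNgt => h.
  rewrite memNset/=; last by apply/negP; rewrite -leNgt.
  by rewrite /eminus max_r// !mulr0 expR0 subrr mulr0 addr0.
rewrite RintegralD// RintegralZl//; last exact: integrable_indic.
rewrite RintegralZl// RintegralB//; last first.
  apply: (@bounded_integrable _ _ _ P _ 1) => // w; exact: eminus_norm.
  by apply: (@bounded_integrable _ _ _ P _ 1) => // w; rewrite normr1.
by rewrite Rintegral_cst_prob.
Qed.

(** The inner integral of [kappa_bar], evaluated with
    [exp(-t) - exp(-a t - b x) =
     (exp(-t) - exp(-a t)) + exp(-a t) (1 - exp(-b x))]. *)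
Definition kappa_density (a b t : R) : R :=
  (expR (- 1 * t) - expR (- a * t)) * (pos_prob X t / t) + expR (- a * t) * gap_density X b t.

Lemma kappa_bar_real (a b : R) : 0 <= b ->
  kappa_bar X a%:C%C b%:C%C = (expR (\int[mu]_(t in `]0, +oo[) kappa_density a b t))%:C%C.
Proof.
move=> b0; rewrite /kappa_bar -cexp_real -cintegral_real; congr (cexp (cintegral _ _ _)).
apply/funext => t.
pose c := (expR (- 1 * t) - expR (- a * t)) / t; pose k := expR (- a * t) / t.
have E : kappa_density a b t = \int[distribution P (X t)]_(x in `]0, +oo[)
    ((expR (- t) - expR (- a * t - b * x)) / t).
  rewrite (_ : kappa_density a b t = c * pos_prob X t + k * gap X b t); last first.
    by rewrite /kappa_density /c /k /gap_density; ring.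
  rewrite -Rintegral_distribution_pos//; apply: eq_Rintegral => x.
  rewrite inE/= in_itv/= andbT => x0.
  rewrite /eminus max_l ?ltW// expRD -(mulNr b) /c /k mulN1r; ring.
rewrite E -cintegral_real; congr (cintegral _ _ _); apply/funext => x.
by rewrite rmorphM rmorphB/= -!cexp_real rmorphN rmorphB !rmorphM rmorphN.
Qed.

End kernel.

Section ratio.
Context {R : realType} {d : measure_display} {T : measurableType d} {P : probability T R}.
Variables (X : R -> {RV P >-> R}) (Q0 : {RV P >-> R}) (th q : R) (e : {RV P >-> \bar R}).
Hypothesis hX : levy_process X.
Hypothesis hlim : {ae P, forall w, X t w @[t --> +oo] --> -oo}.
Hypothesis hQ0_ge0 : forall w, 0 <= Q0 w.
Hypothesis hQ0_indep : independent_sets P (sigma_fun Q0) (sigma_process X).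
Hypothesis hQ0_law : same_law P (fun w => (Q0 w)%:E)
                          (fun w => overall_sup (fun t => X t w)).
Hypothesis th0 : 0 <= th.
Hypothesis q0 : 0 < q.
Hypothesis he : exponential_time P q e.
Hypothesis he_indep : independent_sets P (sigma_fun e) (sigma_process_fun X Q0).
Local Notation mu := (@lebesgue_measure R).
Local Notation half := (`[0, +oo[%classic : set R).
Local Notation g := (gap_density X th).
Local Notation A a := (\int[mu]_(t in half)
  ((expR (- 1 * t) - expR (- a * t)) * (pos_prob X t / t))).

Let ig : mu.-integrable half (EFin \o g).
Proof. exact: integrable_gap_density hX hQ0_ge0 hQ0_law th0. Qed.

Let ie a : 0 <= a -> mu.-integrable half (EFin \o (fun t => expR (- a * t) * g t)).
Proof.
move=> a0; apply: (le_integrable _ _ _ ig) => //.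
  apply/measurable_EFinP; apply: measurable_funM; first exact: measurable_expRN.
  by apply/measurable_EFinP; case/integrableP: ig.
move=> t /=; rewrite in_itv/= andbT => t0.
have g0 := gap_density_ge0 X th0 t0.
rewrite lee_fin normrM (ger0_norm g0) ger0_norm ?expR_ge0// ler_piMl//.
by rewrite -expR0 ler_expR mulNr oppr_le0 mulr_ge0.
Qed.

Let iA a : a = 0 \/ a = q ->
  mu.-integrable half (EFin \o (fun t => (expR (- 1 * t) - expR (- a * t)) * (pos_prob X t / t))).
Proof.
exact: (integrable_pos_prob_rate hX hlim hQ0_ge0 hQ0_indep hQ0_law q0 he he_indep).
Qed.

Let open_half f : mu.-integrable half (EFin \o f) ->
  \int[mu]_(t in `]0, +oo[) f t = \int[mu]_(t in half) f t.
Proof.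
move=> h; apply: Rintegral_itv_obnd_cbnd; apply: (integrableS _ _ _ h) => //.
by apply: subset_itvr; rewrite bnd_simp.
Qed.

Lemma kappa_exponent0 a : a = 0 \/ a = q ->
  \int[mu]_(t in `]0, +oo[) kappa_density X a 0 t = A a.
Proof.
move=> aq; rewrite -open_half; last exact: iA.
apply: eq_Rintegral => t _; rewrite /kappa_density /gap_density.
suff -> : gap X 0 t = 0 by rewrite mul0r mulr0 addr0.
rewrite /gap; under eq_Rintegral do rewrite /eminus oppr0 mul0r expR0.
by rewrite Rintegral_cst_prob subrr.
Qed.

Lemma kappa_exponent a : a = 0 \/ a = q ->
  \int[mu]_(t in `]0, +oo[) kappa_density X a th t =
  A a + \int[mu]_(t in half) (expR (- a * t) * g t).
Proof.
move=> aq; have a0 : 0 <= a by case: aq => -> //; exact: ltW.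
have iE := ie a0; have iAa := iA aq.
rewrite -RintegralD// open_half//.
have : mu.-integrable half (fun t =>
    (EFin \o (fun t => (expR (- 1 * t) - expR (- a * t)) * (pos_prob X t / t))%R) t +
    (EFin \o (fun t => expR (- a * t) * g t)%R) t)%E.
  exact: integrableD.
by apply: eq_integrable => // t _ /=; rewrite -EFinD.
Qed.

(** The terms with [pos_prob] depend on [a] only and cancel in the ratio. *)
Lemma kappa_exponents_telescope :
  \int[mu]_(t in `]0, +oo[) kappa_density X 0 0 t -
  \int[mu]_(t in `]0, +oo[) kappa_density X 0 th t +
  (\int[mu]_(t in `]0, +oo[) kappa_density X q th t -
   \int[mu]_(t in `]0, +oo[) kappa_density X q 0 t) =
  - \int[mu]_(t in half) ((1 - expR (- q * t)) * g t).
Proof.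
have telescope (x y u v : R) : x - (x + u) + (y + v - y) = - (u - v) by lra.
have l : 0 = 0 :> R \/ 0 = q by left.
have r : q = 0 \/ q = q by right.
rewrite (kappa_exponent0 l) (kappa_exponent0 r) (kappa_exponent l) (kappa_exponent r).
have -> : \int[mu]_(t in half) ((1 - expR (- q * t)) * g t) =
    \int[mu]_(t in half) (expR (- 0 * t) * g t) - \int[mu]_(t in half) (expR (- q * t) * g t).
  rewrite -RintegralB//; [|exact: ie|by apply: ie; exact: ltW].
  by apply: eq_Rintegral => t _; rewrite oppr0 mul0r expR0 mulrBl.
exact: telescope.
Qed.

End ratio.

Lemma running_inf_ge0 (R : realType) (f : R -> R) (s : \bar R) :
  (forall u, 0 <= u -> 0 <= f u) -> 0 <= running_inf f s.
Proof.
move=> f0; rewrite /running_inf; set A := [set f u | u in _].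
have [->|/set0P[y Ay]] := eqVneq A set0; first by rewrite inf0.
apply: lb_le_inf; first by exists y.
by move=> _ [u [u0 _] <-]; exact: f0.
Qed.

Local Open Scope complex_scope.

Lemma expR_complex_ratio (R : realType) (x y z w : R) :
  (expR x)%:C / (expR y)%:C * ((expR z)%:C / (expR w)%:C) = (expR (x - y + (z - w)))%:C.
Proof. by rewrite -!fmorph_div -rmorphM -!expRB -expRD. Qed.

Lemma kappa_bar_neq0 (R : realType) (d : measure_display) (T : measurableType d)
    (P : probability T R) (X : R -> {RV P >-> R}) (a b : R) : 0 <= b ->
  kappa_bar X a%:C b%:C != 0.
Proof.
by move=> b0; rewrite kappa_bar_real// fmorph_eq0 gt_eqF ?expR_gt0.
Qed.

Theorem proposition1 (R : realType) (d : measure_display)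
    (T : measurableType d) (P : probability T R)
    (X : R -> {RV P >-> R}) (Q0 : {RV P >-> R})
    (hX : levy_process X)
    (hlim : {ae P, forall w, X t w @[t --> +oo] --> -oo})
    (hQ0_ge0 : forall w, 0 <= Q0 w)
    (hQ0_indep : independent_sets P (sigma_fun Q0) (sigma_process X))
    (hQ0_law : same_law P (fun w => (Q0 w)%:E)
                          (fun w => overall_sup (fun t => X t w)))
    (theta q : R) (htheta : 0 <= theta) (hq : 0 <= q)
    (e : {RV P >-> \bar R})
    (he : exponential_time P q e)
    (he_indep : independent_sets P (sigma_fun e) (sigma_process_fun X Q0)) :
  (fine 'E_P[fun w => expR (- theta *
      running_inf (workload (Q0 w) (fun t => X t w)) (e w))])%:C =
  kappa_bar X 0 0 / kappa_bar X 0 theta%:C *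
  (kappa_bar X q%:C theta%:C / kappa_bar X q%:C 0).
Proof.
rewrite -[in RHS](rmorph0 (real_complex R)).
set f := fun w => expR _.
have f01 w : 0 <= f w <= 1.
  rewrite expR_ge0 -[leRHS]expR0 ler_expR mulNr oppr_le0 mulr_ge0//.
  by apply: running_inf_ge0 => u u0; apply: workload_ge0 => //; exact: levy_cadlag hX w.
have neq0 a b : 0 <= b -> kappa_bar X a%:C b%:C != 0 := @kappa_bar_neq0 _ _ _ _ X a b.
move: hq; rewrite le_eqVlt => /predU1P[q0|q0].
  rewrite -q0 mulrC mulrA divfK ?neq0// divff ?neq0//.
  have f1 : {ae P, forall w, f w = 1}.
    apply: filterS hlim => w hw; rewrite /f.
    move: he; rewrite /exponential_time -q0 eqxx => ->.
    by rewrite (running_inf_workload_pinfty (levy_cadlag hX w))// mulr0 expR0.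
  rewrite (@expectation_ae_eq _ _ _ P f (fun=> 1))//; first by rewrite Rintegral_cst_prob.
  by rewrite lexx ler01.
have {}f1 : {ae P, forall w, f w = expR (- theta *
    running_inf (workload (Q0 w) (fun t => X t w)) (time_part e w)%:E)}.
  by apply: filterS (exponential_time_ae q0 he) => w; rewrite /f => <-.
rewrite (@expectation_ae_eq _ _ _ P f _ _ f01 _ f1); last 2 first.
- exact: (measurable_killed_workload Q0 theta e hX).
- move=> w; rewrite expR_ge0 -[leRHS]expR0 ler_expR mulNr oppr_le0 mulr_ge0//.
  by apply: running_inf_ge0 => u u0; apply: workload_ge0 => //; exact: levy_cadlag hX w.
rewrite -[X in X%:C]/(killed_workload X Q0 theta e).
rewrite (killed_workload_exponent hX hQ0_ge0 hQ0_law htheta q0 hQ0_indep he he_indep).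
rewrite (kappa_bar_real X 0 (lexx 0)) (kappa_bar_real X 0 htheta) (kappa_bar_real X q htheta).
rewrite (kappa_bar_real X q (lexx 0)) expR_complex_ratio.
by rewrite (kappa_exponents_telescope hX hlim hQ0_ge0 hQ0_indep hQ0_law htheta q0 he he_indep).
Qed.
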